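(* Let $n\ge1$, $\alpha>0$, $1<p<n/\alpha$ and $0<q\le\infty$. Let $\Phi:[0,\infty)\to[0,\infty)$ be a function onto $[0,\infty)$, positive on $(0,\infty)$, which is equivalent to a strictly increasing function, such that $\Phi(0)=0$, for every $c>0$ one has $\Phi(cs)\approx\Phi(s)$ for all $s>0$ (with constants that may depend on $c$), and $$\int_0^s\left[\frac{\Phi(u)}{u^{n-\alpha p}}\right]^{1/p}\frac{du}{u}\prec\left[\frac{\Phi(s)}{s^{n-\alpha p}}\right]^{1/p}\quad\text{for all } s>0 .$$ Put $\Phi_\alpha(s)=\Phi\big(s^{\frac{1}{n-\alpha p}}\big)$. Then $$Cap^{\Phi_\alpha}(b^\alpha_{p,q})=C^\Phi .$$
   Context: Notation: $X\prec Y$ means $X\le cY$ with a finite constant $c>0$ independent of the variables in question; $X\approx Y$ means $X\prec Y$ and $Y\prec X$. Two functions $\Phi,\widetilde\Phi$ on $[0,\infty)$ are equivalent if $\Phi\approx\widetilde\Phi$. $\mathbf R^{n+1}_+=\mathbf R^n\times(0,\infty)$. For an open set $O\subset\mathbf R^n$ the tent over $O$ is $TO=\{(x,t)\in\mathbf R^{n+1}_+: x\in O,\ t<\mathrm{dist}(x,\partial O)\}$ (the distance is $+\infty$ if $\partial O=\emptyset$). Homogeneous Sobolev space $w^m_p$ ($m$ a positive integer): the closure of $C_0^\infty(\mathbf R^n)$ with respect to the norm $\|f\|_{w^m_p}=\sum_{|\kappa|=m}\|D^\kappa f\|_{L^p}$. Homogeneous Besov space: $b^\alpha_{p,q}=(L^p,w^m_p)_{\alpha/m,q}$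 with $0<\alpha<m$, where $(\cdot,\cdot)_{\theta,q}$ is the real interpolation method, i.e. $\|f\|_{(A_0,A_1)_{\theta,q}}=\big(\int_0^\infty(t^{-\theta}K(t,f))^q\,\frac{dt}{t}\big)^{1/q}$ (supremum if $q=\infty$), $K(t,f)=\inf_{f=f_0+f_1}(\|f_0\|_{A_0}+t\|f_1\|_{A_1})$. Capacity of an open set $O\subset\mathbf R^n$: $cap(O;b^\alpha_{p,q})=\inf\{\|f\|_{b^\alpha_{p,q}}^p: f\in\mathcal S,\ f\ge0,\ f(x)\ge1\text{ if }x\in O\}$, where $\mathcal S$ is the Schwartz class on $\mathbf R^n$ (infimum of the empty set is $+\infty$, and a condition of the form $\mu(TO)\prec\Phi(+\infty)$ is regarded as void). Classes of positive Borel measures $\mu$ on $\mathbf R^{n+1}_+$, for a positive function $\Theta$ on $(0,\infty)$ with $\Theta(0)=0$: $\mu\in Cap^{\Theta}(b^\alpha_{p,q})$ iff $\mu(TO)\prec\Theta(cap(O;b^\alpha_{p,q}))$ uniformly for all open sets $O\subset\mathbf R^n$; $\mu\in C^{\Theta}$ iff $\mu(TB_r)\prec\Theta(r)$ uniformly for all balls $B_r\subset\mathbf R^n$ of radius $r>0$. *)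

(* Defs.v *)
From HB Require Import structures.
From mathcomp Require Import all_boot all_order all_algebra.
From mathcomp Require Import all_classical all_reals all_analysis.
Import Order.TTheory GRing.Theory Num.Theory.
Import numFieldNormedType.Exports.

Set Implicit Arguments.
Unset Strict Implicit.
Unset Printing Implicit Defensive.

Local Open Scope classical_set_scope.
Local Open Scope ring_scope.

Definition prec_on (T : Type) (R : realType) (D : set T) (X Y : T -> \bar R) :=
  exists2 c : R, 0 < c & forall s, D s -> (X s <= c%:E * Y s)%E.

Definition approx_on (T : Type) (R : realType) (D : set T) (X Y : T -> \bar R) :=
  prec_on D X Y /\ prec_on D Y X.

Definition borel (T : ptopologicalType) := g_sigma_algebraType (@open T).

(* Lebesgue measure: the n-fold product of [lebesgue_measure] on n-tuples,
   transported to the Borel sets of 'rV[R]_n. *)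
Section tuple_lebesgue.
Variable R : realType.
Local Notation M := (measurableTypeR R).

Definition tcons n (z : M * n.-tuple M) : n.+1.-tuple M :=
  [tuple of z.1 :: z.2].

Definition tuncons n (t : n.+1.-tuple M) : M * n.-tuple M :=
  (thead t, [tuple of behead t]).

Lemma tconsK n : cancel (@tcons n) (@tuncons n).
Proof. by move=> [x t]; rewrite /tuncons theadE; congr pair; apply/val_inj. Qed.

Lemma measurable_tcons n : measurable_fun setT (@tcons n).
Proof. exact: measurable_cons. Qed.

Lemma measurable_tuncons n : measurable_fun setT (@tuncons n).
Proof.
apply: measurable_fun_pair; first exact: measurable_tnth.
exact: measurable_behead.
Qed.

Section cons_measure.
Variables (n : nat) (mu : {sigma_finite_measure set (n.-tuple M) -> \bar R}).

Definition cons_measure : set (n.+1.-tuple M) -> \bar R :=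
  pushforward (@lebesgue_measure R \x mu)%E (@tcons n).

Let cons_measure0 : cons_measure set0 = 0%E.
Proof. by rewrite /cons_measure /pushforward preimage_set0 measure0. Qed.

Let cons_measure_ge0 A : (0 <= cons_measure A)%E.
Proof. by apply: integral_ge0 => x _; exact: measure_ge0. Qed.

Let cons_measure_sigma_additive : semi_sigma_additive cons_measure.
Proof.
have mf := @measurable_tcons n.
exact: measure_semi_sigma_additive.
Qed.

HB.instance Definition _ := isMeasure.Build _ _ _ cons_measure
  cons_measure0 cons_measure_ge0 cons_measure_sigma_additive.

Let cons_measure_sigma_finite : sigma_finite setT cons_measure.
Proof.
have /sigma_finiteP[F [FT ndF mF]] := sigma_finiteT (@lebesgue_measure R).
have /sigma_finiteP[G [GT ndG mG]] := sigma_finiteT mu.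
exists (fun k => @tuncons n @^-1` (F k `*` G k)).
  apply/esym; rewrite -preimage_bigcup -subTset => t _ /=.
  have : (\bigcup_k F k) (tuncons t).1 by rewrite -FT.
  have : (\bigcup_k G k) (tuncons t).2 by rewrite -GT.
  move=> [j _ Gj] [i _ Fi]; exists (maxn i j) => //; split.
    by move: Fi; exact/subsetPset/ndF/leq_maxl.
  by move: Gj; exact/subsetPset/ndG/leq_maxr.
move=> k; have [mFk Fkoo] := mF k; have [mGk Gkoo] := mG k; split.
  rewrite -[X in measurable X]setTI; apply: measurable_tuncons => //.
  exact: measurableX.
rewrite /cons_measure /pushforward (_ : _ @^-1` _ = F k `*` G k).
  by rewrite product_measure1E// lte_mul_pinfty// ge0_fin_numE.
by rewrite -comp_preimage (_ : _ \o _ = id)//; apply/funext; exact: tconsK.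
Qed.

HB.instance Definition _ := Measure_isSigmaFinite.Build _ _ _ cons_measure
  cons_measure_sigma_finite.

End cons_measure.

Fixpoint tuple_lebesgue n : {sigma_finite_measure set (n.-tuple M) -> \bar R} :=
  match n with
  | 0%N => \d_([tuple] : 0.-tuple M)
  | k.+1 => cons_measure (tuple_lebesgue k)
  end.

Definition row_of_tuple n (t : n.-tuple M) : 'rV[R]_n := \row_i tnth t i.

Lemma measurable_row_of_tuple n :
  measurable_fun setT (@row_of_tuple n : _ -> borel 'rV[R]_n).
Proof.
apply: (@measurability _ _ _ (borel _) setT _ (@open ('rV[R]_n))) => //.
move=> _ [U oU <-].
rewrite setTI.
pose c (z : {ffun 'I_n -> rat}) : 'rV[R]_n := \row_i ratr (z i).
pose B (z : {ffun 'I_n -> rat} * nat) := ball (c z.1) (z.2.+1%:R^-1 : R).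
pose F z := if `[< B z `<=` U >] then @row_of_tuple n @^-1` B z else set0.
suff -> : @row_of_tuple n @^-1` U = \bigcup_z F z.
  apply: countable_bigcupT_measurable => [|z]; first exact: countableP.
  rewrite /F; case: ifPn => _; last exact: measurable0.
  rewrite (_ : _ @^-1` _ =
    \bigcap_(i in [set: 'I_n]) ((fun t : n.-tuple M => tnth t i) @^-1`
       (ball (c z.1 ord0 i) (z.2.+1%:R^-1 : R)))).
    apply: fin_bigcap_measurable; first exact: finite_finset.
    move=> i _; rewrite -[X in measurable X]setTI.
    by apply: measurable_tnth => //; exact: measurable_realfun.measurable_ball.
  apply/seteqP; split => t /=.
    by move=> [_ h] i _; have := h ord0 i; rewrite !mxE.
  move=> h; split=> [|i j]; first by rewrite invr_gt0.
  by rewrite ord1; have := h j I; rewrite !mxE.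
apply/seteqP; split => [t Ut|t [z _]]; last first.
  by rewrite /F; case: asboolP => // BU /BU.
have [e /= e0 eU] : exists2 e : R, 0 < e & ball (row_of_tuple t) e `<=` U.
  have /nbhs_ballP[e /= e0 eU] : nbhs (row_of_tuple t) U by exact: open_nbhs_nbhs.
  by exists e.
pose k := Num.truncn (2 / e).
pose d : R := k.+1%:R^-1.
have d0 : 0 < d by rewrite invr_gt0.
have de : d + d <= e.
  rewrite -mulr2n -mulr_natr mulrC ler_pdivrMr// mulrC -ler_pdivrMr//.
  by rewrite ltW// truncnS_gt.
have q i : {q : rat | ratr q \in `]tnth t i - d, tnth t i + d[}.
  apply/cid/rat_in_itvoo.
  by rewrite ltrBlDr -addrA ltrDl addr_gt0.
pose z := [ffun i => sval (q i)].
have zt : B (z, k) (row_of_tuple t).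
  split => // i j; rewrite !mxE ffunE; case: (q j) => /= r.
  by rewrite in_itv/= /ball/= ltr_distlC ltrBlDr ltrBlDr andbC.
exists (z, k) => //; rewrite /F asboolT// => s zs; apply: eU.
apply: le_ball de _ _; apply: ball_triangle zs.
exact: ball_sym.
Qed.

End tuple_lebesgue.

Section lebesgue.
Variables (R : realType) (n : nat).

Definition lebesgue : set (borel 'rV[R]_n) -> \bar R :=
  pushforward (tuple_lebesgue R n) (@row_of_tuple R n : _ -> borel 'rV[R]_n).

Let lebesgue0 : lebesgue set0 = 0%E.
Proof. by rewrite /lebesgue /pushforward preimage_set0 measure0. Qed.

Let lebesgue_ge0 A : (0 <= lebesgue A)%E.
Proof. by rewrite /lebesgue /pushforward; exact: measure_ge0. Qed.

Let lebesgue_sigma_additive : semi_sigma_additive lebesgue.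
Proof.
have mf := @measurable_row_of_tuple R n.
exact: measure_semi_sigma_additive.
Qed.

HB.instance Definition _ := isMeasure.Build _ _ _ lebesgue
  lebesgue0 lebesgue_ge0 lebesgue_sigma_additive.

End lebesgue.

Section smooth_functions.
Variables (R : realType) (n : nat).
Implicit Types (f : 'rV[R]_n -> R) (k : 'I_n -> nat) (x : 'rV[R]_n).

Definition partial (i : 'I_n) f : 'rV[R]_n -> R :=
  fun x => 'D_(delta_mx ord0 i) f x.

Definition iter_partial (s : seq 'I_n) f : 'rV[R]_n -> R :=
  foldr partial f s.

Definition smooth f := forall s : seq 'I_n,
  continuous (iter_partial s f) /\
  forall x i, derivable (iter_partial s f) x (delta_mx ord0 i).

Definition multi_partial k f : 'rV[R]_n -> R :=
  iter_partial (flatten [seq nseq (k i) i | i <- enum 'I_n]) f.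

Definition test_function : set ('rV[R]_n -> R) :=
  [set f | smooth f /\ compact (closure [set x | f x != 0])].

Definition schwartz : set ('rV[R]_n -> R) :=
  [set f | smooth f /\ forall b k : 'I_n -> nat, exists C : R, forall x,
     `|(\prod_i x ord0 i ^+ b i) * multi_partial k f x| <= C].

End smooth_functions.

Section function_spaces.
Variables (R : realType) (n : nat).
Local Notation Rn := ('rV[R]_n).
Local Notation mu := (@lebesgue R n).
Implicit Types (f g h : Rn -> R) (p t theta : R) (q : \bar R) (m : nat).

Definition Lp_norm p f : \bar R :=
  'N[mu]_(p%:E)[EFin \o (f : borel Rn -> R)].

Definition Lp_space p : set (Rn -> R) :=
  [set f | measurable_fun setT (f : borel Rn -> R) /\ (Lp_norm p f < +oo)%E].

Definition loc_integrable f := forall K : set Rn, compact K ->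
  mu.-integrable K (EFin \o (f : borel Rn -> R)).

Definition is_weak_deriv (k : 'I_n -> nat) g h :=
  [/\ loc_integrable g, loc_integrable h &
      forall phi, @test_function R n phi ->
        (\int[mu]_x (g x * multi_partial k phi x)%:E =
         ((-1) ^+ (\sum_i k i)%N)%:E * \int[mu]_x (h x * phi x)%:E)%E].

(* Some weak derivative (it is unique up to a null set), or 0 if there is
   none. *)
Definition weak_deriv (k : 'I_n -> nat) g : Rn -> R :=
  xget (cst 0) [set h | is_weak_deriv k g h].

(* The multi-indices of length m, with entries bounded by m so as to be a
   finite type. *)
Definition order_eq m : pred {ffun 'I_n -> 'I_m.+1} :=
  [pred k : {ffun 'I_n -> 'I_m.+1} | (\sum_i k i == m)%N].

Definition sobolev_norm m p g : \bar R :=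
  (\sum_(k : {ffun 'I_n -> 'I_m.+1} | order_eq k)
     Lp_norm p (weak_deriv (fun i => k i) g))%E.

(* The closure of the test functions is taken among the functions all of whose
   weak derivatives of order m exist and are in L^p. *)
Definition sobolev_space m p : set (Rn -> R) :=
  [set g |
    (forall k : {ffun 'I_n -> 'I_m.+1}, order_eq k ->
       exists2 h, is_weak_deriv (fun i => k i) g h & Lp_space p h) /\
    (forall e : R, 0 < e -> exists2 phi, @test_function R n phi &
       (sobolev_norm m p (g \- phi)%R < e%:E)%E)].

Definition K_functional (A0 A1 : set (Rn -> R)) (N0 N1 : (Rn -> R) -> \bar R)
    t f : \bar R :=
  ereal_inf [set (N0 z.1 + t%:E * N1 z.2)%E | z in
    [set z : (Rn -> R) * (Rn -> R) | [/\ A0 z.1, A1 z.2 & f = z.1 \+ z.2]]].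

(* The last branch is never used: the exponent q is positive. *)
Definition interpolation_norm (A0 A1 : set (Rn -> R))
    (N0 N1 : (Rn -> R) -> \bar R) theta q f : \bar R :=
  let F t := ((t `^ (- theta))%:E * K_functional A0 A1 N0 N1 t f)%E in
  match q with
  | r%:E =>
    ((\int[lebesgue_measure]_(t in `]0%R, +oo[) (F t `^ r * t^-1%:E)) `^ r^-1)%E
  | +oo%E => ereal_sup [set F t | t in `]0, +oo[]
  | -oo%E => 0%E
  end.

Definition besov_norm m (alpha p : R) q f : \bar R :=
  interpolation_norm (Lp_space p) (sobolev_space m p)
    (Lp_norm p) (sobolev_norm m p) (alpha / m%:R) q f.

Definition besov_capacity m (alpha p : R) q (O : set Rn) : \bar R :=
  ereal_inf [set (besov_norm m alpha p q f `^ p)%E | f in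
    [set f | [/\ @schwartz R n f, forall x, 0 <= f x &
                 forall x, O x -> 1 <= f x]]].

End function_spaces.

Section half_space.
Variables (R : realType) (n : nat).

(* 'rV[R]_n carries the sup norm in the library; distances and balls are
   Euclidean. *)
Definition eucl_dist (x y : 'rV[R]_n) : R :=
  Num.sqrt (\sum_i (x ord0 i - y ord0 i) ^+ 2).

Definition eucl_ball (x : 'rV[R]_n) (r : R) : set 'rV[R]_n :=
  [set y | eucl_dist x y < r].

Definition boundary (A : set 'rV[R]_n) : set 'rV[R]_n := closure A `\` A^°.

Definition set_dist (x : 'rV[R]_n) (A : set 'rV[R]_n) : \bar R :=
  ereal_inf [set (eucl_dist x y)%:E | y in A].

Definition half_space : Type :=
  set_type [set z : 'rV[R]_n * R | 0 < z.2].

HB.instance Definition _ := Topological.on half_space.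

Definition half_space_point : half_space.
Proof. by exists (0, 1); rewrite inE/=. Defined.

HB.instance Definition _ := isPointed.Build half_space half_space_point.

Definition tent (O : set 'rV[R]_n) : set half_space :=
  [set z | O (set_val z).1 /\
           ((set_val z).2%:E < set_dist (set_val z).1 (boundary O))%E].

Local Notation measures := ({measure set (borel half_space) -> \bar R}).

Definition Cap_class (cap : set 'rV[R]_n -> \bar R) (Theta : R -> R) :
    set measures :=
  [set nu : measures | prec_on [set O | open O /\ (cap O < +oo)%E]
     (fun O => nu (tent O)) (fun O => (Theta (fine (cap O)))%:E)].

Definition C_class (Theta : R -> R) : set measures :=
  [set nu : measures | prec_on [set b : 'rV[R]_n * R | 0 < b.2]
     (fun b => nu (tent (eucl_ball b.1 b.2))) (fun b => (Theta b.2)%:E)].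

End half_space.

(* Main.v *)
Require Import Defs.
From HB Require Import structures.
From mathcomp Require Import all_boot all_order all_algebra.
From mathcomp Require Import all_classical all_reals all_analysis.
From mathcomp Require Import measurable_realfun ring lra.
Import Order.TTheory GRing.Theory Num.Theory.
Import numFieldNormedType.Exports.
Import HBNNSimple.
Local Open Scope classical_set_scope.
Local Open Scope ring_scope.

(** Write d for n - alpha p, and K(t, f) for the K-functional of the couple (L^p, w^m_p).

    From capacities to balls.  Rescaling one smooth bump shows that a ball of radius r has
    capacity at most C r^d ([besov_capacity_ball]), so testing the capacitary condition on
    balls gives the ball condition, because Phi_alpha (C r^d) is comparable to Phi r.  The
    K-functional of the bump is at most a multiple of r^(n/p) min (1, t / r^m), through its
    two trivial decompositions.  Since weak derivatives are chosen by a choice operator,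
    this needs that they agree almost everywhere with the classical ones:
    integration by parts ([classical_weak_deriv]) and uniqueness ([weak_deriv_unique]).

    From balls to capacities.  Let f be admissible for O with Besov norm at most M; it is
    enough to bound the measure of the tent over O by a multiple of Phi (M^(p/d)).  If
    (x, t) is in the tent, then f >= 1 on the ball of radius t about x, so an average of f at
    x on a scale comparable to t is bounded below; averages tend to 0 as the scale grows.
    Hence the differences between averages on consecutive dyadic scales cannot all be small.
    The averaging kernels are chosen so that the difference of two consecutive ones is a sum
    of pure m-th partial derivatives of bounded functions supported near x
    ([multiscale_kernels], [kern_difference]).  So, if f = g + h is a nearly optimal
    decomposition for K(s^m, f), the difference at x on scale s is controlled by g and by the
    m-th weak derivatives of h on a ball B(x, C s) ([average_difference]).  The total mass
    available is of order (s^alpha M)^p.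

    With s_j = 2^-j A M^(p/d), the scales from s_0 upwards contribute at most a quarter of
    the lower bound, so for each (x, t) in the tent some difference on a scale s_j not much
    smaller than t exceeds a multiple of r^j.  Comparing masses, the centres x that occur for a
    given j are covered by at most C r^(-jp) s_j^(-d) M^p balls of radius C s_j
    ([tent_covering]), and the tent over O is covered by the tents over these balls.  The
    integral condition on Phi forces (Phi s_j / s_j^d)^(1/p) to decay like rho^j for some
    rho < 1 ([gauge_decay]).  With r = sqrt rho the sum over j of the number of balls times
    Phi (s_j) is a convergent geometric series, bounded by a multiple of
    Phi (A M^(p/d)) ([tent_measure_le]).  Finally M^p is taken at most twice the capacity;
    if the capacity is 0, M is arbitrarily small, and Phi takes arbitrarily small values. *)

Set Implicit Arguments.
Unset Strict Implicit.
Unset Printing Implicit Defensive.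

(** * Smooth functions of one variable *)

Section towers.
Variable R : realType.
Implicit Types (D E : nat -> R -> R) (f g : R -> R).

Definition hasderiv f (x d : R) := is_derive x (1 : R) f d.

(** A smooth function together with the sequence of its derivatives.  Carrying the
    derivatives explicitly makes those of rescaled functions and of tensor products
    computable, whereas iterating a derivative operator would need a differentiability
    proof at each step. *)
Definition tower D := forall k x, hasderiv (D k) x (D k.+1 x).

Lemma hasderiv_ext f g x d : f =1 g -> hasderiv f x d -> hasderiv g x d.
Proof. by move=> /funext ->. Qed.

Lemma hasderiv_near f g x d : (\near x, f x = g x) -> hasderiv f x d -> hasderiv g x d.
Proof. by move=> h; exact: near_eq_is_derive. Qed.

Lemma hasderivD f g x d e : hasderiv f x d -> hasderiv g x e ->
  hasderiv (fun y => f y + g y) x (d + e).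
Proof. by move=> h h'; exact: is_deriveD. Qed.

Lemma hasderivMc f (a x d : R) : hasderiv f x d -> hasderiv (fun y => a * f y) x (a * d).
Proof. by move=> h; exact: is_deriveZ. Qed.

Lemma hasderivM f g x d e : hasderiv f x d -> hasderiv g x e ->
  hasderiv (fun y => f y * g y) x (d * g x + f x * e).
Proof.
move=> h h'; apply: (is_derive_eq (is_deriveM h h')).
by rewrite addrC /GRing.scale/= [g x * d]mulrC.
Qed.

Lemma hasderiv_cst (a x : R) : hasderiv (fun=> a) x 0.
Proof. exact: is_derive_cst. Qed.

Lemma hasderiv_id (x : R) : hasderiv id x 1.
Proof. exact: is_derive_id. Qed.

Lemma hasderiv_comp f g x d e : hasderiv f (g x) d -> hasderiv g x e ->
  hasderiv (fun y => f (g y)) x (d * e).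
Proof. by move=> h h'; exact: is_derive1_comp. Qed.

Lemma hasderiv_sum I (s : seq I) (F : I -> R -> R) (d : I -> R) x :
  (forall i, hasderiv (F i) x (d i)) ->
  hasderiv (fun y => \sum_(i <- s) F i y) x (\sum_(i <- s) d i).
Proof.
move=> h; elim: s => [|i s IH].
  by rewrite big_nil; apply: hasderiv_ext (hasderiv_cst 0 x) => y; rewrite big_nil.
rewrite big_cons; apply: hasderiv_ext (hasderivD (h i) IH) => y.
by rewrite big_cons.
Qed.

Lemma hasderiv_continuous f x d : hasderiv f x d -> {for x, continuous f}.
Proof.
move=> [df _]; apply: differentiable_continuous; exact/derivable1_diffP.
Qed.

Lemma tower_continuous D k : tower D -> continuous (D k).
Proof. by move=> tD x; exact: hasderiv_continuous (tD k x). Qed.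

Lemma tower_shift D k : tower D -> tower (fun j => D (j + k)%N).
Proof. by move=> tD j x; exact: tD. Qed.

Definition rescale (x s : R) D : nat -> R -> R :=
  fun k v => s^-1 ^+ k * D k ((v - x) * s^-1).

Lemma tower_rescale x s D : tower D -> tower (rescale x s D).
Proof.
move=> tD k v; rewrite /rescale exprSr -mulrA; apply: hasderivMc.
rewrite mulrC; apply: (@hasderiv_comp (D k) (fun v => (v - x) * s^-1)) => //.
apply: (@hasderiv_ext (fun v => s^-1 * (v + - x))); first by move=> y; rewrite mulrC.
rewrite -[X in hasderiv _ _ X]mulr1; apply: hasderivMc.
rewrite -[1]addr0; apply: hasderivD; [exact: hasderiv_id|exact: hasderiv_cst].
Qed.

Lemma tower_sum I (s : seq I) (a : I -> R) (D : I -> nat -> R -> R) :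
  (forall i, tower (D i)) -> tower (fun k v => \sum_(i <- s) a i * D i k v).
Proof. by move=> tD k v; apply: hasderiv_sum => i; apply: hasderivMc; exact: tD. Qed.

Lemma towerB D E : tower D -> tower E -> tower (fun k v => D k v - E k v).
Proof.
move=> tD tE k v; rewrite -[X in hasderiv _ _ (_ + X)]mulN1r.
apply: (@hasderiv_ext (fun v => D k v + -1 * E k v)).
  by move=> y; rewrite mulN1r.
by apply: hasderivD; [exact: tD|apply: hasderivMc; exact: tE].
Qed.

Fixpoint ntimes_derivable k f : Prop :=
  if k is j.+1 then exists2 g, (forall x, hasderiv f x (g x)) & ntimes_derivable j g else True.

Lemma ntimes_derivableW k f : ntimes_derivable k.+1 f -> ntimes_derivable k f.
Proof.
elim: k f => [//|k IH] f /= [g fg gk]; exists g => //.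
exact: IH.
Qed.

Lemma ntimes_derivableD k f g : ntimes_derivable k f -> ntimes_derivable k g -> ntimes_derivable k (fun x => f x + g x).
Proof.
elim: k f g => [//|k IH] f g /= [f' ff' kf'] [g' gg' kg'].
exists (fun x => f' x + g' x); last exact: IH.
by move=> x; exact: hasderivD.
Qed.

Lemma ntimes_derivableM k f g : ntimes_derivable k f -> ntimes_derivable k g -> ntimes_derivable k (fun x => f x * g x).
Proof.
elim: k f g => [//|k IH] f g fk gk.
have [f' ff' kf'] := fk; have [g' gg' kg'] := gk.
exists (fun x => f' x * g x + f x * g' x).
  by move=> x; exact: hasderivM.
by apply: ntimes_derivableD; apply: IH => //; exact: ntimes_derivableW.
Qed.

Lemma tower_ntimes_derivable D j k : tower D -> ntimes_derivable k (D j).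
Proof.
move=> tD; elim: k j => [//|k IH] j /=; exists (D j.+1); last exact: IH.
exact: tD.
Qed.

(** Products are easier to differentiate without naming the higher derivatives; this
    returns from the unnamed derivatives to a tower. *)
Lemma ntimes_derivable_tower f : (forall k, ntimes_derivable k f) -> exists2 D, tower D & D 0%N = f.
Proof.
move=> fC; exists (fun k => f^`(k)%classic) => //.
have C k j : ntimes_derivable j (f^`(k)%classic).
  elim: k j => [|k IH] j; first exact: fC.
  have [g fg gC] := IH j.+1.
  suff -> : f^`(k.+1)%classic = g by [].
  rewrite derive1nS; apply/funext => x; rewrite derive1E.
  exact: (@derive_val _ _ _ _ _ _ _ (fg x)).
move=> k x; have [g fg _] := C k 1%N.
suff -> : f^`(k.+1)%classic x = g x by exact: fg.
rewrite derive1nS derive1E.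
exact: (@derive_val _ _ _ _ _ _ _ (fg x)).
Qed.

Lemma tower_mul D E : tower D -> tower E ->
  exists2 F, tower F & F 0%N = (fun x => D 0%N x * E 0%N x).
Proof.
by move=> tD tE; apply: ntimes_derivable_tower => k; apply: ntimes_derivableM; exact: tower_ntimes_derivable.
Qed.

(** The functions q(1/x) exp(-1/x) for x > 0, extended by 0, are stable under
    differentiation; q = 1 is the standard function that is flat at the origin. *)
Definition flat (q : {poly R}) (x : R) : R :=
  if 0 < x then q.[x^-1] * expR (- x^-1) else 0.

Lemma poly_expR_bound (q : {poly R}) : exists C : R, forall y, 0 <= y ->
  `|q.[y]| <= C * expR y.
Proof.
exists (\sum_(i < size q) `|q`_i| * (i`!%:R)) => y y0.
rewrite horner_coef mulr_suml (le_trans (ler_norm_sum _ _ _))//.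
apply: ler_sum => i _; rewrite normrM -mulrA ler_wpM2l//.
rewrite ger0_norm ?exprn_ge0//; case: {i}(nat_of_ord i) => [|i].
  by rewrite expr0 fact0 mul1r -{1}expR0 ler_expR.
have h : y ^+ i.+1 / i.+1`!%:R <= expR y.
  by apply: le_trans (expR_ge1Dxn i y0); rewrite lerDr.
by move: h; rewrite ler_pdivrMr ?ltr0n ?fact_gt0// mulrC.
Qed.

(** At the origin, the difference quotient at h > 0 is q(1/h) exp(-1/h) / h, which is
    O(h) because y^2 q(y) is dominated by exp(y). *)
Lemma flat_deriv (q : {poly R}) x :
  hasderiv (flat q) x (flat ('X^2 * (q - q^`())) x).
Proof.
have [x0|x0|->] := ltgtP x 0.
- have -> : flat ('X^2 * (q - q^`())) x = 0 by rewrite /flat lt_gtF.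
  apply: hasderiv_near (hasderiv_cst 0 x); near=> y.
  have : y < 0 by near: y; exact: lt_nbhsl.
  by move=> y0; rewrite /flat lt_gtF.
- apply: (@hasderiv_near (fun x => q.[x^-1] * expR (- x^-1))).
    near=> y; have y0 : 0 < y by near: y; exact: lt_nbhsr.
    by rewrite /flat y0.
  rewrite /flat x0.
  have dV : hasderiv (fun y => y^-1) x (- (x^-1 ^+ 2)).
    have xn0 : x != 0 by rewrite gt_eqF.
    have did : derivable (id : R -> R) x 1 by exact: derivable_id.
    apply: DeriveDef; first exact: (derivableV (f := id) xn0 did).
    by rewrite (deriveV (f := id) xn0 did) derive_id /GRing.scale/= mulr1 exprVn.
  have dq : hasderiv (fun y => q.[y^-1]) x (q^`().[x^-1] * - (x^-1 ^+ 2)).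
    by apply: hasderiv_comp dV; exact: is_derive_poly.
  have dNV : hasderiv (fun y => - y^-1) x (x^-1 ^+ 2).
    rewrite -[x^-1 ^+ 2]opprK -mulN1r.
    apply: (@hasderiv_ext (fun y => -1 * y^-1)); last exact: hasderivMc.
    by move=> y; rewrite mulN1r.
  have de : hasderiv (fun y => expR (- y^-1)) x (expR (- x^-1) * (x^-1 ^+ 2)).
    by apply: hasderiv_comp dNV; exact: is_derive_expR.
  apply: is_derive_eq (hasderivM dq de) _.
  by rewrite !hornerE/=; ring.
- have -> : flat ('X^2 * (q - q^`())) 0 = 0 by rewrite /flat ltxx.
  have [C qC] := poly_expR_bound ('X^2 * q).
  have C0 : 0 <= C.
    by have := qC 0 (lexx _); rewrite expR0 mulr1; exact: le_trans.
  have bnd h : `|h^-1 * flat q h| <= C * `|h|.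
    rewrite /flat; case: ifPn => h0; last by rewrite mulr0 normr0 mulr_ge0.
    have hV0 : 0 <= h^-1 by rewrite invr_ge0 ltW.
    have qE : ('X^2 * q).[h^-1] = h^-1 * (h^-1 * q.[h^-1]).
      by rewrite !hornerE/=; ring.
    have := qC _ hV0; rewrite qE !normrM (gtr0_norm h0) (ger0_norm hV0).
    rewrite (ger0_norm (expR_ge0 _)) expRN => H.
    rewrite mulrA ler_pdivrMr ?expR_gt0// mulrAC -ler_pdivrMr//.
    by rewrite mulrC.
  have cv : (fun h : R => h^-1 *: (flat q (h *: (1 : R) + 0) - flat q 0)) @ 0^' --> (0 : R).
    apply/cvgrPdist_le => e e0; near=> h.
    rewrite sub0r normrN /GRing.scale/= mulr1 addr0 [flat q 0]/flat ltxx subr0.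
    apply: le_trans (bnd h) _.
    have : `|h| <= e / (C + 1).
      near: h; apply: dnbhs0_le; rewrite divr_gt0// ltr_wpDl//.
    rewrite ler_pdivlMr ?ltr_wpDl// => /(le_trans _); apply.
    by rewrite mulrC ler_wpM2l// lerDl.
  apply: DeriveDef; first by apply/cvg_ex; exists (0 : R).
  by apply: cvg_lim.
Unshelve. all: by end_near. Qed.

Lemma flat_tower : exists2 D, tower D & D 0%N = flat 1.
Proof.
pose q := fix q k : {poly R} :=
  if k is j.+1 then 'X^2 * (q j - (q j)^`()) else 1.
exists (fun k => flat (q k)) => // k x; exact: flat_deriv.
Qed.

(** The product of the flat functions of 1 + v and 1 - v. *)
Lemma bump_tower : exists D, [/\ tower D, forall v, 0 <= D 0%N v,
  forall k v, 1 <= `|v| -> D k v = 0 &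
  exists2 c : R, 0 < c & forall v, `|v| <= 2^-1 -> c <= D 0%N v].
Proof.
have [E tE E0] := flat_tower.
have [F tF F0] := tower_mul (tower_rescale (-1) 1 tE) (tower_rescale 1 (-1) tE).
have FE v : F 0%N v = flat 1 (1 + v) * flat 1 (1 - v).
  rewrite F0 /rescale !expr0 !mul1r E0 invr1 mulr1 invrN1 mulrN1; congr (flat _ _ * flat _ _); ring.
have flat0 v : 0 <= flat 1 v.
  by rewrite /flat; case: ifP => // _; rewrite hornerE mul1r expR_ge0.
have Fout v : 1 <= `|v| -> F 0%N v = 0.
  move=> v1; rewrite FE /flat; case: ifPn => h; last by rewrite mul0r.
  case: ifPn => h'; last by rewrite mulr0.
  have : `|v| < 1 by rewrite ltr_norml; apply/andP; split; lra.
  by rewrite ltNge v1.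
exists F; split => //.
- by move=> v; rewrite FE mulr_ge0.
- have Fopen k v : 1 < `|v| -> F k v = 0.
    elim: k v => [|k IH] v v1; first by apply: Fout; exact: ltW.
    have h : hasderiv (F k) v 0.
      apply: hasderiv_near (hasderiv_cst 0 v).
      have nv : \near v, 1 < `|v|.
        have /cvgr_gt : (fun y : R => `|y|) y @[y --> v] --> `|v|.
          exact: norm_continuous.
        exact.
      near=> y; apply/esym/IH; near: y; exact: nv.
    have h' := tF k v.
    by rewrite -(@derive_val _ _ _ _ _ _ _ h') (@derive_val _ _ _ _ _ _ _ h).
  move=> k v; rewrite le_eqVlt => /orP[/eqP v1|]; last exact: Fopen.
  apply/eqP; rewrite -normr_eq0 eq_le normr_ge0 andbT.
  have Fc := @tower_continuous _ k tF v.
  apply/ler_addgt0Pl => e e0; rewrite addr0.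
  have /cvgrPdist_le/(_ e e0) := Fc.
  move=> [d /= d0 H].
  have s0 : `|v + v * (d / 2) | > 1.
    rewrite -{1}[v]mulr1 -mulrDr normrM -v1 mul1r.
    by rewrite gtr0_norm ?ltrDl ?addr_gt0 ?divr_gt0.
  have := H (v + v * (d / 2)); rewrite (Fopen _ _ s0) subr0; apply.
  rewrite /= opprD addNKr normrN normrM -v1 mul1r gtr0_norm ?divr_gt0//.
  by rewrite ltr_pdivrMr// ltr_pMr// ltr1n.
- exists (expR (- 2) * expR (- 2)); first by rewrite mulr_gt0 ?expR_gt0.
  move=> v v2; rewrite FE.
  have h w : 2^-1 <= w -> expR (-2) <= flat 1 w.
    move=> w2; have w0 : 0 < w by apply: lt_le_trans w2; rewrite invr_gt0.
    rewrite /flat w0 hornerE mul1r ler_expR lerN2.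
    by rewrite -[leRHS]invrK lef_pV2// posrE ?invr_gt0.
  move: v2; rewrite ler_norml => /andP[a b].
  by apply: ler_pM; rewrite ?expR_ge0//; apply: h; lra.
Unshelve. all: by end_near. Qed.

End towers.

(** * Iterated primitives *)

Section primitives.
Variable R : realType.
Implicit Types (D E : nat -> R -> R) (f g : R -> R).

Lemma primitive f : continuous f -> (forall v, v <= -1 -> f v = 0) ->
  exists2 F, (forall x, hasderiv F x (f x)) & forall v, v <= -1 -> F v = 0.
Proof.
move=> cf f0; pose mu := @lebesgue_measure R.
pose F x := (\int[mu]_(t in `[-2, x]) f t)%R.
have F0 v : v <= -1 -> F v = 0.
  move=> v1; rewrite /F /Rintegral (eq_integral (cst 0%E)) ?integral_cst//.
    by rewrite mul0e.
  move=> t; rewrite inE/= in_itv/= => /andP[_ tv].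
  by rewrite f0// (le_trans tv).
exists F => // x; have [x2|x2] := ltP (-2) x.
  have [] := @continuous_FTC1_closed R f (-2) x (x + 1) _ _ x2 (cf x).
  - by rewrite ltrDl.
  - apply: continuous_compact_integrable; first exact: segment_compact.
    by apply: continuous_subspaceT.
  by move=> dF F'; apply: DeriveDef => //; rewrite -derive1E.
have -> : f x = 0 by apply: f0; apply: le_trans x2 _; lra.
apply: hasderiv_near (hasderiv_cst 0 x); near=> y; rewrite F0//.
apply: ltW; near: y; apply: lt_nbhsl; apply: le_lt_trans x2 _; lra.
Unshelve. all: by end_near. Qed.

Lemma tower_primitive D : tower D -> (forall v, v <= -1 -> D 0%N v = 0) ->
  exists E, [/\ tower E, forall k, E k.+1 = D k & forall v, v <= -1 -> E 0%N v = 0].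
Proof.
move=> tD D0; have [F dF F0] := primitive (tower_continuous tD) D0.
exists (fun k => if k is j.+1 then D j else F); split => // -[|k] x //=.
Qed.

Lemma hasderiv_const_ray (a : R) f : (forall x, a <= x -> hasderiv f x 0) ->
  forall x, a <= x -> f x = f a.
Proof.
move=> df x; rewrite le_eqVlt => /orP[/eqP->//|ax].
have [||c _ E] := @MVT_segment _ f (fun=> 0) _ _ (ltW ax).
- move=> y; rewrite in_itv/= => /andP[ay _]; apply: df; exact: ltW.
- apply: derivable_within_continuous => y; rewrite in_itv/= => /andP[ay _].
  by have [] := df y ay.
by apply/eqP; rewrite -subr_eq0 E mul0r.
Qed.

Lemma poly_primitive (q : {poly R}) : exists2 Q : {poly R}, Q^`() = q &
  (size Q <= (size q).+1)%N.
Proof.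
exists (\poly_(i < (size q).+1) (q`_i.-1 / i%:R)); last exact: size_poly.
apply/polyP => i; rewrite coef_deriv coef_poly/= ltnS.
case: ltnP => [_|h]; last by rewrite nth_default// mul0rn.
by rewrite -[_ *+ _]mulr_natr divfK// pnatr_eq0.
Qed.

(** To the right of the support of the function, its m-fold primitive satisfies
    E^(m) = 0, hence is a polynomial of degree less than m.  Lagrange interpolation cancels
    this polynomial part in [multiscale_kernels]. *)
Lemma iterated_primitive D m : tower D -> (forall v, 1 <= `|v| -> D 0%N v = 0) ->
  exists E (q : {poly R}), [/\ tower E, forall k, E (m + k)%N = D k,
    forall v, v <= -1 -> E 0%N v = 0,
    forall v, 1 <= v -> E 0%N v = q.[v] & (size q <= m)%N].
Proof.
move=> tD D0; elim: m => [|m [E [q [tE ED E0 Eq sq]]]].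
  exists D, 0; split => //.
  - by move=> v v1; apply: D0; rewrite ler_normr; apply/orP; right; lra.
  - by move=> v v1; rewrite horner0; apply: D0; rewrite ler_normr v1.
  - by rewrite size_poly0.
have [F [tF FE F0]] := tower_primitive tE E0.
have [Q Qq sQ] := poly_primitive q.
exists F, (Q + (F 0%N 1 - Q.[1])%:P); split => //.
- by move=> k; rewrite addSn FE ED.
- move=> v v1; rewrite hornerD hornerC.
  suff : F 0%N v - Q.[v] = F 0%N 1 - Q.[1] by lra.
  apply: (@hasderiv_const_ray 1 (fun v => F 0%N v - Q.[v])) => // x x1.
  have -> : (fun v => F 0%N v - Q.[v]) = (fun v => F 0%N v + -1 * Q.[v]).
    by apply/funext => y; rewrite mulN1r.
  have dQ : hasderiv (fun v => -1 * Q.[v]) x (-1 * q.[x]).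
    by apply: hasderivMc; rewrite -Qq; exact: is_derive_poly.
  by apply: is_derive_eq (hasderivD (tF 0%N x) dQ) _; rewrite FE Eq// mulN1r subrr.
- rewrite (leq_trans (size_polyD _ _))// geq_max (leq_trans sQ)//=.
  by rewrite (leq_trans (size_polyC_leq1 _)).
Qed.

End primitives.

(** * Kernels whose scale differences are m-th derivatives *)

Section kernels.
Variable R : realType.

Let node (l : nat) : R := l.+1%:R.

Let node_inj : injective node.
Proof. by move=> i j /eqP; rewrite eqr_nat => /eqP []. Qed.

Lemma lagrange_node m (m0 : (0 < m)%N) (l i : 'I_m) :
  (tnth (lagrange m node) l : {poly R}).[i.+1%:R] = (i == l)%:R.
Proof. by rewrite eq_sym -(lagrange_sample m0 node_inj). Qed.

Lemma lagrange_interpolation m (p : {poly R}) t : (0 < m)%N -> (size p <= m)%N ->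
  \sum_(l < m) (tnth (lagrange m node) l : {poly R}).[t] * p.[l.+1%:R] = p.[t].
Proof.
move=> m0 sp; rewrite [in RHS](lagrange_gen m0 node_inj sp) horner_sum.
by apply: eq_bigr => l _; rewrite hornerM hornerC mulrC.
Qed.

Lemma poly_bounded01 (q : {poly R}) : exists2 C : R, 0 <= C &
  forall t, 0 <= t <= 1 -> `|q.[t]| <= C.
Proof.
exists (\sum_(i < size q) `|q`_i|); first by rewrite sumr_ge0.
move=> t /andP[t0 t1]; rewrite horner_coef (le_trans (ler_norm_sum _ _ _))//.
apply: ler_sum => i _; rewrite normrM -[leRHS]mulr1 ler_wpM2l//.
by rewrite normrX ger0_norm// exprn_ile1.
Qed.

Lemma tower_bounded (D : nat -> R -> R) (a : R) : tower D ->
  (forall v, v <= - a -> D 0%N v = 0) -> forall b : R, exists2 C : R, 0 <= C &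
  forall v, v <= b -> `|D 0%N v| <= C.
Proof.
move=> tD D0 b; have [ab|ab] := leP (- a) b; last first.
  exists 0 => // v vb; rewrite D0 ?normr0//.
  by rewrite (le_trans vb)// ltW.
have cn : {within `[- a, b], continuous (fun v => `|D 0%N v|)}.
  apply: continuous_subspaceT => v.
  by apply: (@continuous_comp _ _ _ (D 0%N) (fun y : R => `|y|)); [exact: tower_continuous|exact: norm_continuous].
have [c _ cP] := EVT_max ab cn.
exists (`|D 0%N c|) => // v vb; have [va|va] := leP v (- a).
  by rewrite D0// normr0.
by apply: cP; rewrite in_itv/= vb ltW.
Qed.

(** Dilates of a bump phi have the same integral, but their differences are not m-th
    derivatives of compactly supported functions unless the moments of order 1 to m - 1
    agree as well.  The moment of order j of l^-1 phi(v / l) is proportional to l^j.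
    Combining l = 1, ..., m with the Lagrange basis at these nodes, evaluated at t, gives a
    kernel y_t with moments proportional to t^j, as if it were the dilate of phi by t; and
    y_1 = phi.  The kernel 1/2 y_(t/2)(v/2) has the same moments of order less than m, so the
    m-fold primitive eta_t of the difference has compact support.  As t stays in [0, 1],
    starting from t = 1 the difference of scales can be taken indefinitely with uniform
    bounds. *)
Lemma multiscale_kernels (m : nat) : (0 < m)%N ->
  exists (y eta : R -> nat -> R -> R) (C L c : R), [/\ 0 < C, 1 <= L & 0 < c] /\
  [/\ forall t, tower (y t) /\ tower (eta t),
      forall t v, eta t m v = y t 0%N v - 2^-1 * y (t / 2) 0%N (v / 2),
      forall t v, 0 <= t <= 1 -> `|y t 0%N v| <= C /\ `|eta t 0%N v| <= C,
      forall t v, L <= `|v| -> y t 0%N v = 0 /\ eta t 0%N v = 0 &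
      [/\ forall v, 0 <= y 1 0%N v,
      forall v, 1 <= `|v| -> y 1 0%N v = 0 &
      forall v, `|v| <= 2^-1 -> c <= y 1 0%N v]].
Proof.
move=> m0; have [D [tD Dge0 Dout [c c0 Dc]]] := @bump_tower R.
have [E [q [tE ED E0 Eq sq]]] := iterated_primitive m tD (Dout 0%N).
pose a t (l : 'I_m) : R := (tnth (lagrange m node) l : {poly R}).[t].
pose y t := fun k v => \sum_(l < m) (a t l / l.+1%:R) * rescale 0 l.+1%:R D k v.
pose eta1 t := fun k v =>
  \sum_(l < m) (a t l * l.+1%:R ^+ m.-1) * rescale 0 l.+1%:R E k v.
pose eta2 t := fun k v =>
  \sum_(l < m) (a (t / 2) l * (2 * l.+1%:R) ^+ m.-1) * rescale 0 (2 * l.+1%:R) E k v.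
pose eta t := fun k v => eta1 t k v - eta2 t k v.
have l0 (l : 'I_m) : (l.+1%:R : R) != 0 by rewrite pnatr_eq0.
have lpos (l : 'I_m) : 0 < (l.+1%:R : R) by rewrite ltr0n.
have ED0 : E m = D 0%N by rewrite -ED addn0.
have expm (x : R) : x != 0 -> x ^+ m.-1 * x^-1 ^+ m = x^-1.
  move=> x0; rewrite -{2}(prednK m0) exprS mulrCA -exprMn mulfV// expr1n.
  by rewrite mulr1.
have lm (l : 'I_m) : (l.+1%:R : R) <= m%:R by rewrite ler_nat.
have [Cb Cb0 CbP] : exists2 Cb : R, 0 <= Cb & forall t l, 0 <= t <= 1 -> `|a t l| <= Cb.
  have /choice[f fP] : forall l : 'I_m, exists C : R, 0 <= C /\ forall t, 0 <= t <= 1 -> `|a t l| <= C.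
    by move=> l; have [C C0 CP] := poly_bounded01 (tnth (lagrange m node) l : {poly R}); exists C.
  exists (\sum_l f l); first by apply: sumr_ge0 => l _; have [] := fP l.
  move=> t l t01; rewrite (le_trans ((fP l).2 t t01))// (bigD1 l)//= lerDl.
  by apply: sumr_ge0 => l' _; have [] := fP l'.
have [CE CE0 CEP] := tower_bounded tE E0 (2 * m%:R).
have [CD CD0 CDP] : exists2 C : R, 0 <= C & forall v, `|D 0%N v| <= C.
  have [//|C C0 CP] := @tower_bounded D 1 tD _ 1.
    by move=> v v1; apply: Dout; rewrite ler_normr; apply/orP; right; lra.
  exists C => // v; have [v1|v1] := leP v 1; first exact: CP.
  by rewrite Dout ?normr0// ler_normr ltW.
have etaout t v : 2 * m%:R <= `|v| -> eta t 0%N v = 0.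
  have m1 : (1 : R) <= m%:R by rewrite ler1n.
  rewrite ler_normr => /orP[v2|v2]; last first.
    rewrite /eta /eta1 /eta2 !big1 ?subrr// => l _; rewrite /rescale subr0 E0 ?mulr0//.
      rewrite ler_pdivrMr ?mulr_gt0//; have := lm l; lra.
    rewrite ler_pdivrMr//; have := lm l; lra.
  have polyE (s x : R) : 0 < s -> s <= v -> s ^+ m.-1 * rescale 0 s E 0%N v =
      \sum_(i < m) q`_i * v ^+ i * s ^+ (m.-1 - i).
    move=> s0 sv; rewrite /rescale expr0 mul1r subr0 Eq; last first.
      by rewrite ler_pdivlMr// mul1r.
    rewrite (horner_coef_wide _ sq) mulr_sumr; apply: eq_bigr => i _.
    have im : (i <= m.-1)%N by rewrite -ltnS prednK.
    rewrite -{1}(subnK im) exprD exprMn.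
    transitivity (q`_i * v ^+ i * s ^+ (m.-1 - i) * (s ^+ i * s^-1 ^+ i)); first by ring.
    by rewrite -exprMn mulfV ?expr1n ?mulr1// gt_eqF.
  have sumE t' (u : R) : 0 < u -> u <= 2 ->
      \sum_(l < m) (a t' l * (u * l.+1%:R) ^+ m.-1) * rescale 0 (u * l.+1%:R) E 0%N v =
      \sum_(i < m) q`_i * v ^+ i * (u * t') ^+ (m.-1 - i).
    move=> u0 u2.
    transitivity (\sum_(l < m) a t' l * \sum_(i < m) q`_i * v ^+ i * (u * l.+1%:R) ^+ (m.-1 - i)).
      apply: eq_bigr => l _; rewrite -mulrA polyE ?mulr_gt0//.
      by apply: le_trans v2; apply: ler_pM => //; exact: ltW.
    (* the value at the node l is a polynomial of degree less than m in l, so interpolation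
       at t is exact *)
  pose p : {poly R} := \sum_(i < m) (q`_i * v ^+ i * u ^+ (m.-1 - i)) *: 'X^(m.-1 - i).
    have pE x : p.[x] = \sum_(i < m) q`_i * v ^+ i * (u * x) ^+ (m.-1 - i).
      rewrite horner_sum; apply: eq_bigr => i _.
      by rewrite hornerZ hornerXn exprMn mulrA.
    rewrite -pE -(@lagrange_interpolation m p t' m0); last first.
      apply: (leq_trans (size_sum _ _ _)); apply/bigmax_leqP => i _.
      rewrite (leq_trans (size_scale_leq _ _))// size_polyXn.
      by rewrite -[X in (_ <= X)%N](prednK m0) ltnS leq_subr.
    by apply: eq_bigr => l _; rewrite pE.
  rewrite /eta /eta2 sumE// /eta1.
  under eq_bigr do rewrite -[_.+1%:R]mul1r.
  rewrite sumE// ?ler1n// mul1r [2 * _]mulrC divfK// ?subrr//.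
have etaT t : tower (eta t).
  by apply: towerB; apply: tower_sum => l; exact: tower_rescale.
exists y, eta, (m%:R * Cb * CD + (m%:R * (Cb * m%:R ^+ m.-1) * CE + m%:R * (Cb * (2 * m%:R) ^+ m.-1) * CE) + 1), (2 * m%:R), c.
have m1 : (1 : R) <= m%:R by rewrite ler1n.
have m00 : (0 : R) <= m%:R by [].
split; first split => //.
- by rewrite ltr_wpDl// !addr_ge0// !mulr_ge0// ?exprn_ge0// mulr_ge0.
- lra.
split.
- by move=> t; split => //; apply: tower_sum => l; exact: tower_rescale.
- move=> t v; rewrite /eta; congr (_ - _).
    apply: eq_bigr => l _; rewrite /rescale ED0 expr0 mul1r -!mulrA.
    by congr (_ * _); rewrite mulrA expm.
  rewrite mulr_sumr; apply: eq_bigr => l _; rewrite /rescale ED0 expr0 mul1r.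
  rewrite !subr0 [in RHS]mulrA [in RHS]mulrCA -!mulrA; congr (_ * _).
  by rewrite [LHS]mulrA expm ?mulf_neq0// invfM -!mulrA.
- move=> t v t01.
  have t201 : 0 <= t / 2 <= 1.
    by case/andP: t01 => t0 t1; apply/andP; split; lra.
  have ge1 : 0 <= m%:R * Cb * CD by rewrite !mulr_ge0.
  have ge2 : 0 <= m%:R * (Cb * m%:R ^+ m.-1) * CE by rewrite !mulr_ge0// exprn_ge0.
  have ge3 : 0 <= m%:R * (Cb * (2 * m%:R) ^+ m.-1) * CE.
    by rewrite !mulr_ge0// exprn_ge0// mulr_ge0.
  have sumC (F : 'I_m -> R) (B : R) : (forall l, `|F l| <= B) -> `|\sum_l F l| <= m%:R * B.
    move=> FB; rewrite (le_trans (ler_norm_sum _ _ _))//.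
    rewrite (le_trans (ler_sum _ (fun l _ => FB l)))//.
    by rewrite sumr_const card_ord mulr_natl.
  split.
    suff : `|y t 0%N v| <= m%:R * (Cb * CD) by rewrite mulrA; lra.
    apply: sumC => l; rewrite normrM ler_pM// /rescale ?expr0 ?mul1r//.
    rewrite normrM -[leRHS]mulr1 ler_pM ?CbP//.
    by rewrite ger0_norm ?invr_ge0// invf_le1// ler1n.
  have [vL|vL] := leP (2 * m%:R) `|v|.
    by rewrite etaout// normr0; lra.
  have vle : v <= 2 * m%:R by rewrite (le_trans (ler_norm _))// ltW.
  have Eb (s : R) : 1 <= s -> `|rescale 0 s E 0%N v| <= CE.
    move=> s1; rewrite /rescale expr0 mul1r subr0; apply: CEP.
    rewrite ler_pdivrMr ?(lt_le_trans _ s1)//.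
    have [v0|v0] := leP 0 v; last by rewrite (le_trans (ltW v0))// !mulr_ge0// (le_trans _ s1).
    by rewrite (le_trans vle)// ler_peMr// mulr_ge0.
  rewrite (le_trans (ler_normB _ _))//.
  suff : `|eta1 t 0%N v| <= m%:R * (Cb * m%:R ^+ m.-1 * CE) /\
         `|eta2 t 0%N v| <= m%:R * (Cb * (2 * m%:R) ^+ m.-1 * CE).
    by rewrite ![m%:R * (_ * CE)]mulrA; lra.
  have pw (x z : R) : 0 <= x -> x <= z -> `|x ^+ m.-1| <= z ^+ m.-1.
    move=> x0 xz; rewrite normrX ger0_norm// lerXn2r// nnegrE//.
    exact: le_trans xz.
  split; apply: sumC => l; rewrite normrM; apply: ler_pM => //.
  - by rewrite normrM; apply: ler_pM => //; [exact: CbP|exact: pw].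
  - by apply: Eb; rewrite ler1n.
  - rewrite normrM; apply: ler_pM => //; first exact: CbP.
    by apply: pw; rewrite ?mulr_ge0// ler_wpM2l.
  - have l1 : (1 : R) <= l.+1%:R by rewrite ler1n.
    by apply: Eb; lra.
- move=> t v vL; split; last exact: etaout.
  rewrite /y big1// => l _; rewrite /rescale Dout ?mulr0// subr0 normrM normfV.
  rewrite [X in _ / X]ger0_norm// ler_pdivlMr// mul1r.
  by rewrite (le_trans _ vL)//; have := lm l; lra.
have y1 v : y 1 0%N v = D 0%N v.
  rewrite /y (bigD1 (Ordinal m0))//= big1 ?addr0; last first.
    move=> l lm0; rewrite /a (lagrange_node m0 l (Ordinal m0)) eq_sym (negbTE lm0).
    by rewrite !mul0r.
  rewrite /a (lagrange_node m0 (Ordinal m0) (Ordinal m0)) eqxx /rescale.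
  by rewrite invr1 mulr1 !mul1r subr0 mulr1.
split=> v; rewrite y1//; first exact: Dout.
exact: Dc.
Qed.

End kernels.

(** * Tensor products *)

Section norms.
Variables (R : realType) (n : nat).
Implicit Types u : 'rV[R]_n.

Lemma norm_coord u i : `|u ord0 i| <= `|u|.
Proof.
rewrite [leRHS]mx_normrE.
exact: (le_bigmax _ (fun ij : 'I_1 * 'I_n => `|u ij.1 ij.2|) (ord0, i)).
Qed.

Lemma norm_le_coord u M : 0 <= M -> (forall i, `|u ord0 i| <= M) -> `|u| <= M.
Proof.
move=> M0 uM; rewrite [leLHS]mx_normrE; apply: bigmax_le => // -[i j] _ /=.
by rewrite ord1.
Qed.

Lemma rV_ballP (x : 'rV[R]_n) e y : ball x e y <->
  0 < e /\ forall i, `|x ord0 i - y ord0 i| < e.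
Proof.
split=> [[e0 h]|[e0 h]]; first by split=> // i; exact: h.
by split=> // i j; rewrite (ord1 i); exact: h.
Qed.

Lemma closed_norm_le M : closed [set u : 'rV[R]_n | `|u| <= M].
Proof.
apply: (@preimage_closed _ _ (fun u : 'rV[R]_n => `|u|) [set r | r <= M]).
  by move=> u _; exact: norm_continuous.
exact: closed_le.
Qed.

Lemma compact_norm_le M : compact [set u : 'rV[R]_n | `|u| <= M].
Proof.
apply: bounded_closed_compact; last exact: closed_norm_le.
exists M; split; first exact: num_real.
by move=> M' MM' x /= xM; rewrite (le_trans xM)// ltW.
Qed.

Lemma compact_closure_support (f : 'rV[R]_n -> R) M :
  (forall u, M < `|u| -> f u = 0) -> compact (closure [set u | f u != 0]).
Proof.
move=> fM; apply: (@subclosed_compact _ _ [set u : 'rV[R]_n | `|u| <= M]).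
- exact: closed_closure.
- exact: compact_norm_le.
rewrite [X in _ `<=` X](closure_id _).1; last exact: closed_norm_le.
apply: closure_subset => w /= fw.
by rewrite leNgt; apply/negP => /fM; exact/eqP.
Qed.

Lemma hasderiv_line (f : 'rV[R]_n -> R) x v d :
  hasderiv (fun h => f (h *: v + x)) 0 d -> is_derive x v f d.
Proof.
move=> [df <-]; constructor; first exact: (derivable1P f x v).2 df.
rewrite /derive.
suff -> : (fun h => h^-1 *: (((fun h => f (h *: v + x)) \o shift 0) (h *: (1 : R))
  - f (0 *: v + x))) = (fun h => h^-1 *: ((f \o shift x) (h *: v) - f x)) by [].
apply/funext => h /=.
by rewrite addr0 scale0r add0r [_%:A]mulr1.
Qed.

Lemma line_hasderiv (f : 'rV[R]_n -> R) x v :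
  derivable f x v -> hasderiv (fun h => f (h *: v + x)) 0 ('D_v f x).
Proof.
move=> df; constructor; first exact: (derivable1P f x v).1 df.
rewrite /derive.
suff -> : (fun h => h^-1 *: (((fun h => f (h *: v + x)) \o shift 0) (h *: (1 : R))
  - f (0 *: v + x))) = (fun h => h^-1 *: ((f \o shift x) (h *: v) - f x)) by [].
apply/funext => h /=.
by rewrite addr0 scale0r add0r [_%:A]mulr1.
Qed.

End norms.

Section continuity.
Variables (R : realType) (T : topologicalType).
Implicit Types f g : T -> R.

Lemma continuous_addr f g : continuous f -> continuous g ->
  continuous (fun x => f x + g x).
Proof. by move=> cf cg x; apply: (@cvgD _ _ _ _ _ f g); [exact: cf|exact: cg]. Qed.

Lemma continuous_mulr f g : continuous f -> continuous g ->
  continuous (fun x => f x * g x).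
Proof. by move=> cf cg x; apply: (@cvgM _ _ _ _ f g); [exact: cf|exact: cg]. Qed.

Lemma continuous_oppr f : continuous f -> continuous (fun x => - f x).
Proof. by move=> cf x; apply: (@cvgN _ _ _ _ _ f); exact: cf. Qed.

Lemma continuous_cstr (a : R) : continuous (fun _ : T => a).
Proof. by move=> x; exact: cvg_cst. Qed.

End continuity.

Section tensors.
Variables (R : realType) (n : nat).
Implicit Types (D : 'I_n -> nat -> R -> R) (k : 'I_n -> nat) (u : 'rV[R]_n).

Definition tensor D k u : R := \prod_i D i (k i) (u ord0 i).

Lemma tensor_continuous D k : (forall i, tower (D i)) ->
  continuous (tensor D k).
Proof.
move=> tD; rewrite /tensor.
apply: (@continuous_big R _ (@GRing.mul R) 1 predT).
  by move=> [a b]; exact: mul_continuous.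
move=> i _ u.
apply: (@continuous_comp _ _ _ (fun u : 'rV[R]_n => u ord0 i) (D i (k i))).
  exact: coord_continuous.
exact: tower_continuous.
Qed.

Definition bump_index k (j : 'I_n) : 'I_n -> nat := fun i => (k i + (i == j))%N.

(** Along a coordinate line only one factor of the product varies. *)
Lemma tensor_is_derive D k j u : (forall i, tower (D i)) ->
  is_derive u (delta_mx ord0 j) (tensor D k) (tensor D (bump_index k j) u).
Proof.
move=> tD; apply: hasderiv_line.
have E h : tensor D k (h *: delta_mx ord0 j + u) =
    (\prod_(i < n | i != j) D i (k i) (u ord0 i)) * D j (k j) (h + u ord0 j).
  rewrite /tensor (bigD1 j)//= mulrC; congr (_ * _).
    apply: eq_bigr => i ij; rewrite !mxE eqxx/=.
    by rewrite (negbTE ij) mulr0 add0r.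
  by rewrite !mxE !eqxx mulr1.
apply: (hasderiv_ext (fun h => esym (E h))).
have -> : tensor D (bump_index k j) u =
    (\prod_(i < n | i != j) D i (k i) (u ord0 i)) * (D j (k j).+1 (u ord0 j) * 1).
  rewrite /tensor (bigD1 j)//= mulrC mulr1 /bump_index eqxx addn1; congr (_ * _).
  by apply: eq_bigr => i ij; rewrite (negbTE ij) addn0.
apply: hasderivMc; apply: (@hasderiv_comp _ (D j (k j)) (fun h => h + u ord0 j)).
  by rewrite add0r; exact: tD.
rewrite -[1]addr0; apply: hasderivD; [exact: hasderiv_id|exact: hasderiv_cst].
Qed.

Lemma partial_tensor D k j : (forall i, tower (D i)) ->
  partial j (tensor D k) = tensor D (bump_index k j).
Proof.
move=> tD; apply/funext => u; rewrite /partial.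
exact: (@derive_val _ _ _ _ _ _ _ (tensor_is_derive k j u tD)).
Qed.

Lemma iter_partial_tensor D k s : (forall i, tower (D i)) ->
  iter_partial s (tensor D k) = tensor D (fun i => k i + count_mem i s)%N.
Proof.
move=> tD; elim: s => [|j s IH] /=.
  by congr tensor; apply/funext => i; rewrite addn0.
rewrite IH partial_tensor//.
congr tensor; apply/funext => i; rewrite /bump_index -addnA eq_sym.
by rewrite [(count_mem _ _ + _)%N]addnC.
Qed.

Lemma smooth_tensor D k : (forall i, tower (D i)) -> smooth (tensor D k).
Proof.
move=> tD s; rewrite iter_partial_tensor//; split; first exact: tensor_continuous.
by move=> x i; have [] := tensor_is_derive (fun i => k i + count_mem i s)%N i x tD.
Qed.

Lemma count_multi_index k i :
  count_mem i (flatten [seq nseq (k j) j | j <- enum 'I_n]) = k i.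
Proof.
rewrite count_flatten -map_comp sumnE big_map big_enum/= (bigD1 i)//=.
rewrite count_nseq/= eqxx mul1n big1 ?addn0// => j ji.
by rewrite count_nseq/= (negbTE ji).
Qed.

Lemma multi_partial_tensor D k l : (forall i, tower (D i)) ->
  multi_partial l (tensor D k) = tensor D (fun i => k i + l i)%N.
Proof.
move=> tD; rewrite /multi_partial iter_partial_tensor//.
by congr tensor; apply/funext => i; rewrite count_multi_index.
Qed.

Lemma tensor_eq0 D k i u : D i (k i) (u ord0 i) = 0 -> tensor D k u = 0.
Proof. by move=> D0; rewrite /tensor (bigD1 i)//= D0 mul0r. Qed.

Lemma tensor_test_function D k (M : R) : 0 <= M -> (forall i, tower (D i)) ->
  (forall i v, M < `|v| -> D i (k i) v = 0) -> test_function (tensor D k).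
Proof.
move=> M0 tD D0; split; first exact: smooth_tensor.
apply: (@compact_closure_support _ _ _ M) => u Mu.
have [i ui] : exists i, M < `|u ord0 i|.
  apply: contrapT => H; move: Mu; apply/negP; rewrite -leNgt.
  apply: norm_le_coord => // i; rewrite leNgt; apply/negP => ui.
  by apply: H; exists i.
by apply: (@tensor_eq0 _ _ i); exact: D0.
Qed.

End tensors.

(** The factors of the first product are replaced one at a time by those of the
    second. *)
Lemma prod_telescope (R : comNzRingType) n (a b : 'I_n -> R) :
  \prod_i a i - \prod_i b i =
  \sum_(i < n) \prod_(j < n) (if (j < i)%N then a j else if j == i then a j - b j else b j).
Proof.
elim: n a b => [|n IH] a b; first by rewrite !big_ord0 subrr.
rewrite big_ord_recl [in X in _ - X]big_ord_recl [in RHS]big_ord_recl.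
rewrite [X in _ = X + _]big_ord_recl/=.
have -> : \prod_(i < n) (if (lift ord0 i < 0)%N then a (lift ord0 i)
    else if lift ord0 i == ord0 then a (lift ord0 i) - b (lift ord0 i)
    else b (lift ord0 i)) = \prod_(i < n) b (lift ord0 i).
  by apply: eq_bigr.
under [X in _ = _ + X]eq_bigr do rewrite big_ord_recl/=.
rewrite -big_distrr/=.
rewrite (_ : \sum_(i < n) _ = \prod_(i < n) a (lift ord0 i) - \prod_(i < n) b (lift ord0 i)).
  ring.
rewrite IH; apply: eq_bigr => i _; apply: eq_bigr => j _.
by rewrite /bump !leq0n !add1n ltnS (inj_eq lift_inj).
Qed.

(** * Lebesgue measure of boxes and balls *)

Section boxes.
Variables (R : realType) (n : nat).
Local Notation Rn := 'rV[R]_n.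
Local Notation bRn := (borel 'rV[R]_n).

Definition box (a b : Rn) : set Rn :=
  [set u | forall i, a ord0 i < u ord0 i < b ord0 i].

Definition boxes : set (set Rn) := [set box ab.1 ab.2 | ab in [set: Rn * Rn]].

Lemma ball_box (x : Rn) r : 0 < r ->
  ball x r = box (\row_i (x ord0 i - r)) (\row_i (x ord0 i + r)).
Proof.
move=> r0; apply/seteqP; split => u.
  move/rV_ballP => [_ h] i; rewrite !mxE; have := h i.
  by rewrite ltr_distlC.
move=> h; apply/rV_ballP; split => // i; have := h i; rewrite !mxE.
by rewrite ltr_distlC.
Qed.

Lemma box_setI a b a' b' : box a b `&` box a' b' =
  box (\row_i Num.max (a ord0 i) (a' ord0 i)) (\row_i Num.min (b ord0 i) (b' ord0 i)).
Proof.
apply/seteqP; split => u.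
  move=> [h h'] i; rewrite !mxE gt_max lt_min.
  by have /andP[-> ->] := h i; have /andP[-> ->] := h' i.
move=> h; split => i; have := h i; rewrite !mxE gt_max lt_min.
  by move=> /andP[/andP[-> _] /andP[-> _]].
by move=> /andP[/andP[_ ->] /andP[_ ->]].
Qed.

Lemma boxes_setI : setI_closed boxes.
Proof.
move=> _ _ [[a b] _ <-] [[a' b'] _ <-]; rewrite box_setI.
by eexists (_, _).
Qed.

(** Balls with rational centres and radii 1/(k+1) form a countable base, so the Borel
    sets are generated by boxes although a general open set is an uncountable union. *)
Lemma rat_ball (U : set Rn) u : open U -> U u ->
  exists (z : {ffun 'I_n -> rat} * nat),
   ball (\row_i ratr (z.1 i) : Rn) (z.2.+1%:R^-1 : R) u /\
   ball (\row_i ratr (z.1 i) : Rn) (z.2.+1%:R^-1 : R) `<=` U.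
Proof.
move=> oU Uu.
have /nbhs_ballP[e /= e0 eU] : nbhs u U by exact: open_nbhs_nbhs.
pose k := Num.truncn (2 / e).
pose d : R := k.+1%:R^-1.
have d0 : 0 < d by rewrite invr_gt0.
have de : d + d <= e.
  rewrite -mulr2n -mulr_natr mulrC ler_pdivrMr// mulrC -ler_pdivrMr//.
  by rewrite ltW// truncnS_gt.
have q i : {q : rat | ratr q \in `]u ord0 i - d, u ord0 i + d[}.
  apply/cid/rat_in_itvoo.
  by rewrite ltrBlDr -addrA ltrDl addr_gt0.
exists ([ffun i => sval (q i)], k) => /=.
have zt : ball (\row_i ratr ([ffun i => sval (q i)] i) : Rn) d u.
  split => // i j; rewrite !mxE ffunE (ord1 i); case: (q j) => /= r.
  by rewrite in_itv/= /ball/= ltr_distlC ltrBlDr ltrBlDr andbC.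
split=> // s zs; apply: eU.
apply: le_ball de _ _; apply: ball_triangle zs.
exact: ball_sym.
Qed.

Lemma open_box a b : open (box a b).
Proof.
rewrite openE => u ub.
apply: (@filter_forall _ _ (fun i => [set u : Rn | a ord0 i < u ord0 i < b ord0 i]) (nbhs u)) => i.
apply: (@coord_continuous _ _ _ ord0 i u `]a ord0 i, b ord0 i[%classic).
apply: open_nbhs_nbhs; split; first exact: interval_open.
by rewrite /= in_itv/=; exact: ub.
Qed.

Lemma borel_boxes : @measurable _ bRn = <<s boxes >>.
Proof.
apply/seteqP; split; last first.
  apply: smallest_sub; first exact: sigma_algebra_measurable.
  move=> _ [[a b] _ <-]; apply: sub_sigma_algebra.
  exact: open_box.
apply: smallest_sub; first exact: smallest_sigma_algebra.
move=> U oU.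
pose B (z : {ffun 'I_n -> rat} * nat) :=
  ball (\row_i ratr (z.1 i) : Rn) (z.2.+1%:R^-1 : R).
pose F z := if `[< B z `<=` U >] then B z else set0.
have -> : U = \bigcup_z F z.
  apply/seteqP; split => [u Uu|u [z _]]; last by rewrite /F; case: asboolP => // h /h.
  have [z [zu zU]] := rat_ball oU Uu.
  by exists z => //; rewrite /F asboolT.
pose GT := g_sigma_algebraType boxes.
apply: (@countable_bigcupT_measurable _ GT) => [|z]; first exact: countableP.
rewrite /F; case: ifPn => _; last exact: (@measurable0 _ GT).
rewrite /B ball_box ?invr_gt0//; apply: sub_sigma_algebra.
by eexists (_, _).
Qed.

Lemma box_cover : \bigcup_k box (\row_i - (k%:R : R)) (\row_i k%:R) = [set: Rn].
Proof.
apply/seteqP; split => // u _.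
exists (Num.truncn `|u|).+1 => // i; rewrite !mxE -ltr_norml.
by apply: le_lt_trans (norm_coord u i) _; rewrite truncnS_gt.
Qed.

(** Boxes are stable under intersection and generate the Borel sets, and countably many
    of them exhaust the space. *)
Lemma borel_measure_unique (m1 m2 : {measure set bRn -> \bar R}) :
  (forall a b, m1 (box a b) = m2 (box a b)) ->
  (forall a b, (m1 (box a b) < +oo)%E) ->
  forall A, measurable A -> m1 A = m2 A.
Proof.
move=> m12 m1oo A mA.
apply: (@measure_unique _ R bRn boxes (fun k => box (\row_i - (k%:R : R)) (\row_i k%:R)) borel_boxes boxes_setI _ _ m1 m2) => //.
- by move=> i; eexists (_, _).
- exact: box_cover.
- by move=> _ [[a b] _ <-].
Qed.

Lemma measurable_box a b : @measurable _ bRn (box a b).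
Proof. by rewrite borel_boxes; apply: sub_sigma_algebra; exists (a, b). Qed.

Lemma measurable_rV_ball (x : Rn) r : @measurable _ bRn (ball x r).
Proof. exact: sub_sigma_algebra (ball_open _ _). Qed.

Lemma continuous_borel_measurable (f : Rn -> R) : continuous f ->
  measurable_fun setT (f : bRn -> R).
Proof.
move=> cf; apply: (measurability _ (RGenOpens.measurableE R)).
move=> _ [_ [a [b ->] <-]]; rewrite setTI; apply: sub_sigma_algebra.
by apply: open_comp => // x _; exact: cf.
Qed.

End boxes.

(** Induction on the dimension, along the recursive definition of the product
    measure. *)
Lemma tuple_lebesgue_box (R : realType) n (a b : 'I_n -> R) :
  (forall i, a i <= b i) ->
  tuple_lebesgue R n [set t : n.-tuple R | forall i, a i < tnth t i < b i] =
  (\prod_i (b i - a i))%:E.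
Proof.
elim: n a b => [|n IH] a b ab.
  rewrite big_ord0 /= diracE mem_set//= => -[]//.
have := IH (fun i => a (lift ord0 i)) (fun i => b (lift ord0 i)) (fun i => ab _).
set A := (X in tuple_lebesgue R n X = _ -> _) => IHA.
rewrite /= /cons_measure /pushforward.
have -> : @tcons R n @^-1` [set t : n.+1.-tuple R | forall i, a i < tnth t i < b i] =
   `]a ord0, b ord0[%classic `*` A.
  apply/seteqP; split => -[x t] /=.
    move=> h; split; first by rewrite /= in_itv/=; exact: (h ord0).
    by move=> i; have := h (lift ord0 i); rewrite tnthS.
  move=> [+ h] i; rewrite /= in_itv/= => h0.
  have [j ->|->] := unliftP ord0 i; last by [].
  by rewrite tnthS; exact: h.
rewrite product_measure1E; last 2 first.
- exact: measurable_itv.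
- rewrite (_ : A = \bigcap_(i in [set: 'I_n]) ((fun t : n.-tuple (measurableTypeR R) => tnth t i) @^-1`
       `]a (lift ord0 i), b (lift ord0 i)[%classic)).
    apply: fin_bigcap_measurable; first exact: finite_finset.
    by move=> i _; rewrite -[X in measurable X]setTI; apply: measurable_tnth.
  apply/seteqP; split => t h i => [_|]; first by rewrite /= in_itv/=; exact: h.
  by have := h i I; rewrite /= in_itv.
rewrite IHA big_ord_recl.
rewrite [X in (X * _)%E](_ : _ = (b ord0 - a ord0)%:E) ?EFinM//.
rewrite [LHS]lebesgue_measure_itv/= lte_fin.
have [h|h] := ltP (a ord0) (b ord0); first by rewrite EFinB.
suff -> : a ord0 = b ord0 by rewrite subrr.
by apply/eqP; rewrite eq_le ab h.
Qed.

Lemma lebesgue_box (R : realType) n (a b : 'rV[R]_n) :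
  (forall i, a ord0 i <= b ord0 i) ->
  lebesgue (box a b) = (\prod_i (b ord0 i - a ord0 i))%:E.
Proof.
move=> ab; rewrite -tuple_lebesgue_box// /lebesgue /pushforward; congr (tuple_lebesgue _ _ _).
apply/seteqP; split => t h i; first by have := h i; rewrite mxE.
by rewrite mxE; exact: h.
Qed.

Lemma lebesgue_box_lty (R : realType) n (a b : 'rV[R]_n) :
  (lebesgue (box a b) < +oo)%E.
Proof.
have [h|/existsNP[i /negP]] := pselect (forall i, a ord0 i <= b ord0 i).
  by rewrite lebesgue_box// ltry.
rewrite -ltNge => bi; suff -> : box a b = set0 by rewrite measure0.
apply/seteqP; split => // u h; have := h i => /andP[h1 h2].
by have := lt_trans (lt_trans h1 h2) bi; rewrite ltxx.
Qed.

Lemma lebesgue_ball (R : realType) n (x : 'rV[R]_n) r : 0 < r ->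
  lebesgue (ball x r) = ((2 * r) ^+ n)%:E.
Proof.
move=> r0; rewrite ball_box// lebesgue_box; last first.
  by move=> i; rewrite !mxE; lra.
congr (_%:E); under eq_bigr do rewrite !mxE.
rewrite (eq_bigr (fun=> 2 * r)); last by move=> i _; lra.
by rewrite prodr_const card_ord.
Qed.

Lemma lebesgue_ball_lty (R : realType) n (x : 'rV[R]_n) r : 0 < r ->
  (lebesgue (ball x r) < +oo)%E.
Proof. by move=> r0; rewrite lebesgue_ball// ltry. Qed.

(** * Integrals of partial derivatives *)

Section integration.
Variables (R : realType) (n : nat).
Local Notation Rn := 'rV[R]_n.
Local Notation bRn := (borel 'rV[R]_n).
Local Notation mu := (@lebesgue R n).

Lemma translation_continuous (v : Rn) : continuous (fun x : Rn => x + v).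
Proof.
move=> x; apply: (@cvgD R Rn Rn (nbhs x) _ (fun x => x) (fun=> v) x v).
  exact: cvg_id.
exact: cvg_cst.
Qed.

Lemma measurable_translation (v : Rn) :
  measurable_fun setT ((fun x => x + v) : bRn -> bRn).
Proof.
apply: (@measurability _ _ _ bRn setT _ (@open Rn)) => //.
move=> _ [U oU <-]; rewrite setTI; apply: sub_sigma_algebra.
apply: open_comp => // x _; exact: translation_continuous.
Qed.

(** Both measures give a box the same value. *)
Lemma lebesgue_translation (v : Rn) A : @measurable _ bRn A ->
  mu ((fun x => x + v) @^-1` A) = mu A.
Proof.
pose m := measure_function_pushforward__canonical__measure_function_Measure
  mu (measurable_translation v).
move: A; apply: (@borel_measure_unique R n m mu); last first.
  move=> a b; rewrite -[X in (X < _)%E]/(mu _).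
  rewrite (_ : _ @^-1` _ = box (a - v) (b - v)) ?lebesgue_box_lty//.
  by apply/seteqP; split => u h i; have := h i; rewrite !mxE ltrBlDr ltrBrDr.
move=> a b; rewrite -[LHS]/(mu _) -[RHS]/(mu _).
rewrite (_ : _ @^-1` _ = box (a - v) (b - v)); last first.
  by apply/seteqP; split => u h i; have := h i; rewrite !mxE ltrBlDr ltrBrDr.
have [h|/existsNP[i /negP]] := pselect (forall i, a ord0 i <= b ord0 i).
  rewrite (lebesgue_box h) lebesgue_box; last by move=> i; rewrite !mxE lerD2r.
  by congr (_%:E); apply: eq_bigr => i _; rewrite !mxE; ring.
rewrite -ltNge => bi.
have box0 (a' b' : Rn) : b' ord0 i < a' ord0 i -> box a' b' = set0.
  move=> ab; apply/seteqP; split => // u h; have := h i => /andP[h1 h2].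
  by have := lt_trans (lt_trans h1 h2) ab; rewrite ltxx.
by rewrite !box0 ?measure0// !mxE ltrD2r.
Qed.

Lemma integral_translation (v : Rn) (f : bRn -> \bar R) :
  mu.-integrable setT f -> mu.-integrable setT (fun x : bRn => f ((x : Rn) + v)%R) ->
  (\int[mu]_x f ((x : Rn) + v)%R = \int[mu]_x f x)%E.
Proof.
move=> intf intfv.
pose m := measure_function_pushforward__canonical__measure_function_Measure
  mu (measurable_translation v).
transitivity (\int[m]_x f x)%E; last first.
  by apply: eq_measure_integral => A mA _; exact: lebesgue_translation.
have [mf _] := integrableP _ _ _ intf.
have intf' : mu.-integrable ((fun x : Rn => x + v) @^-1` setT)
    (f \o ((fun x : Rn => x + v) : bRn -> bRn)) by [].
exact: (esym (integral_pushforward (measurable_translation v) mf intf' measurableT)).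
Qed.

Lemma integrable_bounded_support (f : bRn -> R) (C M : R) :
  measurable_fun setT f -> (forall x, `|f x| <= C) ->
  (forall x : Rn, M < `|x| -> f x = 0) -> mu.-integrable setT (EFin \o f).
Proof.
move=> mf fC fM.
pose B : set bRn := ball (0 : Rn) (`|M| + 1).
have B0 : 0 < `|M| + 1 by rewrite ltr_wpDl.
have mB : measurable B by exact: measurable_rV_ball.
have fE : EFin \o f = (EFin \o f) \_ B.
  apply/funext => x; rewrite patchE; case: ifPn => // /negP xB.
  rewrite /= fM// ltNge; apply/negP => xM; apply: xB; rewrite inE /B.
  rewrite mx_norm_ball /ball_/= sub0r normrN.
  by rewrite (le_lt_trans xM)// (le_lt_trans (ler_norm _))// ltrDl.
rewrite fE; apply/(integrable_mkcond _ mB); apply: measurable_bounded_integrable => //.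
- exact: lebesgue_ball_lty.
- exact: measurable_funTS.
- exists C; split; first exact: num_real.
  by move=> C' CC' x _ /=; rewrite (le_trans (fC x))// ltW.
Qed.

Lemma continuous_bounded_on (f : Rn -> R) M : continuous f ->
  exists2 C, 0 <= C & forall x, `|x| <= M -> `|f x| <= C.
Proof.
move=> cf; have [M0|M0] := leP 0 M; last first.
  by exists 0 => // x xM; have := le_lt_trans xM M0; rewrite ltNge normr_ge0.
pose K := [set x : Rn | `|x| <= M].
have cK : compact K := @compact_norm_le R n M.
have K0 : K !=set0 by exists 0; rewrite /K/= normr0.
have cfK : {within K, continuous (fun x => `|f x|)}.
  apply: continuous_subspaceT => x.
  by apply: (@continuous_comp _ _ _ f (fun y : R => `|y|)); [exact: cf|exact: norm_continuous].
have [c _ cP] := EVT_max_rV K0 cK cfK.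
exists (`|f c|) => // x xM; apply: cP; by rewrite inE.
Qed.

Lemma continuous_bounded_support (f : Rn -> R) M : continuous f ->
  (forall x : Rn, M < `|x| -> f x = 0) ->
  exists2 C, 0 <= C & forall x, `|f x| <= C.
Proof.
move=> cf fM; have [C C0 CP] := continuous_bounded_on M cf.
exists C => // x; have [xM|xM] := leP `|x| M; first exact: CP.
by rewrite fM// normr0.
Qed.

Lemma integrable_continuous_support (f : Rn -> R) M : continuous f ->
  (forall x : Rn, M < `|x| -> f x = 0) ->
  mu.-integrable setT (EFin \o (f : bRn -> R)).
Proof.
move=> cf fM; have [C C0 CP] := continuous_bounded_support cf fM.
by apply: (integrable_bounded_support (C := C) (M := M)) => //; exact: continuous_borel_measurable.
Qed.

Lemma partial_support (f : Rn -> R) M i :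
  (forall x : Rn, M < `|x| -> f x = 0) -> forall x : Rn, M < `|x| -> partial i f x = 0.
Proof.
move=> fM x xM; rewrite /partial.
rewrite -(@near_eq_derive _ _ _ (fun=> 0)); first exact: derive_cst.
have nM : \near x, M < `|x|.
  have /cvgr_gt : (fun y : Rn => `|y|) y @[y --> x] --> `|x| by exact: norm_continuous.
  exact.
by near=> y; apply/esym/fM; near: y; exact: nM.
Unshelve. all: by end_near. Qed.

Lemma partial_MVT (f : Rn -> R) i x (h : R) : 0 < h ->
  (forall y, derivable f y (delta_mx ord0 i)) ->
  exists2 c, 0 <= c <= h &
    f (x + h *: delta_mx ord0 i) - f x = h * partial i f (x + c *: delta_mx ord0 i).
Proof.
move=> h0 df; pose g t := f (t *: delta_mx ord0 i + x).
have dg t : hasderiv g t (partial i f (t *: delta_mx ord0 i + x)).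
  have := line_hasderiv (df (t *: delta_mx ord0 i + x)).
  rewrite -/(partial i f _) => H.
  have -> : g = (fun s => (fun h => f (h *: delta_mx ord0 i + (t *: delta_mx ord0 i + x))) (s - t)).
    by apply/funext => s; rewrite /g addrA -scalerDl subrK.
  have dl : hasderiv (fun s => s - t) t 1.
    rewrite -[X in hasderiv _ _ X]addr0.
    by apply: hasderivD; [exact: hasderiv_id|exact: hasderiv_cst].
  rewrite -[X in hasderiv _ _ X]mulr1.
  apply: (@hasderiv_comp _ (fun h => f (h *: delta_mx ord0 i +
    (t *: delta_mx ord0 i + x))) (fun s => s - t)) => //.
  by rewrite subrr.
have [|c c0h E] := @MVT_segment _ g (fun t => partial i f (t *: delta_mx ord0 i + x)) 0 h (ltW h0) (fun y _ => dg y).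
  by apply: continuous_subspaceT => t; exact: hasderiv_continuous (dg t).
exists c; first by move: c0h; rewrite in_itv.
by move: E; rewrite /g scale0r add0r subr0 [x + _]addrC [x + c *: _]addrC mulrC.
Qed.

(** The difference quotients have integral 0 by translation invariance, and converge
    boundedly, by the mean value theorem, on a fixed ball. *)
Lemma integral_partial_eq0 (f : Rn -> R) M i :
  continuous f -> (forall y, derivable f y (delta_mx ord0 i)) ->
  continuous (partial i f) -> (forall x : Rn, M < `|x| -> f x = 0) ->
  (\int[mu]_x (partial i f x)%:E = 0)%E.
Proof.
move=> cf df cdf fM.
have dfM := @partial_support f M i fM.
have [C C0 CP] := continuous_bounded_support cdf dfM.
pose h k : R := k.+1%:R^-1.
have h0 k : 0 < h k by rewrite invr_gt0.
have h1 k : h k <= 1 by rewrite invf_le1// ler1n.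
pose e : Rn := delta_mx ord0 i.
have ne : `|e| <= 1.
  apply: norm_le_coord => // j; rewrite mxE eqxx/=.
  by case: (_ == _); rewrite ?normr1 ?normr0.
pose f_ k (x : Rn) : R := (h k)^-1 * (f (x + h k *: e) - f x).
have cfs k : continuous (fun x : Rn => f (x + h k *: e)).
  move=> x; apply: (@continuous_comp _ _ _ (fun x : Rn => x + h k *: e) f); last exact: cf.
  exact: translation_continuous.
have fsM k (x : Rn) : M + 1 < `|x| -> f (x + h k *: e) = 0.
  move=> xM; apply: fM; have := lerB_dist x (- (h k *: e)).
  rewrite opprK normrN normrZ gtr0_norm//.
  have : h k * `|e| <= 1 by rewrite -[leRHS]mulr1 ler_pM// ltW.
  move: xM; set a := `|x|; set b := `|x + _|; set c := h k * _; lra.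
have cf_ k : continuous (f_ k).
  apply: continuous_mulr; first exact: continuous_cstr.
  by apply: continuous_addr => //; exact: continuous_oppr.
have f_M k (x : Rn) : M + 1 < `|x| -> f_ k x = 0.
  move=> xM; rewrite /f_ fsM// fM ?subrr ?mulr0//.
  by apply: lt_trans xM; rewrite ltrDl.
have f_C k x : `|f_ k x| <= C.
  have [c _ E] := partial_MVT x (h0 k) df.
  by rewrite /f_ E mulKf// gt_eqF.
have f_0 k : (\int[mu]_x (f_ k x)%:E = 0)%E.
  have if1 := integrable_continuous_support (cfs k) (fsM k).
  have if0 := integrable_continuous_support cf fM.
  under eq_integral do rewrite EFinM EFinB.
  rewrite integralZl//; last first.
    exact: (integrableB measurableT if1 if0).
  rewrite integralB_EFin// (@integral_translation (h k *: e) (EFin \o f))// subee ?mule0//.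
  exact: integrable_fin_num if0.
have dfE x : f_ k x @[k --> \oo] --> partial i f x.
  apply/cvgrPdist_lt => eps eps0.
  have /cvgrPdist_lt/(_ _ eps0)/nbhs_ballP[d /= d0 dP] := cdf x.
  near=> k.
  have [c c0 E] := partial_MVT x (h0 k) df.
  rewrite /f_ E mulKf ?gt_eqF//; apply: dP.
  rewrite mx_norm_ball /ball_/= opprD addNKr normrN normrZ.
  have hd : h k < d.
    near: k; exists (Num.truncn d^-1) => // k /= dk; rewrite /h.
    rewrite -[ltRHS]invrK ltf_pV2 ?posrE ?invr_gt0//.
    by apply: lt_le_trans (truncnS_gt _) _; rewrite ler_nat ltnS.
  case/andP: c0 => c0 ch; rewrite ger0_norm//.
  apply: le_lt_trans hd; apply: le_trans ch.
  by rewrite -[leRHS]mulr1 ler_wpM2l.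
pose B : set bRn := ball (0 : Rn) (`|M| + 2).
have B0 : 0 < `|M| + 2 by rewrite ltr_wpDl.
pose g : bRn -> R := fun x => C * \1_B x.
have ig : mu.-integrable setT (EFin \o g).
  apply: (@integrable_bounded_support _ C (`|M| + 2)).
  - apply: measurable_funM; first exact: measurable_cst.
    by apply: measurable_indic; exact: measurable_rV_ball.
  - move=> x; rewrite /g indicE; case: (x \in B); rewrite ?mulr1 ?mulr0 ?normr0//.
    by rewrite ger0_norm.
  - move=> x xM; rewrite /g indicE memNset ?mulr0//.
    by rewrite /B mx_norm_ball /ball_/= sub0r normrN ltNge (ltW xM).
have [|||||_ _] := @dominated_convergence _ _ _ mu setT measurableT
  (fun k x => (f_ k x)%:E) (fun x => (partial i f x)%:E) (EFin \o g).
- by move=> k; apply/measurable_EFinP; exact: continuous_borel_measurable.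
- by apply/measurable_EFinP; exact: continuous_borel_measurable.
- by apply/aeW => x _; apply: cvg_EFin; [exact: nearW|exact: dfE].
- exact: ig.
- apply/aeW => x k _; rewrite lee_fin /g indicE.
  case: (boolP (x \in B)) => xB; first by rewrite mulr1.
  rewrite mulr0 f_M ?normr0//.
  move: xB; rewrite notin_setE /B mx_norm_ball /ball_/= sub0r normrN => /negP.
  rewrite -leNgt => xM; have := ler_norm M; lra.
rewrite (_ : (fun k => _) = cst 0%E); last first.
  by apply/funext => k /=; exact: f_0.
by move=> /cvg_lim; rewrite lim_cst// => ->.
Unshelve. all: by end_near. Qed.

End integration.

(** * Classical derivatives are weak derivatives *)

Section weak_derivatives.
Variables (R : realType) (n : nat).
Local Notation Rn := 'rV[R]_n.
Local Notation bRn := (borel 'rV[R]_n).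
Local Notation mu := (@lebesgue R n).
Implicit Types (f g : Rn -> R).

Definition C1_along i f := [/\ continuous f, continuous (partial i f) &
  forall y, derivable f y (delta_mx ord0 i)].

Lemma integration_by_parts_partial f g M i : C1_along i f -> C1_along i g ->
  (forall x : Rn, M < `|x| -> g x = 0) ->
  (\int[mu]_x (f x * partial i g x)%:E = - \int[mu]_x (partial i f x * g x)%:E)%E.
Proof.
move=> [cf cdf df] [cg cdg dg] gM.
have dgM := @partial_support _ _ g M i gM.
have dfg y : derivable (fun x => f x * g x) y (delta_mx ord0 i) by exact: derivableM.
have pE : partial i (fun x => f x * g x) = (fun x => f x * partial i g x + partial i f x * g x).
  apply/funext => x; rewrite /partial (deriveM (df x) (dg x)) [in RHS]mulrC.
  by rewrite /GRing.scale/= addrC mulrC [X in _ + X]mulrC addrC.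
have c1 : continuous (fun x => f x * partial i g x).
  exact: continuous_mulr cf cdg.
have c2 : continuous (fun x => partial i f x * g x).
  exact: continuous_mulr cdf cg.
have s1 (x : Rn) : M < `|x| -> f x * partial i g x = 0 by move=> xM; rewrite dgM ?mulr0.
have s2 (x : Rn) : M < `|x| -> partial i f x * g x = 0 by move=> xM; rewrite gM ?mulr0.
have i1 := integrable_continuous_support c1 s1.
have i2 := integrable_continuous_support c2 s2.
have := @integral_partial_eq0 R n (fun x => f x * g x) M i.
rewrite pE => H.
have : (\int[mu]_x (f x * partial i g x + partial i f x * g x)%:E = 0)%E.
  apply: H => //.
  - exact: continuous_mulr cf cg.
  - exact: continuous_addr c1 c2.
  - by move=> x xM; rewrite gM// mulr0.
under eq_integral do rewrite EFinD.
rewrite (integralD_EFin measurableT i1 i2) => E.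
have f2 : (\int[mu]_x (partial i f x * g x)%:E)%E \is a fin_num by exact: integrable_fin_num i2.
by rewrite -[LHS](addeK _ f2) E add0e.
Qed.

Lemma iter_partial_rcons s i f : iter_partial (rcons s i) f = iter_partial s (partial i f).
Proof. by rewrite /iter_partial foldr_rcons. Qed.

Lemma smooth_partial i f : smooth f -> smooth (partial i f).
Proof. by move=> sf s; rewrite -iter_partial_rcons; exact: sf. Qed.

Lemma smooth_iter_partial s f : smooth f -> smooth (iter_partial s f).
Proof.
elim/last_ind: s f => [//|s i IH] f sf.
by rewrite iter_partial_rcons; apply: IH; exact: smooth_partial.
Qed.

Lemma smooth_C1 i f : smooth f -> C1_along i f.
Proof.
by move=> sf; split; [exact: (sf [::]).1|exact: (sf [:: i]).1|move=> y; exact: (sf [::]).2].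
Qed.

Lemma iter_partial_support s f M : (forall x : Rn, M < `|x| -> f x = 0) ->
  forall x : Rn, M < `|x| -> iter_partial s f x = 0.
Proof.
by move=> fM; elim: s => [//|i s IH]; exact: partial_support.
Qed.

Lemma integration_by_parts_iter s f g M : smooth f -> smooth g ->
  (forall x : Rn, M < `|x| -> g x = 0) ->
  (\int[mu]_x (f x * iter_partial s g x)%:E =
   ((-1) ^+ size s)%:E * \int[mu]_x (iter_partial (rev s) f x * g x)%:E)%E.
Proof.
move=> + sg gM; elim: s f => [|i s IH] f sf; first by rewrite expr0 mul1e.
rewrite [iter_partial (i :: s) g]/(partial i (iter_partial s g)).
rewrite (@integration_by_parts_partial _ _ M).
- rewrite IH; last exact: smooth_partial.
  by rewrite rev_cons iter_partial_rcons exprS mulN1r EFinN mulNe.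
- exact: smooth_C1.
- by apply: smooth_C1; exact: smooth_iter_partial.
- exact: iter_partial_support.
Qed.

Lemma test_function_support f : test_function f ->
  exists2 M, 0 <= M & forall x : Rn, M < `|x| -> f x = 0.
Proof.
move=> [_ /compact_bounded[M [_ MP]]].
exists (`|M| + 1); first by rewrite addr_ge0.
move=> x xM; apply/eqP; apply: contraT => fx.
have sx : [set x | f x != 0] x by [].
have /= := MP (`|M| + 1) _ x (subset_closure sx).
rewrite (le_lt_trans (ler_norm M)) ?ltrDl// => /(_ isT).
by rewrite leNgt xM.
Qed.

Lemma compact_borel_measurable (K : set Rn) : compact K -> @measurable _ bRn K.
Proof.
move=> cK; rewrite -(setCK K); apply: (@measurableC _ bRn); apply: sub_sigma_algebra.
by apply: closed_openC; apply: compact_closed => //; exact: norm_hausdorff.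
Qed.

Lemma lebesgue_compact_lty (K : set Rn) : compact K -> (mu K < +oo)%E.
Proof.
move=> cK; have [M [_ MP]] := compact_bounded cK.
have M0 : 0 < `|M| + 2 by rewrite ltr_wpDl.
have KB : K `<=` ball (0 : Rn) (`|M| + 2).
  move=> x Kx; rewrite mx_norm_ball /ball_/= sub0r normrN.
  have := MP (`|M| + 1); rewrite (le_lt_trans (ler_norm M)) ?ltrDl// => /(_ isT x Kx) /=.
  lra.
apply: (@le_lt_trans _ _ (mu (ball (0 : Rn) (`|M| + 2)))).
  by apply: le_measure => //; rewrite inE; [exact: compact_borel_measurable|exact: measurable_rV_ball].
by rewrite lebesgue_ball// ltry.
Qed.

Lemma continuous_loc_integrable f : continuous f -> loc_integrable f.
Proof.
move=> cf K cK; apply: measurable_bounded_integrable.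
- exact: compact_borel_measurable.
- exact: lebesgue_compact_lty.
- by apply: measurable_funTS; exact: continuous_borel_measurable.
- have [M [_ MP]] := compact_bounded cK.
  have [C C0 CP] := continuous_bounded_on (`|M| + 1) cf.
  exists C; split; first exact: num_real.
  move=> C' CC' x Kx /=; apply: le_trans (ltW CC'); apply: CP.
  have := MP (`|M| + 1); rewrite (le_lt_trans (ler_norm M)) ?ltrDl//.
  by move=> /(_ isT x Kx).
Qed.

(** The same derivatives as in [multi_partial], in reverse order: moving them one by one
    off the test function reverses the order. *)
Definition classical_deriv (k : 'I_n -> nat) f : Rn -> R :=
  iter_partial (rev (flatten [seq nseq (k i) i | i <- enum 'I_n])) f.

Lemma classical_weak_deriv k f : smooth f -> is_weak_deriv k f (classical_deriv k f).
Proof.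
move=> sf; split.
- by apply: continuous_loc_integrable; exact: (sf [::]).1.
- by apply: continuous_loc_integrable; exact: (sf _).1.
move=> phi tphi; have [M M0 MP] := test_function_support tphi.
rewrite /multi_partial (integration_by_parts_iter _ sf tphi.1 MP) /classical_deriv.
congr ((_ ^+ _)%:E * _)%E.
rewrite size_flatten /shape -map_comp sumnE big_map big_enum/=.
by apply: eq_bigr => i _; rewrite size_nseq.
Qed.

End weak_derivatives.

(** * The fundamental lemma of the calculus of variations *)

Section box_bumps.
Variables (R : realType) (n : nat).
Local Notation Rn := 'rV[R]_n.

Definition hat (a b v : R) := flat 1 (v - a) * flat 1 (b - v).

Lemma flat1_ge0 (v : R) : 0 <= flat 1 v.
Proof. by rewrite /flat; case: ifP => // _; rewrite hornerE mul1r expR_ge0. Qed.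

Lemma flat1_le1 (v : R) : flat 1 v <= 1.
Proof.
rewrite /flat; case: ifPn => // v0; rewrite hornerE mul1r -[leRHS]expR0 ler_expR.
by rewrite oppr_le0 invr_ge0 ltW.
Qed.

Lemma flat1_gt0 (v : R) : 0 < v -> 0 < flat 1 v.
Proof. by move=> v0; rewrite /flat v0 hornerE mul1r expR_gt0. Qed.

Lemma hat_itv a b v : 0 <= hat a b v <= 1.
Proof.
apply/andP; split; first by rewrite mulr_ge0 ?flat1_ge0.
by rewrite -[leRHS]mulr1 ler_pM ?flat1_ge0 ?flat1_le1.
Qed.

Lemma hat_gt0 a b v : a < v < b -> 0 < hat a b v.
Proof. by move=> /andP[av vb]; rewrite mulr_gt0 ?flat1_gt0 ?subr_gt0. Qed.

Lemma hat_eq0 a b v : ~~ (a < v < b) -> hat a b v = 0.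
Proof.
rewrite negb_and -!leNgt /hat /flat => /orP[h|h].
  by rewrite subr_gt0 ltNge h mul0r.
by rewrite [0 < b - v]subr_gt0 [v < b]ltNge h mulr0.
Qed.

(** On the open interval from a to b the function [hat a b] takes values in ]0, 1], so the
    powers of 1 - hat tend to 0; elsewhere it vanishes. *)
Definition plateau (a b : R) k v := 1 - (1 - hat a b v) ^+ k.

Lemma ntimes_derivable_cst j (c : R) : ntimes_derivable j (fun=> c).
Proof.
elim: j c => [//|j IH] c; exists (fun=> 0); last exact: IH.
by move=> x; exact: hasderiv_cst.
Qed.

Lemma plateau_tower a b k : exists2 D, tower D & D 0%N = plateau a b k.
Proof.
apply: ntimes_derivable_tower => j.
have [E tE E0] := @flat_tower R.
have C1f : ntimes_derivable j (fun v => flat 1 (v - a)).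
  have := tower_ntimes_derivable 0%N j (tower_rescale a 1 tE).
  congr ntimes_derivable; apply/funext => v.
  by rewrite /rescale expr0 mul1r E0 invr1 mulr1.
have C2f : ntimes_derivable j (fun v => flat 1 (b - v)).
  have := tower_ntimes_derivable 0%N j (tower_rescale b (-1) tE).
  congr ntimes_derivable; apply/funext => v.
  by rewrite /rescale expr0 mul1r E0 invrN1 mulrN1 opprB.
have Ch : ntimes_derivable j (fun v => 1 + -1 * hat a b v).
  by apply: ntimes_derivableD; [exact: ntimes_derivable_cst|apply: ntimes_derivableM; [exact: ntimes_derivable_cst|exact: ntimes_derivableM]].
suff : ntimes_derivable j (fun v => 1 + -1 * (1 + -1 * hat a b v) ^+ k).
  by congr ntimes_derivable; apply/funext => v; rewrite /plateau !mulN1r.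
apply: ntimes_derivableD; first exact: ntimes_derivable_cst.
apply: ntimes_derivableM; first exact: ntimes_derivable_cst.
elim: k => [|k IH].
  by under [X in ntimes_derivable j X]funext do rewrite expr0; exact: ntimes_derivable_cst.
by under [X in ntimes_derivable j X]funext do rewrite exprS; exact: ntimes_derivableM.
Qed.

Lemma plateau_itv a b k v : 0 <= plateau a b k v <= 1.
Proof.
have /andP[h0 h1] := hat_itv a b v.
rewrite /plateau subr_ge0 exprn_ile1 ?subr_ge0 ?gerBl//=.
by rewrite exprn_ge0// subr_ge0.
Qed.

Lemma plateau_eq0 a b k v : ~~ (a < v < b) -> plateau a b k v = 0.
Proof. by move=> h; rewrite /plateau hat_eq0// subr0 expr1n subrr. Qed.

Lemma plateau_cvg a b v : a < v < b -> plateau a b k v @[k --> \oo] --> (1 : R).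
Proof.
move=> h; have /andP[h0 h1] := hat_itv a b v.
have c0 : (1 - hat a b v) ^+ k @[k --> \oo] --> (0 : R).
  by apply: cvg_expr; rewrite ger0_norm ?subr_ge0// gtrBl hat_gt0.
have := @cvgB R R nat \oo _ (fun=> 1) _ 1 0 (cvg_cst _) c0.
by rewrite subr0 => H; exact: H.
Qed.

Lemma box_plateaus (a b : Rn) : exists phi : nat -> Rn -> R,
  [/\ forall k, test_function (phi k), forall k u, 0 <= phi k u <= 1,
      forall k u, ~ box a b u -> phi k u = 0 &
      forall u, box a b u -> phi k u @[k --> \oo] --> (1 : R)].
Proof.
have /choice[D DP] : forall ki : nat * 'I_n, exists D : nat -> R -> R,
    tower D /\ D 0%N = plateau (a ord0 ki.2) (b ord0 ki.2) ki.1.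
  move=> [k i]; have [D tD D0] := plateau_tower (a ord0 i) (b ord0 i) k.
  by exists D.
pose phi k := tensor (fun i => D (k, i)) (fun=> 0%N).
have phiE k u : phi k u = \prod_i plateau (a ord0 i) (b ord0 i) k (u ord0 i).
  by apply: eq_bigr => i _; rewrite (DP (k, i)).2.
exists phi; split.
- move=> k; apply: (@tensor_test_function _ _ _ _ (`|a| + `|b|)).
  + by rewrite addr_ge0.
  + by move=> i; exact: (DP (k, i)).1.
  + move=> i v hv; rewrite (DP (k, i)).2 plateau_eq0//=.
    apply/negP => /andP[av vb]; move: hv; rewrite ltNge => /negP; apply.
    have := norm_coord a i; have := norm_coord b i.
    move: (normr_ge0 a) (normr_ge0 b); rewrite ler_norml.
    set A := `|a|; set B := `|b|; rewrite !ler_norml => A0 B0 /andP[b1 b2] /andP[a1 a2].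
    by apply/andP; split; lra.
- move=> k u; rewrite phiE; apply/andP; split.
    by apply: prodr_ge0 => i _; have /andP[] := plateau_itv (a ord0 i) (b ord0 i) k (u ord0 i).
  rewrite -[leRHS](@big1_eq _ _ *%R 'I_n (index_enum _) predT).
  by apply: ler_prod => i _; exact: plateau_itv.
- move=> k u /existsNP[i /negP ui]; rewrite phiE (bigD1 i)//= plateau_eq0// mul0r//.
- move=> u ub; rewrite (_ : (fun k => phi k u) = (fun k => \prod_i plateau (a ord0 i) (b ord0 i) k (u ord0 i))); last first.
    by apply/funext => k; exact: phiE.
  rewrite -[X in _ --> X](@big1_eq _ _ *%R 'I_n (index_enum _) predT).
  apply: (@cvg_big R _ (@GRing.mul R) 1 predT).
    by move=> [x y]; exact: mul_continuous.
  by move=> i _; apply: plateau_cvg; exact: ub.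
Qed.

End box_bumps.

Section density.
Context d (T : measurableType d) (R : realType) (mu : {measure set T -> \bar R}).
Variables (g : T -> R) (g0 : forall x, 0 <= g x).
Hypothesis ig : mu.-integrable setT (EFin \o g).

(** The two hypotheses are arguments of the definition so that the measure structure
    can be attached to it. *)
Definition density of mu.-integrable setT (EFin \o g) & (forall x, 0 <= g x) :=
  fun A => (\int[mu]_(x in A) (g x)%:E)%E.

Let density0 : density ig g0 set0 = 0%E.
Proof. by rewrite /density integral_set0. Qed.

Let density_ge0 A : (0 <= density ig g0 A)%E.
Proof. by apply: integral_ge0 => x _; rewrite lee_fin. Qed.

Let density_sigma_additive : semi_sigma_additive (density ig g0).
Proof.
move=> /= A mA tA mUA.
rewrite /density/= integral_bigcup//=; last first.
  by apply: (integrableS _ _ (subsetT _)) => //; exact: ig.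
apply: is_cvg_ereal_nneg_natsum_cond => n _ _.
by apply: integral_ge0 => /= x ?; rewrite lee_fin.
Qed.

HB.instance Definition _ := isMeasure.Build _ _ _
  (density ig g0) density0 density_ge0 density_sigma_additive.

End density.

Lemma ler_poweR (R : realType) (x y : \bar R) (r : R) :
  0 <= r -> (0 <= x)%E -> (x <= y)%E -> (x `^ r <= y `^ r)%E.
Proof.
move=> r0 x0 xy; apply: gt0_ler_poweR => //.
  by rewrite in_itv/= leey andbT.
by rewrite in_itv/= leey andbT (le_trans x0).
Qed.

Section fundamental_lemma.
Variables (R : realType) (n : nat).
Local Notation Rn := 'rV[R]_n.
Local Notation bRn := (borel 'rV[R]_n).
Local Notation mu := (@lebesgue R n).
Implicit Types (w : bRn -> R).

Lemma box_bounded (a b : Rn) : box a b `<=` [set u : Rn | `|u| <= `|a| + `|b|].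
Proof.
move=> u h /=; apply: norm_le_coord => [|i]; first by rewrite addr_ge0.
have := h i; have := norm_coord a i; have := norm_coord b i.
move: (normr_ge0 a) (normr_ge0 b).
set A := `|a|; set B := `|b|; rewrite !ler_norml => A0 B0.
by move=> /andP[b1 b2] /andP[a1 a2] /andP[u1 u2]; apply/andP; split; lra.
Qed.

Lemma loc_integrable_box w a b : loc_integrable w -> mu.-integrable (box a b) (EFin \o w).
Proof.
move=> lw; have cK := @compact_norm_le R n (`|a| + `|b|).
apply: (integrableS _ _ _ (lw _ cK)).
- exact: compact_borel_measurable.
- exact: measurable_box.
- exact: box_bounded.
Qed.

(** Dominated convergence along the plateaus of the box. *)
Lemma integral_box_eq0 w a b : loc_integrable w ->
  (forall phi, test_function phi -> (\int[mu]_x (w x * phi x)%:E = 0)%E) ->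
  (\int[mu]_(x in box a b) (w x)%:E = 0)%E.
Proof.
move=> lw w0; have [phi [tphi phi01 phi0 phi1]] := box_plateaus a b.
have iw := loc_integrable_box a b lw.
have mw : measurable_fun (box a b : set bRn) w.
  by apply/measurable_EFinP; case/integrableP: iw.
have mphi k : measurable_fun (box a b : set bRn) (phi k : bRn -> R).
  by apply: measurable_funTS; apply: continuous_borel_measurable; exact: ((tphi k).1 [::]).1.
have mB : measurable (box a b : set bRn) by exact: measurable_box.
have [|||||_ _] := @dominated_convergence _ _ _ mu (box a b) mB
  (fun k x => (w x * phi k x)%:E) (fun x => (w x)%:E) (fun x => `|w x|%:E).
- by move=> k; apply/measurable_EFinP; apply: measurable_funM.
- by apply/measurable_EFinP.
- apply/aeW => x bx; apply: cvg_EFin; first exact: nearW.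
  have := @cvgM _ _ _ _ (fun=> w x) (fun k => phi k x) _ _ (cvg_cst _) (phi1 _ bx).
  by rewrite mulr1 => H; exact: H.
- exact: (integrable_norm iw).
- apply/aeW => x k bx; rewrite lee_fin normrM -[leRHS]mulr1 ler_wpM2l//.
  by have /andP[p0 p1] := phi01 k x; rewrite ger0_norm.
rewrite (_ : (fun k => _) = cst 0%E); last first.
  apply/funext => k /=; rewrite integral_mkcond.
  rewrite -[RHS](w0 _ (tphi k)); apply: eq_integral => x _; rewrite patchE.
  case: ifPn => //; rewrite notin_setE => xB.
  by rewrite phi0// mulr0.
by move=> /cvg_lim; rewrite lim_cst// => ->.
Qed.

(** The positive and negative parts of w on the box define two finite measures that
    agree on all boxes, hence on all Borel sets; so w has integral 0 on every Borel subset
    of the box. *)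
Lemma fundamental_lemma_box w a b : loc_integrable w ->
  (forall phi, test_function phi -> (\int[mu]_x (w x * phi x)%:E = 0)%E) ->
  ae_eq mu (box a b : set bRn) w (cst 0).
Proof.
move=> lw w0; set B : set bRn := box a b.
have mB : measurable B by exact: measurable_box.
have iw : mu.-integrable B (EFin \o w) := loc_integrable_box a b lw.
have mw : measurable_fun B w by apply/measurable_EFinP; case/integrableP: iw.
pose v := w \_ B.
have iv : mu.-integrable setT (EFin \o v).
  have := (integrable_mkcond _ mB).1 iw; rewrite restrict_EFin.
  exact.
have mv : measurable_fun setT v by apply/measurable_EFinP; case/integrableP: iv.
pose gp x := Num.max (v x) 0; pose gm x := Num.max (- v x) 0.
have gp0 x : 0 <= gp x by rewrite le_max lexx orbT.
have gm0 x : 0 <= gm x by rewrite le_max lexx orbT.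
have vE x : v x = gp x - gm x.
  rewrite /gp /gm; have [h|] := boolP (0 <= v x).
    by rewrite max_l// max_r ?subr0// oppr_le0.
  rewrite -ltNge => h.
  by rewrite max_r ?(ltW h)// max_l ?sub0r ?opprK// oppr_ge0 ltW.
have igp : mu.-integrable setT (EFin \o gp).
  apply: (le_integrable measurableT _ _ iv).
    by apply/measurable_EFinP; apply: measurable_maxr.
  move=> x _; rewrite lee_fin ger0_norm// ge_max normr_ge0 ler_norm//.
have igm : mu.-integrable setT (EFin \o gm).
  apply: (le_integrable measurableT _ _ iv).
    apply/measurable_EFinP; apply: measurable_maxr => //.
    exact: measurable_funN.
  by move=> x _; rewrite lee_fin ger0_norm// ge_max normr_ge0 -normrN ler_norm.
have intB E : measurable E -> (\int[mu]_(x in E) (v x)%:E =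
    density igp gp0 E - density igm gm0 E)%E.
  move=> mE; rewrite -integralB_EFin//; last 2 first.
  - by apply: integrableS igp.
  - by apply: integrableS igm.
  by apply: eq_integral => x _; rewrite vE.
have dfin E g (g0 : forall x, 0 <= g x) (ig : mu.-integrable setT (EFin \o g)) :
    measurable E -> density ig g0 E \is a fin_num.
  by move=> mE; apply: integrable_fin_num => //; apply: integrableS ig.
have intv E : (\int[mu]_(x in E) (v x)%:E = \int[mu]_(x in E `&` B) (w x)%:E)%E.
  rewrite integral_mkcondr; apply: eq_integral => x _.
  by rewrite /v !patchE; case: ifP.
have gpm E : measurable E -> density igp gp0 E = density igm gm0 E.
  apply: borel_measure_unique => [a' b'|a' b']; last first.
    by rewrite -ge0_fin_numE//; apply: dfin; exact: measurable_box.
  rewrite -[RHS]add0e.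
  have bm : measurable (box a' b' : set bRn) by exact: measurable_box.
  have := intB _ bm; rewrite intv box_setI integral_box_eq0// => ->.
  by rewrite subeK// dfin.
have H : ae_eq mu B (EFin \o w) (cst 0%E).
  apply: (integral_ae_eq mB iw); first exact: measurable_cst.
  move=> E EB mE; rewrite -[in LHS](setIidl EB) -intv intB// gpm// subee ?dfin//.
  by rewrite integral0.
by apply: filterS H => x h Bx; have [] := h Bx.
Qed.

Lemma fundamental_lemma w : loc_integrable w ->
  (forall phi, test_function phi -> (\int[mu]_x (w x * phi x)%:E = 0)%E) ->
  ae_eq mu setT w (cst 0).
Proof.
move=> lw w0.
pose B k : set bRn := box (\row_i - (k%:R : R)) (\row_i k%:R).
have : mu.-negligible (\bigcup_k [set x : bRn | B k x /\ w x <> 0]).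
  apply: negligible_bigcup => k.
  apply: negligibleS (fundamental_lemma_box (\row_i - (k%:R : R)) (\row_i k%:R) lw w0).
  by move=> x [Bx wx] /(_ Bx).
apply: negligibleS => x /= wx.
have [k _ Bk] : (\bigcup_k B k) x by rewrite box_cover.
by exists k => //; split => // w0x; apply: wx.
Qed.

Lemma loc_integrable_measurable w : loc_integrable w -> measurable_fun setT w.
Proof.
move=> lw; rewrite -(@box_cover R n).
apply/(@measurable_fun_bigcup _ _ bRn) => k; first exact: measurable_box.
by apply/measurable_EFinP; case/integrableP: (loc_integrable_box (\row_i - (k%:R : R)) (\row_i k%:R) lw).
Qed.

Lemma loc_integrable_mul_support w (phi : Rn -> R) M : loc_integrable w ->
  continuous phi -> (forall x : Rn, M < `|x| -> phi x = 0) ->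
  mu.-integrable setT (fun x => (w x * phi x)%:E).
Proof.
move=> lw cphi phiM; pose K : set bRn := [set u : Rn | `|u| <= M].
have cK : compact (K : set Rn) := @compact_norm_le R n M.
have mK : measurable K := compact_borel_measurable cK.
have [C C0 CP] := continuous_bounded_support cphi phiM.
have -> : (fun x => (w x * phi x)%:E) = (fun x => (w x * phi x)%:E) \_ K.
  apply/funext => x; rewrite patchE; case: ifPn => //; rewrite notin_setE /K/= => /negP.
  by rewrite -ltNge => xM; rewrite phiM// mulr0.
apply/(integrable_mkcond _ mK).
have iw := integrableZl mK C (lw _ cK).
apply: (le_integrable mK _ _ iw).
  apply/measurable_EFinP; apply: measurable_funM.
    by apply: measurable_funTS; exact: loc_integrable_measurable.
  by apply: measurable_funTS; exact: continuous_borel_measurable.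
move=> x _; rewrite lee_fin !normrM mulrC ler_wpM2r// (le_trans (CP x))//.
exact: ler_norm.
Qed.

Lemma weak_deriv_unique k g h1 h2 : is_weak_deriv k g h1 -> is_weak_deriv k g h2 ->
  ae_eq mu setT (h1 : bRn -> R) (h2 : bRn -> R).
Proof.
move=> [_ l1 w1] [_ l2 w2].
have lw : loc_integrable (fun x => h1 x - h2 x).
  move=> K cK; have mK := compact_borel_measurable cK.
  exact: (integrableB mK (l1 K cK) (l2 K cK)).
have H : ae_eq mu setT ((fun x => h1 x - h2 x) : bRn -> R) (cst 0).
  apply: fundamental_lemma lw _ => phi tphi.
  have [M M0 MP] := test_function_support tphi.
  have cphi : continuous phi := (tphi.1 [::]).1.
  have i1 := loc_integrable_mul_support l1 cphi MP.
  have i2 := loc_integrable_mul_support l2 cphi MP.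
  have -> : (\int[mu]_x ((h1 x - h2 x) * phi x)%:E =
      \int[mu]_x (h1 x * phi x)%:E - \int[mu]_x (h2 x * phi x)%:E)%E.
    rewrite -integralB_EFin//; apply: eq_integral => x _.
    by rewrite -EFinB mulrBl.
  have : (((-1) ^+ (\sum_i k i)%N)%:E * \int[mu]_x (h1 x * phi x)%:E =
    ((-1) ^+ (\sum_i k i)%N)%:E * \int[mu]_x (h2 x * phi x)%:E)%E.
    by rewrite -(w1 _ tphi) -(w2 _ tphi).
  move=> /(congr1 (fun z => ((-1) ^+ (\sum_i k i)%N)%:E * z)%E).
  rewrite !muleA -!EFinM -expr2 sqrr_sign !mul1e => ->.
  by rewrite subee//; exact: integrable_fin_num i2.
by apply: filterS H => x h _; apply/eqP; rewrite -subr_eq0; apply/eqP; exact: h.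
Qed.

Lemma Lp_norm_ae_eq (p : R) (f g : Rn -> R) :
  measurable_fun setT (f : bRn -> R) -> measurable_fun setT (g : bRn -> R) ->
  ae_eq mu setT (f : bRn -> R) (g : bRn -> R) -> Lp_norm p f = Lp_norm p g.
Proof.
move=> mf mg fg; rewrite /Lp_norm unlock; congr poweR.
have mpow (h : bRn -> R) : measurable_fun setT h ->
    measurable_fun setT (fun x => (`|(EFin \o h) x| `^ p)%E).
  move=> mh; apply: (measurableT_comp (measurable_poweR p)).
  by apply: measurableT_comp => //; exact/measurable_EFinP.
apply: ae_eq_integral => //; [exact: mpow|exact: mpow|].
by apply: filterS fg => x h _ /=; rewrite h.
Qed.

Lemma Lp_norm_weak_deriv (p : R) k (f : Rn -> R) : smooth f ->
  Lp_norm p (weak_deriv k f) = Lp_norm p (classical_deriv k f).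
Proof.
move=> sf; have wc := classical_weak_deriv k sf.
have wd : is_weak_deriv k f (weak_deriv k f).
  by apply: (@xgetPex _ (cst 0) [set h | is_weak_deriv k f h]); exists (classical_deriv k f).
apply: Lp_norm_ae_eq.
- by apply: loc_integrable_measurable; case: wd.
- by apply: loc_integrable_measurable; case: wc.
- exact: weak_deriv_unique wd wc.
Qed.

Lemma Lp_norm_ball_le (p C r : R) (x0 : Rn) (f : Rn -> R) : 0 < p -> 0 < r ->
  measurable_fun setT (f : bRn -> R) ->
  (forall x, `|f x| <= C) -> (forall x, ~ ball x0 r x -> f x = 0) ->
  (Lp_norm p f <= (C * ((2 * r) ^+ n) `^ p^-1)%:E)%E.
Proof.
move=> p0 r0 mf fC f0; have C0 : 0 <= C by apply: le_trans (fC 0).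
pose B : set bRn := ball x0 r.
have mB : measurable B by exact: measurable_rV_ball.
have -> : C * ((2 * r) ^+ n) `^ p^-1 = (C `^ p * (2 * r) ^+ n) `^ p^-1.
  by rewrite powRM ?powR_ge0 ?exprn_ge0 ?mulr_ge0 ?ltW// -powRrM mulfV ?gt_eqF// powRr1.
rewrite -poweR_EFin /Lp_norm unlock.
have mpow : measurable_fun setT (fun x => (`|(EFin \o (f : bRn -> R)) x| `^ p)%E).
  apply: (measurableT_comp (measurable_poweR p)).
  by apply: measurableT_comp => //; exact/measurable_EFinP.
suff H : (\int[mu]_x (`|(EFin \o (f : bRn -> R)) x| `^ p) <= (C `^ p * (2 * r) ^+ n)%:E)%E.
  have I0 : (0 <= \int[mu]_x (`|(EFin \o (f : bRn -> R)) x| `^ p))%E.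
    by apply: integral_ge0 => x _; exact: poweR_ge0.
  by apply: ler_poweR => //; rewrite invr_ge0 ltW.
apply: (@le_trans _ _ (\int[mu]_x ((C `^ p)%:E * (\1_B x)%:E))%E).
  apply: ge0_le_integral => //.
  - by move=> x _; exact: poweR_ge0.
  - apply/measurable_EFinP; apply: measurable_funM; first exact: measurable_cst.
    exact: measurable_indic.
  - move=> x _ /=; rewrite -EFinM lee_fin indicE.
    have [xB|] := boolP (x \in B); first by rewrite mulr1 ge0_ler_powR// ?nnegrE// ltW.
    rewrite notin_setE => /f0 ->; rewrite normr0 powR0 ?gt_eqF//.
    by rewrite mulr0.
rewrite ge0_integralZl_EFin ?powR_ge0//; last by apply/measurable_EFinP; exact: measurable_indic.
rewrite integral_indic// setIT EFinM.
by rewrite [X in (_ * X <= _)%E](lebesgue_ball x0 r0).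
Qed.

End fundamental_lemma.

(** * Integrals of powers *)

Section power_integrals.
Variable R : realType.
Local Notation mu := (@lebesgue_measure R).

(** By definition, the integral of a nonnegative function is a supremum over the simple
    functions below it.  The gauge function, to which this applies, may fail to be
    measurable. *)
Lemma ge0_le_integral_nonmeasurable d (T : measurableType d)
    (m : {measure set T -> \bar R}) (D : set T) (f g : T -> \bar R) :
  (forall x, D x -> 0 <= f x)%E -> (forall x, D x -> f x <= g x)%E ->
  (\int[m]_(x in D) f x <= \int[m]_(x in D) g x)%E.
Proof.
move=> f0 fg; rewrite !ge0_integralE//; last first.
  by move=> x Dx; apply: le_trans (fg x Dx); exact: f0.
apply: ge_ereal_sup => _ [h hf <-]; apply: ereal_sup_ubound; exists h => //.
move=> x; apply: (le_trans (hf x)); rewrite !patchE.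
by case: ifPn => // /[!inE]; exact: fg.
Qed.

Lemma ge0_integral_exhaustion_le (f : R -> \bar R) (F : (set R)^nat) (D : set R) M :
  nondecreasing_seq F -> (forall i, measurable (F i)) -> D = \bigcup_i F i ->
  measurable_fun D f -> (forall x, 0 <= f x)%E ->
  (forall i, \int[mu]_(x in F i) f x <= M)%E -> (\int[mu]_(x in D) f x <= M)%E.
Proof.
move=> ndF mF -> mf f0 FM.
have cv : (\int[mu]_(x in F i) f x @[i --> \oo] --> \int[mu]_(x in \bigcup_i F i) f x)%E.
  apply: ge0_nondecreasing_set_cvg_integral => // i.
  by apply: measurable_funS mf => //; [exact: bigcup_measurable|exact: bigcup_sup].
rewrite -(cvg_lim _ cv)//; apply: lime_le; first by apply/cvg_ex; eexists; exact: cv.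
exact: nearW.
Qed.

Lemma powR_continuous_pos (e x : R) : 0 < x -> {for x, continuous (fun t => t `^ e)}.
Proof.
move=> x0; apply: differentiable_continuous; apply/derivable1_diffP.
by have [] := is_derive1_powR e x0.
Qed.

Lemma integral_powR (a b e : R) : 0 < a -> a < b -> e != 0 ->
  (\int[mu]_(x in `[a, b]) (x `^ (e - 1))%:E = ((b `^ e - a `^ e) / e)%:E)%E.
Proof.
move=> a0 ab e0; pose F (t : R) := e^-1 * t `^ e.
have b0 := lt_trans a0 ab.
have dF (x : R) : 0 < x -> hasderiv F x (x `^ (e - 1)).
  move=> x0; have := hasderivMc e^-1 (is_derive1_powR e x0).
  by rewrite mulrA mulVf// mul1r.
have cF (x : R) : 0 < x -> {for x, continuous F}.
  by move=> x0; exact: hasderiv_continuous (dF x x0).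
rewrite (@continuous_FTC2 R (fun x => x `^ (e - 1)) F)//.
- by rewrite -EFinB /F -mulrBr mulrC.
- apply: continuous_in_subspaceT => x; rewrite inE/= in_itv/= => /andP[ax _].
  by apply: powR_continuous_pos; exact: lt_le_trans ax.
- split.
  + by move=> x; rewrite in_itv/= => /andP[ax _]; have [] := dF x (lt_trans a0 ax).
  + by apply: cvg_at_right_filter; exact: cF.
  + by apply: cvg_at_left_filter; exact: cF.
- move=> x; rewrite in_itv/= => /andP[ax _].
  by rewrite derive1E; exact: (@derive_val _ _ _ _ _ _ _ (dF x (lt_trans a0 ax))).
Qed.

Lemma integral_powR_near0 (T e : R) : 0 < T -> 0 < e ->
  (\int[mu]_(x in `]0%R, T]) (x `^ (e - 1))%:E <= (T `^ e / e)%:E)%E.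
Proof.
move=> T0 e0.
have Tk k : 0 < T / k.+2%:R by rewrite divr_gt0.
have TkT k : T / k.+2%:R < T by rewrite ltr_pdivrMr// ltr_pMr// ltr1n.
apply: (@ge0_integral_exhaustion_le _ (fun k => `[T / k.+2%:R, T]%classic)) => //.
- move=> k l kl; apply/subsetPset => x /=; rewrite !in_itv/= => /andP[xk ->].
  rewrite andbT (le_trans _ xk)// ler_pM2l// lef_pV2 ?posrE ?ltr0n//.
  by rewrite ler_nat.
- apply/seteqP; split => [x|x [k _]] /=; rewrite !in_itv/=; last first.
    by move=> /andP[xk ->]; rewrite andbT (lt_le_trans _ xk).
  move=> /andP[x0 xT].
  exists (Num.truncn (T / x)) => //=; rewrite in_itv/= xT andbT.
  rewrite ler_pdivrMr// mulrC -ler_pdivrMr//.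
  by rewrite (le_trans (ltW (truncnS_gt _)))// ler_nat.
- by apply/measurable_EFinP; apply: measurable_funTS; exact: measurable_powR.
- by move=> x; rewrite lee_fin powR_ge0.
- move=> k; rewrite integral_powR ?gt_eqF// lee_fin ler_pM2r ?invr_gt0//.
  by rewrite gerBl powR_ge0.
Qed.

Lemma integral_powR_neary (T e : R) : 0 < T -> e < 0 ->
  (\int[mu]_(x in `]T, +oo[) (x `^ (e - 1))%:E <= (T `^ e / - e)%:E)%E.
Proof.
move=> T0 e0.
have TkT k : T < T * k.+2%:R by rewrite ltr_pMr// ltr1n.
have mp : measurable_fun setT (fun x : R => (x `^ (e - 1))%:E).
  by apply/measurable_EFinP; exact: measurable_powR.
apply: (@le_trans _ _ (\int[mu]_(x in `[T, +oo[) (x `^ (e - 1))%:E)%E).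
  apply: ge0_subset_integral => //; first exact: measurable_funTS.
    by move=> x _; rewrite lee_fin powR_ge0.
  by apply: subset_itvr; rewrite bnd_simp.
apply: (@ge0_integral_exhaustion_le _ (fun k => `[T, T * k.+2%:R]%classic)) => //.
- move=> k l kl; apply/subsetPset => x /=; rewrite !in_itv/= => /andP[-> xk].
  by rewrite (le_trans xk)// ler_pM2l// ler_nat.
- apply/seteqP; split => [x|x [k _]] /=; rewrite !in_itv/= ?andbT; last first.
    by move=> /andP[].
  move=> Tx.
  exists (Num.truncn (x / T)) => //=; rewrite in_itv/= Tx/=.
  rewrite -ler_pdivrMl// mulrC.
  by rewrite (le_trans (ltW (truncnS_gt _)))// ler_nat.
- exact: measurable_funTS.
- by move=> x; rewrite lee_fin powR_ge0.
- move=> k; rewrite integral_powR ?lt_eqF// lee_fin.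
  rewrite invrN mulrN -mulNr ler_nM2r ?invr_lt0//.
  by rewrite lerBrDr addNr powR_ge0.
Qed.

(** Split at T: the integrand is t^((1 - theta) r - 1) T^(-r) below T and
    t^(- theta r - 1) above. *)
Lemma truncated_power_integral (theta r : R) : 0 < theta < 1 -> 0 < r ->
  exists2 C : R, 0 < C & forall (T : R) (F : R -> \bar R), 0 < T ->
   (forall t : R, (0 < t)%R -> 0 <= F t)%E ->
   (forall t : R, (0 < t)%R -> F t <= ((t `^ (- theta) * Num.min 1 (t / T)) `^ r / t)%:E)%E ->
   (\int[mu]_(t in `]0%R, +oo[) F t <= (C * T `^ (- (theta * r)))%:E)%E.
Proof.
move=> /andP[th0 th1] r0.
have e1 : 0 < (1 - theta) * r by rewrite mulr_gt0// subr_gt0.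
have e2 : 0 < theta * r by rewrite mulr_gt0.
exists (((1 - theta) * r)^-1 + (theta * r)^-1); first by rewrite addr_gt0 ?invr_gt0.
move=> T F T0 F0 FT.
pose g1 (t : R) := (T `^ (- r) * t `^ ((1 - theta) * r - 1))%:E.
pose g2 (t : R) := (t `^ (- (theta * r) - 1))%:E.
have g10 t : (0 <= g1 t)%E by rewrite lee_fin mulr_ge0 ?powR_ge0.
have g20 t : (0 <= g2 t)%E by rewrite lee_fin powR_ge0.
have mg1 : measurable_fun setT g1.
  by apply/measurable_EFinP; apply: measurable_funM; [exact: measurable_cst|exact: measurable_powR].
have mg2 : measurable_fun setT g2.
  by apply/measurable_EFinP; exact: measurable_powR.
set D := `]0%R, +oo[%classic : set R; set A := `]0%R, T]%classic : set R.
set B := `]T, +oo[%classic : set R.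
apply: (@le_trans _ _ (\int[mu]_(t in D) ((g1 \_ A) t + (g2 \_ B) t))%E).
  apply: ge0_le_integral_nonmeasurable => t; rewrite /D/= in_itv/= andbT => t0.
    exact: F0.
  have tn0 : t != 0 by rewrite gt_eqF.
  have tA : (t \in A) = (t <= T) by rewrite mem_setE/= in_itv/= t0.
  have tB : (t \in B) = (T < t) by rewrite mem_setE/= in_itv/= andbT.
  apply: (le_trans (FT t t0)); rewrite !patchE tA tB.
  have [tT|tT] := leP t T.
    have tT1 : t / T <= 1 by rewrite ler_pdivrMr// mul1r.
    rewrite adde0 lee_fin min_r//.
    have E : t `^ (- theta) * (t / T) = t `^ (1 - theta) * T `^ (-1).
      rewrite [t `^ (1 - theta)]powRD ?tn0 ?implybT// powRr1 ?ltW// powR_inv1 ?ltW//.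
      by rewrite mulrA [t * _]mulrC.
    rewrite E powRM ?powR_ge0// -!powRrM mulN1r -(powR_inv1 (ltW t0)).
    by rewrite mulrAC -powRD ?tn0 ?implybT// mulrC.
  have tT1 : 1 <= t / T by rewrite ler_pdivlMr// mul1r ltW.
  rewrite [X in (_ <= X)%E](_ : _ = g2 t); last exact: add0e.
  rewrite lee_fin min_l// mulr1 -powRrM.
  rewrite -(powR_inv1 (ltW t0)) -powRD; last by rewrite tn0 implybT.
  by rewrite mulNr.
have mA : measurable A by exact: measurable_itv.
have mB : measurable B by exact: measurable_itv.
have mD : measurable D by exact: measurable_itv.
have AD : D `&` A = A.
  apply: setIidr => x; rewrite /D /A /= !in_itv/= andbT => /andP[]//.
have BD : D `&` B = B.
  by apply: setIidr => x; rewrite /D /B /= !in_itv/= !andbT; apply: lt_trans.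
rewrite ge0_integralD//; last 4 first.
- by move=> x _; apply: erestrict_ge0.
- apply: measurable_funTS; apply/(measurable_restrictT _ _).1 => //.
  exact: measurable_funTS.
- by move=> x _; apply: erestrict_ge0.
- apply: measurable_funTS; apply/(measurable_restrictT _ _).1 => //.
  exact: measurable_funTS.
rewrite -!integral_mkcondr AD BD mulrDl EFinD; apply: leeD.
  rewrite /g1; under eq_integral do rewrite EFinM.
  rewrite ge0_integralZl_EFin ?powR_ge0//; last 2 first.
  - by move=> x _; rewrite lee_fin powR_ge0.
  - by apply/measurable_EFinP; apply: measurable_funTS; exact: measurable_powR.
  apply: (@le_trans _ _ ((T `^ (- r))%:E * (T `^ ((1 - theta) * r) / ((1 - theta) * r))%:E)%E).
    by apply: lee_wpmul2l; [rewrite lee_fin powR_ge0|exact: integral_powR_near0].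
  rewrite -EFinM lee_fin mulrA -powRD; last by rewrite (gt_eqF T0) implybT.
  by rewrite mulrC; have -> : - r + (1 - theta) * r = - (theta * r) by ring.
have eN : - (theta * r) < 0 by rewrite oppr_lt0.
by have := integral_powR_neary T0 eN; rewrite opprK [T `^ _ / _]mulrC.
Qed.

End power_integrals.

(** * Upper bounds for K-functionals and Besov norms *)

Section besov_upper_bound.
Variables (R : realType) (n : nat).
Local Notation Rn := 'rV[R]_n.

Definition K_Lp_sobolev m (p t : R) (f : Rn -> R) : \bar R :=
  K_functional (Lp_space p) (sobolev_space m p) (Lp_norm p) (sobolev_norm m p) t f.

Lemma sobolev_norm_ge0 m p (f : Rn -> R) : (0 <= sobolev_norm m p f)%E.
Proof. by apply: sume_ge0 => k _; exact: Lnorm_ge0. Qed.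

Lemma K_ge0 m p t f : 0 <= t -> (0 <= K_Lp_sobolev m p t f)%E.
Proof.
move=> t0; apply: le_ereal_inf_tmp => _ [z _ <-].
by rewrite adde_ge0 ?Lnorm_ge0// mule_ge0 ?lee_fin// sobolev_norm_ge0.
Qed.

(** The profile A min(1, t / T) is the one met for a bump living on scale T^(1/m). *)
Lemma besov_norm_le m (alpha p : R) (q : \bar R) : 0 < alpha < m%:R -> (0 < q)%E ->
  exists2 C : R, 0 < C & forall (f : Rn -> R) (A T : R), 0 < A -> 0 < T ->
  (forall t, 0 < t -> (K_Lp_sobolev m p t f <= (A * Num.min 1 (t / T))%:E)%E) ->
  (besov_norm m alpha p q f <= (C * A * T `^ (- (alpha / m%:R)))%:E)%E.
Proof.
move=> /andP[al0 alm] q0; set th := alpha / m%:R.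
have m0 : (0 : R) < m%:R := lt_trans al0 alm.
have th01 : 0 < th < 1 by rewrite divr_gt0// ltr_pdivrMr// mul1r.
have /andP[th0 th1] := th01.
have min0 t T : 0 < t -> 0 < T -> 0 <= Num.min 1 (t / T) :> R.
  by move=> t0 T0; rewrite le_min ler01 divr_ge0// ltW.
case: q q0 => [r|_|//]; last first.
  exists 1 => // f A T A0 T0 KA; apply: ge_ereal_sup => _ [t + <-] /=.
  move=> t0_; have t0 : 0 < t by have /andP[] := t0_.
  apply: (@le_trans _ _ ((t `^ (- th))%:E * (A * Num.min 1 (t / T))%:E)%E).
    by apply: lee_wpmul2l; [rewrite lee_fin powR_ge0|exact: KA].
  rewrite -EFinM lee_fin mulrCA mul1r ler_pM2l//.
  have [tT|tT] := leP t T.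
    apply: (@le_trans _ _ (t `^ (- th) * (t / T))).
      by rewrite ler_wpM2l ?powR_ge0// ge_min lexx orbT.
    have -> : t `^ (- th) * (t / T) = t `^ (1 - th) * T^-1.
      rewrite [t `^ (1 - th)]powRD ?(gt_eqF t0) ?implybT// powRr1 ?ltW//.
      by rewrite mulrA [t * _]mulrC.
    have -> : T `^ (- th) = T `^ (1 - th) * T^-1.
      rewrite [T `^ (1 - th)]powRD ?(gt_eqF T0) ?implybT// powRr1 ?ltW//.
      by rewrite mulrAC mulfV ?mul1r// gt_eqF.
    have th1' : 0 <= 1 - th by rewrite subr_ge0 ltW.
    by rewrite ler_pM2r ?invr_gt0// ge0_ler_powR// ?nnegrE ?(ltW t0) ?(ltW T0).
  apply: (@le_trans _ _ (t `^ (- th))).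
    by rewrite -[leRHS]mulr1 ler_wpM2l ?powR_ge0// ge_min lexx.
  by rewrite !powRN lef_pV2 ?posrE ?powR_gt0// ge0_ler_powR// ?nnegrE ?(ltW T0) ?(ltW t0) ?(ltW th0) ?(ltW tT).
rewrite lte_fin => r0.
have [C C0 CP] := truncated_power_integral th01 r0.
exists (C `^ r^-1); first by rewrite powR_gt0.
move=> f A T A0 T0 KA; rewrite /besov_norm /interpolation_norm -/th.
pose G (t : R) : R := (t `^ (- th) * Num.min 1 (t / T)) `^ r * t `^ (-1).
have G0 t : 0 <= G t by rewrite mulr_ge0 ?powR_ge0.
have mG : measurable_fun setT G.
  apply: measurable_funM; last exact: measurable_powR.
  apply: (measurableT_comp (measurable_powR r)).
  apply: measurable_funM; first exact: measurable_powR.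
  apply: measurable_minr; first exact: measurable_cst.
  by apply: measurable_funM; [exact: measurable_id|exact: measurable_cst].
have GP : (\int[lebesgue_measure]_(t in `]0%R, +oo[) (G t)%:E <= (C * T `^ (- (th * r)))%:E)%E.
  apply: CP => // [t t0|t t0]; first by rewrite lee_fin.
  by rewrite lee_fin /G powR_inv1// ltW.
have H : (\int[lebesgue_measure]_(t in `]0%R, +oo[)
   (((t `^ (- th))%:E * K_Lp_sobolev m p t f) `^ r * t^-1%:E) <=
   (A `^ r * (C * T `^ (- (th * r))))%:E)%E.
  apply: (@le_trans _ _ (\int[lebesgue_measure]_(t in `]0%R, +oo[)
    ((A `^ r)%:E * (G t)%:E))%E).
    apply: ge0_le_integral_nonmeasurable => t /=; rewrite in_itv/= andbT => t0.
      by rewrite mule_ge0 ?poweR_ge0// lee_fin invr_ge0 ltW.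
    have -> : ((A `^ r)%:E * (G t)%:E =
        ((t `^ (- th))%:E * (A * Num.min 1 (t / T))%:E) `^ r * t^-1%:E)%E.
      rewrite -!EFinM /G powR_inv1 ?ltW//; congr (_%:E).
      rewrite [X in _ = X `^ r * _]mulrCA [in RHS]powRM ?mulr_ge0 ?powR_ge0 ?min0 ?ltW//.
      by rewrite mulrA.
    apply: lee_wpmul2r; first by rewrite lee_fin invr_ge0 ltW.
    have le1 : ((t `^ (- th))%:E * K_Lp_sobolev m p t f <=
        (t `^ (- th))%:E * (A * Num.min 1 (t / T))%:E)%E.
      by apply: lee_wpmul2l; [rewrite lee_fin powR_ge0|exact: KA].
    have le0 : (0 <= (t `^ (- th))%:E * K_Lp_sobolev m p t f)%E.
      by rewrite mule_ge0 ?K_ge0 ?lee_fin ?powR_ge0// ltW.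
    by apply: ler_poweR => //; exact: ltW.
  rewrite ge0_integralZl_EFin ?powR_ge0//; last 2 first.
  - by move=> x _; rewrite lee_fin.
  - by apply/measurable_EFinP; exact: measurable_funTS.
  by rewrite EFinM; apply: lee_wpmul2l; rewrite ?lee_fin ?powR_ge0.
have -> : C `^ r^-1 * A * T `^ (- th) = (A `^ r * (C * T `^ (- (th * r)))) `^ r^-1.
  rewrite powRM ?powR_ge0 ?mulr_ge0 ?powR_ge0 ?ltW// powRM ?powR_ge0 ?ltW//.
  by rewrite -!powRrM mulfV ?gt_eqF// powRr1 ?ltW// mulrA mulNr mulfK ?gt_eqF// [A * _]mulrC.
rewrite -poweR_EFin.
have I0 : (0 <= \int[lebesgue_measure]_(t in `]0%R, +oo[)
   (((t `^ (- th))%:E * K_Lp_sobolev m p t f) `^ r * t^-1%:E))%E.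
  apply: integral_ge0 => t /=; rewrite in_itv/= andbT => t0.
  by rewrite mule_ge0 ?poweR_ge0// lee_fin invr_ge0 ltW.
by apply: ler_poweR => //; rewrite invr_ge0 ltW.
Qed.

Lemma smooth_cst (c : R) : smooth (fun _ : Rn => c).
Proof.
suff H s : exists c', iter_partial s (fun _ : Rn => c) = fun=> c'.
  move=> s; have [c' ->] := H s; split; first exact: continuous_cstr.
  by move=> x i; exact: derivable_cst.
elim: s => [|i s [c' IH]]; first by exists c.
exists 0; rewrite [iter_partial _ _]/(partial i (iter_partial s _)) IH.
by apply/funext => x; exact: derive_cst.
Qed.

Lemma iter_partial0 s : iter_partial s (fun _ : Rn => 0) = fun=> 0 :> R.
Proof.
elim: s => [//|i s IH]; rewrite [iter_partial _ _]/(partial i (iter_partial s _)) IH.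
by apply/funext => x; exact: derive_cst.
Qed.

Lemma test_function0 : test_function (fun _ : Rn => 0 : R).
Proof.
split; first exact: smooth_cst.
by apply: (@compact_closure_support _ _ _ 0).
Qed.

Lemma Lp_norm0 p : 0 < p -> Lp_norm p (fun _ : Rn => 0) = 0%E.
Proof. by move=> p0; apply: Lnorm0; rewrite gt_eqF. Qed.

Lemma sobolev_norm0 m p : 0 < p -> sobolev_norm m p (fun _ : Rn => 0) = 0%E.
Proof.
move=> p0; apply: big1 => k _; rewrite (Lp_norm_weak_deriv _ _ (smooth_cst 0)).
by rewrite /classical_deriv iter_partial0 Lp_norm0.
Qed.

Lemma continuous_support_Lp p (f : Rn -> R) M : 0 < p -> continuous f ->
  (forall x : Rn, M < `|x| -> f x = 0) -> Lp_space p f.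
Proof.
move=> p0 cf fM; have mf := continuous_borel_measurable cf.
split => //; have [C C0 CP] := continuous_bounded_support cf fM.
have B0 : 0 < `|M| + 1 by rewrite ltr_wpDl.
apply: le_lt_trans (ltry _).
apply: (@Lp_norm_ball_le R n p C (`|M| + 1) 0) => // x xB; apply: fM.
rewrite ltNge; apply/negP => xM; apply: xB.
rewrite mx_norm_ball /ball_/= sub0r normrN.
by rewrite (le_lt_trans xM)// (le_lt_trans (ler_norm _))// ltrDl.
Qed.

Lemma test_function_sobolev m p (f : Rn -> R) : 0 < p -> test_function f -> sobolev_space m p f.
Proof.
move=> p0 tf; have [M M0 MP] := test_function_support tf; split.
  move=> k _; exists (classical_deriv (fun i => k i) f).
    exact: classical_weak_deriv tf.1.
  apply: (@continuous_support_Lp p _ M) => //; first exact: (tf.1 _).1.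
  exact: iter_partial_support.
move=> e e0; exists f => //.
rewrite (_ : f \- f = fun=> 0) ?sobolev_norm0 ?lte_fin//.
by apply/funext => x /=; rewrite subrr.
Qed.

Lemma test_function_Lp p (f : Rn -> R) : 0 < p -> test_function f -> Lp_space p f.
Proof.
move=> p0 tf; have [M M0 MP] := test_function_support tf.
by apply: (@continuous_support_Lp p _ M) => //; exact: (tf.1 [::]).1.
Qed.

(** The decompositions f = f + 0 and f = 0 + f. *)
Lemma K_test_function_le m p t (f : Rn -> R) (a b : R) : 0 < p -> 0 < t -> test_function f ->
  (Lp_norm p f <= a%:E)%E -> (sobolev_norm m p f <= b%:E)%E ->
  (K_Lp_sobolev m p t f <= (Num.min a (t * b))%:E)%E.
Proof.
move=> p0 t0 tf fa fb.
have K1 : (K_Lp_sobolev m p t f <= a%:E)%E.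
  apply: le_trans fa; apply: ereal_inf_lbound; exists (f, fun=> 0).
    split => /=; [exact: test_function_Lp|exact: test_function_sobolev test_function0|].
    by apply/funext => x /=; rewrite addr0.
  by rewrite /= sobolev_norm0// mule0 adde0.
have K2 : (K_Lp_sobolev m p t f <= (t * b)%:E)%E.
  rewrite EFinM; apply: (@le_trans _ _ (t%:E * sobolev_norm m p f)%E); last first.
    by apply: lee_wpmul2l => //; rewrite lee_fin ltW.
  apply: ereal_inf_lbound; exists (fun=> 0, f).
    split => /=; [exact: test_function_Lp test_function0|exact: test_function_sobolev|].
    by apply/funext => x /=; rewrite add0r.
  by rewrite /= Lp_norm0// add0e.
by rewrite EFin_min le_min K1 K2.
Qed.

End besov_upper_bound.

(** * Capacity of balls *)

Section capacity_of_balls.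
Variables (R : realType) (n : nat).
Local Notation Rn := 'rV[R]_n.
Local Notation bRn := (borel 'rV[R]_n).

Lemma normalized_bump m : exists (G : nat -> R -> R) (B : R),
  [/\ tower G, 1 <= B, forall v, 0 <= G 0%N v, forall v, `|v| <= 2^-1 -> 1 <= G 0%N v &
   (forall k v, 1 <= `|v| -> G k v = 0) /\
   (forall k v, (k <= m)%N -> `|G k v| <= B)].
Proof.
have [D [tD D0 Dout [c c0 Dc]]] := @bump_tower R.
pose G k v := c^-1 * D k v.
have tG : tower G by move=> k v; apply: hasderivMc; exact: tD.
have Gout k v : 1 <= `|v| -> G k v = 0 by move=> v1; rewrite /G Dout// mulr0.
have /choice[C CP] : forall k : nat, exists C : R, 0 <= C /\ forall v, `|G k v| <= C.
  move=> k; have [|C C0 CP] := @tower_bounded R (fun j => G (j + k)%N) 1 (tower_shift k tG) _ 1.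
    by move=> v v1; apply: Gout; rewrite ler_normr; apply/orP; right; lra.
  exists C; split => // v; have [v1|v1] := leP v 1; first exact: CP.
  by rewrite Gout ?normr0// ler_normr ltW.
exists G, (1 + \sum_(k < m.+1) C k); split => //.
- by rewrite lerDl; apply: sumr_ge0 => k _; have [] := CP k.
- by move=> v; rewrite mulr_ge0 ?invr_ge0 ?(ltW c0).
- by move=> v v2; rewrite /G ler_pdivlMl// mulr1; exact: Dc.
- split=> // k v km; rewrite (le_trans ((CP k).2 v))//.
  rewrite (bigD1 (Ordinal (n:=m.+1) (m:=k) km))//= addrCA lerDl addr_ge0//.
  by apply: sumr_ge0 => j _; have [] := CP j.
Qed.

Lemma test_function_schwartz (f : Rn -> R) : test_function f -> schwartz f.
Proof.
move=> tf; have [M M0 MP] := test_function_support tf; split; first exact: tf.1.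
move=> b k.
have cm : continuous (fun x : Rn => \prod_i x ord0 i ^+ b i).
  apply: (@continuous_big R _ (@GRing.mul R) 1 predT).
    by move=> [x y]; exact: mul_continuous.
  move=> i _ x; apply: (@continuous_comp _ _ _ (fun x : Rn => x ord0 i) (fun y : R => y ^+ b i)).
    exact: coord_continuous.
  exact: exprn_continuous.
have cf : continuous (multi_partial k f) := (tf.1 _).1.
have [|C _ CP] := @continuous_bounded_support R n
  (fun x : Rn => (\prod_i x ord0 i ^+ b i) * multi_partial k f x) M (continuous_mulr cm cf).
  by move=> x xM; rewrite /multi_partial (iter_partial_support _ MP) // mulr0.
by exists C.
Qed.

Lemma classical_deriv_tensor (D : 'I_n -> nat -> R -> R) k : (forall i, tower (D i)) ->
  classical_deriv k (tensor D (fun=> 0%N)) = tensor D k.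
Proof.
move=> tD; rewrite /classical_deriv iter_partial_tensor//.
by congr tensor; apply/funext => i; rewrite add0n count_rev count_multi_index.
Qed.

Lemma eucl_dist_coord (x y : Rn) i : `|x ord0 i - y ord0 i| <= eucl_dist x y.
Proof.
rewrite /eucl_dist -[leLHS]sqrtr_sqr ler_wsqrtr//.
rewrite (bigD1 i)//= lerDl; apply: sumr_ge0 => j _; exact: sqr_ge0.
Qed.

(** A bump equal to at least 1 on the ball and rescaled to twice its radius: the L^p norm
    scales as s^(n/p) and the norms of the derivatives of order m as s^(n/p - m), so the
    Besov norm scales as s^(n/p - alpha). *)
Lemma besov_capacity_ball m (alpha p : R) (q : \bar R) : 0 < alpha < m%:R ->
  0 < p -> (0 < q)%E -> exists2 C : R, 0 < C &
  forall (x0 : Rn) rho, 0 < rho ->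
  (besov_capacity m alpha p q (eucl_ball x0 rho) <= (C * rho `^ (n%:R - alpha * p))%:E)%E.
Proof.
move=> alm p0 q0; have [G [B [tG B1 G0 G1 [Gout GB]]]] := normalized_bump m.
have m0 : (0 : R) < m%:R by case/andP: alm => a0; exact: lt_trans.
have B0 : 0 < B := lt_le_trans ltr01 B1.
have [Cb Cb0 CbP] := @besov_norm_le R n m alpha p q alm q0.
pose Nc : R := #|[pred k : {ffun 'I_n -> 'I_m.+1} | order_eq k]|%:R.
have Nc0 : 0 <= Nc by [].
exists ((Cb * B ^+ n * (Nc + 1)) `^ p * 4 ^+ n * 2 `^ (- (alpha * p))).
  by rewrite !mulr_gt0 ?powR_gt0 ?exprn_gt0 ?mulr_gt0 ?exprn_gt0// ltr_wpDl.
move=> x0 rho rho0; pose s := 2 * rho; have s0 : 0 < s by rewrite mulr_gt0.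
pose D i := rescale (x0 ord0 i) s G.
have tD i : tower (D i) by exact: tower_rescale.
pose f : Rn -> R := tensor D (fun=> 0%N).
have Dout i k v : s <= `|v - x0 ord0 i| -> D i k v = 0.
  move=> h; rewrite /D /rescale Gout ?mulr0// normrM normfV (gtr0_norm s0).
  by rewrite ler_pdivlMr// mul1r.
have tf : test_function f.
  apply: (@tensor_test_function _ _ _ _ (s + `|x0|)) => //.
    by rewrite addr_ge0// ltW.
  move=> i v h; apply: Dout; have xX := norm_coord x0 i.
  have := lerB_dist v (x0 ord0 i); lra.
have fball (k : 'I_n -> nat) x : ~ ball x0 s x -> tensor D k x = 0.
  move=> xB; have [i xi] : exists i, s <= `|x ord0 i - x0 ord0 i|.
    apply: contrapT => H; apply: xB; apply/rV_ballP; split => // i.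
    by rewrite ltNge distrC; apply/negP => h; apply: H; exists i.
  by apply: (@tensor_eq0 _ _ _ _ i); exact: Dout.
have fbnd (k : 'I_n -> nat) x : (\sum_i k i <= m)%N ->
    `|tensor D k x| <= B ^+ n * s^-1 ^+ (\sum_i k i)%N.
  move=> km; rewrite /tensor normr_prod.
  have -> : B ^+ n * s^-1 ^+ (\sum_i k i)%N = \prod_(i < n) (B * s^-1 ^+ k i).
    by rewrite big_split/= prodr_const card_ord -expr_sum.
  apply: ler_prod => i _; rewrite normr_ge0/= /D /rescale normrM mulrC.
  rewrite normrX normfV (gtr0_norm s0) ler_wpM2r ?exprn_ge0 ?invr_ge0 ?(ltW s0)//.
  by apply: GB; rewrite (leq_trans _ km)// (bigD1 i)//= leq_addr.
pose a : R := B ^+ n * ((2 * s) ^+ n) `^ p^-1.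
have a0 : 0 < a by rewrite mulr_gt0 ?exprn_gt0// powR_gt0// exprn_gt0// mulr_gt0.
have mtens k : measurable_fun setT (tensor D k : bRn -> R).
  by apply: continuous_borel_measurable; exact: tensor_continuous.
have fa : (Lp_norm p f <= a%:E)%E.
  apply: (@Lp_norm_ball_le R n p (B ^+ n) s x0) => //.
    exact: mtens.
    move=> x; have := @fbnd (fun=> 0%N) (x : Rn).
    by rewrite big1// expr0 mulr1 => /(_ isT).
  exact: fball.
have fb : (sobolev_norm m p f <= (Nc * (s^-1 ^+ m * a))%:E)%E.
  rewrite /sobolev_norm.
  apply: (@le_trans _ _ (\sum_(k : {ffun 'I_n -> 'I_m.+1} | order_eq k) (s^-1 ^+ m * a)%:E)%E).
    apply: lee_sum => k /eqP km.
    rewrite (Lp_norm_weak_deriv _ _ tf.1) classical_deriv_tensor// mulrA.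
    rewrite [s^-1 ^+ m * B ^+ n]mulrC.
    apply: (@Lp_norm_ball_le R n p (B ^+ n * s^-1 ^+ m) s x0) => //.
      by move=> x; have := @fbnd (fun i => k i) (x : Rn); rewrite km; apply.
    exact: fball.
  by rewrite sumEFin lee_fin sumr_const mulr_natl.
pose A := a * (Nc + 1); have A0 : 0 < A by rewrite mulr_gt0// ltr_wpDl.
pose T := s ^+ m; have T0 : 0 < T by rewrite exprn_gt0.
have KA t : 0 < t -> (K_Lp_sobolev m p t f <= (A * Num.min 1 (t / T))%:E)%E.
  move=> t0; apply: (le_trans (K_test_function_le p0 t0 tf fa fb)).
  rewrite lee_fin minr_pMr ?(ltW A0)// mulr1 le_min !ge_min; apply/andP; split.
    by rewrite /A ler_peMr ?(ltW a0)// lerDr.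
  apply/orP; right; rewrite /A /T exprVn.
  have -> : t * (Nc * ((s ^+ m)^-1 * a)) = (a * Nc) * (t / s ^+ m) by ring.
  by rewrite ler_wpM2r ?divr_ge0 ?(ltW t0) ?(ltW T0)// ler_wpM2l ?(ltW a0)// lerDl.
have bf := CbP f A T A0 T0 KA.
have bf0 : (0 <= besov_norm m alpha p q f)%E.
  rewrite /besov_norm /interpolation_norm; case: (q) q0 => [r|_|//].
    by move=> _; exact: poweR_ge0.
  apply: le_ereal_sup_tmp.
  eexists; first by exists 1; [rewrite /= in_itv/= ltr01|reflexivity].
  by rewrite mule_ge0 ?lee_fin ?powR_ge0//; exact: K_ge0.
apply: (@le_trans _ _ (besov_norm m alpha p q f `^ p)%E).
  apply: ereal_inf_lbound; exists f => //; split.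
  - exact: test_function_schwartz.
  - move=> x; apply: prodr_ge0 => i _; rewrite /D /rescale expr0 mul1r; exact: G0.
  - move=> x xB; apply: (big_ind (fun y : R => 1 <= y)) => // [y z y1 z1|i _].
      by rewrite -[1]mulr1 ler_pM.
    rewrite /D /rescale expr0 mul1r; apply: G1.
    rewrite normrM normfV (gtr0_norm s0) ler_pdivrMr// /s mulKf//.
    rewrite distrC (le_trans (eucl_dist_coord x0 x i))// ltW//.
apply: (@le_trans _ _ ((Cb * A * T `^ (- (alpha / m%:R)))%:E `^ p)%E).
  by apply: ler_poweR => //; exact: ltW.
rewrite poweR_EFin lee_fin.
have -> : T `^ (- (alpha / m%:R)) = s `^ (- alpha).
  by rewrite /T -powR_mulrn ?(ltW s0)// -powRrM mulrN mulrCA mulfV ?mulr1// gt_eqF.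
have -> : Cb * A * s `^ (- alpha) =
    (Cb * B ^+ n * (Nc + 1)) * (((2 * s) ^+ n) `^ p^-1 * s `^ (- alpha)).
  by rewrite /A /a; ring.
rewrite powRM; last 2 first.
- by rewrite !mulr_ge0 ?exprn_ge0 ?(ltW Cb0) ?(ltW B0) ?addr_ge0.
- by rewrite mulr_ge0 ?powR_ge0.
rewrite [X in _ * X]powRM ?powR_ge0// -!powRrM mulVf ?gt_eqF// powRr1; last first.
  by apply: exprn_ge0; apply: mulr_ge0 => //; exact: ltW.
rewrite mulNr -!mulrA ler_wpM2l ?powR_ge0// /s mulrA powRM ?(ltW rho0)//.
have -> : rho `^ (n%:R - alpha * p) = rho ^+ n * rho `^ (- (alpha * p)).
  by rewrite powRD ?(gt_eqF rho0) ?implybT// powR_mulrn// ltW.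
rewrite (_ : 2 * 2 = 4); last by ring.
by rewrite exprMn -!mulrA ler_wpM2l ?exprn_ge0// mulrCA.
Qed.

End capacity_of_balls.

(** * Tents *)

Section geometry.
Variables (R : realType) (n : nat).
Local Notation Rn := 'rV[R]_n.
Implicit Types (x y z : Rn) (O : set Rn).

Lemma cauchy_schwarz_sum (a b : 'I_n -> R) :
  (\sum_i a i * b i) ^+ 2 <= (\sum_i a i ^+ 2) * (\sum_i b i ^+ 2).
Proof.
have H : 0 <= \sum_i \sum_j (a i * b j - a j * b i) ^+ 2.
  by apply: sumr_ge0 => i _; apply: sumr_ge0 => j _; exact: sqr_ge0.
have E : \sum_i \sum_j (a i * b j - a j * b i) ^+ 2 =
    2 * ((\sum_i a i ^+ 2) * (\sum_i b i ^+ 2)) - 2 * (\sum_i a i * b i) ^+ 2.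
  have E1 : (\sum_i a i ^+ 2) * (\sum_i b i ^+ 2) = \sum_i \sum_j a i ^+ 2 * b j ^+ 2.
    by rewrite mulr_suml; apply: eq_bigr => i _; rewrite mulr_sumr.
  have E2 : (\sum_i a i * b i) ^+ 2 = \sum_i \sum_j (a i * b i) * (a j * b j).
    by rewrite expr2 mulr_suml; apply: eq_bigr => i _; rewrite mulr_sumr.
  have E3 : \sum_i \sum_j a i ^+ 2 * b j ^+ 2 = \sum_i \sum_j a j ^+ 2 * b i ^+ 2.
    exact: exchange_big.
  rewrite mulr_natl mulr2n {2}E1 E3 E1 E2 mulr_sumr -big_split/= -sumrB.
  apply: eq_bigr => i _; rewrite mulr_sumr -big_split/= -sumrB.
  by apply: eq_bigr => j _; ring.
move: H; rewrite E; lra.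
Qed.

Lemma eucl_dist_ge0 x y : 0 <= eucl_dist x y.
Proof. exact: sqrtr_ge0. Qed.

Lemma eucl_distC x y : eucl_dist x y = eucl_dist y x.
Proof.
by rewrite /eucl_dist; congr Num.sqrt; apply: eq_bigr => i _; rewrite -sqrrN opprB.
Qed.

Lemma eucl_dist_triangle x y z : eucl_dist x z <= eucl_dist x y + eucl_dist y z.
Proof.
rewrite -[leRHS]ger0_norm ?addr_ge0 ?eucl_dist_ge0// -sqrtr_sqr ler_wsqrtr//.
rewrite sqrrD !sqr_sqrtr; try by apply: sumr_ge0 => i _; exact: sqr_ge0.
pose a (i : 'I_n) := x ord0 i - y ord0 i; pose b (i : 'I_n) := y ord0 i - z ord0 i.
have -> : \sum_i (x ord0 i - z ord0 i) ^+ 2 =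
    \sum_i a i ^+ 2 + 2 * \sum_i a i * b i + \sum_i b i ^+ 2.
  rewrite mulr_sumr -!big_split/=; apply: eq_bigr => i _; rewrite /a /b; ring.
rewrite lerD2r lerD2l mulr_natl ler_pMn2r// -sqrtrM; last first.
  by apply: sumr_ge0 => i _; exact: sqr_ge0.
apply: (le_trans (ler_norm _)); rewrite -sqrtr_sqr ler_wsqrtr//.
exact: cauchy_schwarz_sum.
Qed.

Lemma eucl_dist_le_norm x y : eucl_dist x y <= n%:R * `|x - y|.
Proof.
rewrite -[leRHS]ger0_norm ?mulr_ge0// -sqrtr_sqr ler_wsqrtr//.
apply: (@le_trans _ _ (\sum_(i < n) `|x - y| ^+ 2)).
  apply: ler_sum => i _; rewrite -real_normK ?num_real// lerXn2r ?nnegrE//.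
  by have := norm_coord (x - y) i; rewrite !mxE.
rewrite sumr_const card_ord -[leLHS]mulr_natl exprMn ler_wpM2r ?sqr_ge0//.
by case: n => [|k]; rewrite ?expr0n// expr2 ler_peMl// ler1n.
Qed.

Lemma near_eucl_dist x (e : R) : 0 < e -> \forall y \near x, eucl_dist x y < e.
Proof.
move=> e0; have n0 : 0 < n%:R + 1 :> R by rewrite ltr_wpDl.
have d0 : 0 < e / (n%:R + 1) by rewrite divr_gt0.
near=> y; have h : `|x - y| < e / (n%:R + 1).
  near: y; apply/nbhs_ballP; exists (e / (n%:R + 1)) => //= y.
  by rewrite mx_norm_ball.
apply: (le_lt_trans (eucl_dist_le_norm x y)).
move: h; rewrite ltr_pdivlMr// => h; apply: le_lt_trans h.
by rewrite mulrC ler_wpM2l// lerDl.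
Unshelve. all: by end_near. Qed.

Lemma open_eucl_ball x r : open (eucl_ball x r).
Proof.
rewrite openE => y; rewrite /eucl_ball/= => xy.
have e0 : 0 < r - eucl_dist x y by rewrite subr_gt0.
have := near_eucl_dist y e0; apply: filterS => z /= yz.
have := eucl_dist_triangle x y z; lra.
Qed.

Lemma boundary_open_notin O y : open O -> boundary O y -> ~ O y.
Proof. by move=> oO [_]; rewrite (interior_id _).1. Qed.

Lemma set_dist_gt x A (t : R) : (t%:E < set_dist x A)%E ->
  forall y, A y -> t < eucl_dist x y.
Proof.
move=> h y Ay; rewrite -lte_fin; apply: (lt_le_trans h).
by apply: ereal_inf_lbound; exists y.
Qed.

Lemma le_set_dist x A (t : R) : (forall y, A y -> t <= eucl_dist x y) ->
  (t%:E <= set_dist x A)%E.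
Proof. by move=> h; apply: le_ereal_inf_tmp => _ [y Ay <-]; rewrite lee_fin h. Qed.

(** If a segment from x leaves O, the first point outside O on it is a boundary
    point of O, at distance at least t from x. *)
Lemma tent_ball_sub x t O : open O -> O x -> (t%:E < set_dist x (boundary O))%E ->
  eucl_ball x t `<=` O.
Proof.
move=> oO Ox tO y /= xy; apply: contrapT => nOy.
pose g (s : R) : Rn := x + s *: (y - x).
have cg : continuous g.
  move=> s; apply: (@cvgD R Rn R (nbhs s) _ (fun=> x) (fun s => s *: (y - x)) x (s *: (y - x))).
    exact: cvg_cst.
  by apply: cvgZr_tmp; exact: cvg_id.
(* the boundary point is at the infimum of the parameters outside O *)
pose A := [set s : R | 0 <= s <= 1 /\ ~ O (g s)].
have A1 : A 1 by split; rewrite ?ler01 ?lexx// /g scale1r addrC subrK.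
have lA : has_lbound A by exists 0 => s [/andP[]].
have infA : has_inf A by split; [exists 1|].
pose s0 := inf A.
have s00 : 0 <= s0 by apply: lb_le_inf; [exists 1|move=> s [/andP[]]].
have s01 : s0 <= 1 by exact: ge_inf.
have dg s : 0 <= s -> eucl_dist x (g s) = s * eucl_dist x y.
  move=> h; rewrite /eucl_dist -[in RHS](ger0_norm h) -sqrtr_sqr -sqrtrM ?sqr_ge0//.
  congr Num.sqrt; rewrite mulr_sumr; apply: eq_bigr => i _; rewrite !mxE; ring.
have nOg : ~ O (g s0).
  move=> Og.
  have /nbhs_ballP[d /= d0 dP] : nbhs s0 (g @^-1` O).
    by apply: cg; exact: open_nbhs_nbhs.
  have [s [As ss]] : exists s, A s /\ s < s0 + d.
    by have [s As ss] := inf_adherent d0 infA; exists s.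
  have s0s : s0 <= s by exact: ge_inf.
  by apply: As.2; apply: dP; rewrite /ball/= ltr_distlC; apply/andP; split; lra.
have bO : boundary O (g s0).
  split; last by rewrite (interior_id _).1.
  move=> B /cg /nbhs_ballP[d /= d0 dP].
  have s0p : 0 < s0.
    rewrite lt_neqAle s00 andbT; apply/eqP => s0E; apply: nOg.
    by rewrite -s0E /g scale0r addr0.
  pose s := s0 - Num.min s0 d / 2.
  have mp : 0 < Num.min s0 d by rewrite lt_min s0p.
  have ms : Num.min s0 d <= s0 by rewrite ge_min lexx.
  have md : Num.min s0 d <= d by rewrite ge_min lexx orbT.
  have sA : s < s0 by rewrite /s; lra.
  have sge : 0 <= s by rewrite /s; lra.
  exists (g s); split; last first.
    by apply: dP; rewrite /ball/= /s; rewrite opprD addNKr opprK gtr0_norm ?divr_gt0//; lra.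
  apply: contrapT => nO; have : A s by split => //; apply/andP; split => //; lra.
  by move=> /(ge_inf lA); rewrite leNgt sA.
have := set_dist_gt tO bO; rewrite dg// => h.
have : s0 * eucl_dist x y <= eucl_dist x y by rewrite ler_piMl// eucl_dist_ge0.
by move: xy; rewrite /eucl_ball/=; lra.
Qed.

Lemma half_space_gt0 (z : half_space R n) : 0 < (set_val z).2.
Proof. by have := set_valP z. Qed.

Lemma ball_in_tent x0 (a b r : R) (z : half_space R n) :
  eucl_dist x0 (set_val z).1 <= a -> (set_val z).2 <= b -> a + b < r ->
  tent (eucl_ball x0 r) z.
Proof.
move=> za zb abr; have z0 := half_space_gt0 z; split.
  rewrite /eucl_ball/=; lra.
apply: (@lt_le_trans _ _ (r - a)%:E); first by rewrite lte_fin; lra.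
apply: le_set_dist => y /(boundary_open_notin (@open_eucl_ball x0 r)).
rewrite /eucl_ball/= => /negP; rewrite -leNgt => h.
have := eucl_dist_triangle x0 (set_val z).1 y; lra.
Qed.

(** Tents over open sets are open, the distance to the boundary being continuous. *)
Lemma measurable_tent O : open O -> @measurable _ (borel (half_space R n)) (tent O).
Proof.
move=> oO; apply: sub_sigma_algebra.
pose W := [set z : Rn * R | O z.1 /\ (z.2%:E < set_dist z.1 (boundary O))%E].
suff oW : open W.
  have -> : tent O = (set_val : half_space R n -> _) @^-1` W by [].
  by apply: open_comp => // z _; exact: initial_continuous.
rewrite openE => -[x t] [/= Ox tx].
have [r tr rx] : exists2 r : R, t < r & (r%:E <= set_dist x (boundary O))%E.
  move: tx; case: (set_dist x (boundary O)) => [s|_|//].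
    by rewrite lte_fin => ts; exists s.
  by exists (t + 1); rewrite ?ltrDl// leey.
have e0 : 0 < (r - t) / 3 by rewrite divr_gt0// subr_gt0.
have nO : \forall y \near x, O y by exact: open_nbhs_nbhs.
have nx := near_eucl_dist x e0.
have nt : \forall s \near t, s < t + (r - t) / 3.
  by apply: lt_nbhsl; rewrite ltrDl.
have nO' : nbhs ((x, t) : (Rn * R)%type) [set z : Rn * R | O z.1].
  by apply: (@cvg_fst _ _ (nbhs x) (nbhs t) (nbhs_filter t)); exact: nO.
have nx' : nbhs ((x, t) : (Rn * R)%type) [set z : Rn * R | eucl_dist x z.1 < (r - t) / 3].
  exact: (@cvg_fst _ _ (nbhs x) (nbhs t) (nbhs_filter t) [set y | eucl_dist x y < (r - t) / 3] nx).
have nt' : nbhs ((x, t) : (Rn * R)%type) [set z : Rn * R | z.2 < t + (r - t) / 3].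
  exact: (@cvg_snd _ _ (nbhs x) (nbhs t) (nbhs_filter x) [set s | s < t + (r - t) / 3] nt).
have FF : Filter (nbhs ((x, t) : (Rn * R)%type)) by exact: nbhs_filter.
have := @filterI _ _ FF _ _ (@filterI _ _ FF _ _ nO' nx') nt'.
apply: (@filterS _ _ FF) => z /= [[Oz zx] zt]; split => //.
apply: (@lt_le_trans _ _ (r - (r - t) / 3)%:E); first by rewrite lte_fin; lra.
apply: le_set_dist => y By.
have : r <= eucl_dist x y.
  by rewrite -lee_fin; apply: (le_trans rx); apply: ereal_inf_lbound; exists y.
have := eucl_dist_triangle x z.1 y; lra.
Qed.

End geometry.

(** * Multiscale averages and the K-functional *)

Section kernels.
Variables (R : realType) (n m : nat).
Local Notation Rn := 'rV[R]_n.
Local Notation bRn := (borel 'rV[R]_n).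
Local Notation mu := (@lebesgue R n).
Variables (y eta : R -> nat -> R -> R) (C L : R).
Hypotheses (C1 : 1 <= C) (L1 : 1 <= L).
Hypothesis y_tower : forall t, tower (y t).
Hypothesis eta_tower : forall t, tower (eta t).
Hypothesis eta_y : forall t v, eta t m v = y t 0%N v - 2^-1 * y (t / 2) 0%N (v / 2).
Hypothesis y_bound : forall t v, 0 <= t <= 1 -> `|y t 0%N v| <= C.
Hypothesis eta_bound : forall t v, 0 <= t <= 1 -> `|eta t 0%N v| <= C.
Hypothesis y_out : forall t v, L <= `|v| -> y t 0%N v = 0.
Hypothesis eta_out : forall t v, L <= `|v| -> eta t 0%N v = 0.

Definition kern (D : nat -> R -> R) (s : R) (x u : Rn) : R :=
  s^-1 ^+ n * \prod_i D 0%N ((u ord0 i - x ord0 i) * s^-1).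

(** The multi-index of the m-th derivative in the direction i. *)
Definition pure_index (i : 'I_n) : {ffun 'I_n -> 'I_m.+1} :=
  [ffun j => if j == i then ord_max else ord0].

Lemma pure_index_order i : order_eq (pure_index i).
Proof.
rewrite /order_eq/= (bigD1 i)//= ffunE eqxx/= big1 ?addn0// => j ji.
by rewrite ffunE (negbTE ji).
Qed.

Lemma kern_eq0 D s (x u : Rn) j : D 0%N ((u ord0 j - x ord0 j) * s^-1) = 0 ->
  kern D s x u = 0.
Proof. by move=> D0; rewrite /kern (bigD1 j)//= D0 mul0r mulr0. Qed.

Lemma notin_ball_coord (x u : Rn) r : 0 < r -> ~ ball x r u ->
  exists i, r <= `|u ord0 i - x ord0 i|.
Proof.
move=> r0 xu; apply: contrapT => H; apply: xu; apply/rV_ballP; split => // i.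
by rewrite ltNge distrC; apply/negP => h; apply: H; exists i.
Qed.

Section one_scale.
Variables (t s : R) (x : Rn).
Hypotheses (t01 : 0 <= t <= 1) (s0 : 0 < s).

Let t201 : 0 <= t / 2 <= 1.
Proof. by case/andP: t01 => t0 t1; apply/andP; split; lra. Qed.

(** The factors of the i-th term of the telescoped difference of two product kernels:
    the fine kernel before i, the primitive at i, the coarse kernel after i. *)
Definition mixed (i j : 'I_n) : nat -> R -> R :=
  if (j < i)%N then rescale (x ord0 j) s (y t) else
  if j == i then rescale (x ord0 j) s (eta t) else
  fun k v => 2^-1 * rescale (x ord0 j) (2 * s) (y (t / 2)) k v.

Lemma mixed_tower i j : tower (mixed i j).
Proof.
rewrite /mixed; case: ifP => _; first exact: tower_rescale.
case: ifP => _; first exact: tower_rescale.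
by move=> k v; apply: hasderivMc; exact: tower_rescale.
Qed.

Lemma mixed_bound i j v : `|mixed i j 0%N v| <= C.
Proof.
rewrite /mixed; case: ifP => _; first by rewrite /rescale expr0 mul1r y_bound.
case: ifP => _; first by rewrite /rescale expr0 mul1r eta_bound.
rewrite /rescale expr0 mul1r normrM gtr0_norm ?invr_gt0//.
have := y_bound ((v - x ord0 j) * (2 * s)^-1) t201; have := normr_ge0 (y (t / 2) 0%N ((v - x ord0 j) * (2 * s)^-1)).
by set z := `|_|; lra.
Qed.

Lemma mixed_out i j v : 2 * L * s <= `|v - x ord0 j| -> mixed i j 0%N v = 0.
Proof.
have L0 : 0 < L by apply: lt_le_trans L1.
move=> h.
have h1 : L <= `|(v - x ord0 j) * s^-1|.
  rewrite normrM normfV (gtr0_norm s0) ler_pdivlMr//.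
  by apply: le_trans h; rewrite ler_pM2r//; lra.
have h2 : L <= `|(v - x ord0 j) * (2 * s)^-1|.
  rewrite normrM normfV (@gtr0_norm _ (2 * s)) ?mulr_gt0// ler_pdivlMr ?mulr_gt0//.
  by rewrite mulrA [L * 2]mulrC.
rewrite /mixed; case: ifP => _; first by rewrite /rescale y_out// mulr0.
case: ifP => _; first by rewrite /rescale eta_out// mulr0.
by rewrite /rescale y_out// !mulr0.
Qed.

Definition mixed_tensor i : Rn -> R := tensor (mixed i) (fun=> 0%N).

Lemma mixed_tensor_bound i u : `|mixed_tensor i u| <= C ^+ n.
Proof.
have <- : \prod_(i < n) C = C ^+ n by rewrite prodr_const card_ord.
rewrite /mixed_tensor /tensor normr_prod.
by apply: ler_prod => j _; rewrite normr_ge0 mixed_bound.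
Qed.

Let Ls0 : 0 < 2 * L * s.
Proof. by rewrite !mulr_gt0// (lt_le_trans _ L1). Qed.

Lemma mixed_tensor_out i u : ~ ball x (2 * L * s) u -> mixed_tensor i u = 0.
Proof.
move=> /(notin_ball_coord Ls0)[j h]; apply: (@tensor_eq0 _ _ _ _ j).
exact: mixed_out.
Qed.

Lemma mixed_tensor_test i : test_function (mixed_tensor i).
Proof.
apply: (@tensor_test_function _ _ _ _ (2 * L * s + `|x|)) => //.
- by rewrite addr_ge0// ltW.
- by move=> j; exact: mixed_tower.
- move=> j v h; apply: mixed_out; have xX := norm_coord x j.
  have := lerB_dist v (x ord0 j); lra.
Qed.

(** Telescoping the product leaves in the i-th term the one-dimensional difference in
    the variable i, which is the m-th derivative of eta. *)
Lemma kern_difference u : kern (y t) s x u - kern (y (t / 2)) (2 * s) x u =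
  s^-1 ^+ n * \sum_i s ^+ m * multi_partial (fun j => pure_index i j) (mixed_tensor i) u.
Proof.
pose a j := y t 0%N ((u ord0 j - x ord0 j) * s^-1).
pose b j := 2^-1 * y (t / 2) 0%N ((u ord0 j - x ord0 j) * (2 * s)^-1).
have -> : kern (y (t / 2)) (2 * s) x u = s^-1 ^+ n * \prod_j b j.
  rewrite /kern /b big_split/= prodr_const card_ord mulrA; congr (_ * _).
  by rewrite -exprMn invfM mulrC.
rewrite -mulrBr prod_telescope; congr (_ * _); apply: eq_bigr => i _.
rewrite multi_partial_tensor; last by move=> j; exact: mixed_tower.
rewrite /tensor [in RHS](bigD1 i)//= [in LHS](bigD1 i)//= ltnn eqxx mulrA; congr (_ * _).
  rewrite /mixed ltnn eqxx ffunE eqxx/= add0n /rescale mulrA -exprMn mulfV ?gt_eqF//.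
  by rewrite expr1n mul1r eta_y /a /b -mulrA -invfM [s * 2]mulrC.
apply: eq_bigr => j ji; rewrite ffunE (negbTE ji)/= addn0 /mixed (negbTE ji).
by case: ifP => _; rewrite /rescale expr0 mul1r.
Qed.

Lemma kern_difference_bound u :
  `|s ^+ n * (kern (y t) s x u - kern (y (t / 2)) (2 * s) x u)| <= 2 * C ^+ n.
Proof.
have P (t' v : R) : 0 <= t' <= 1 -> `|\prod_i y t' 0%N ((u ord0 i - x ord0 i) * v)| <= C ^+ n.
  have <- : \prod_(i < n) C = C ^+ n by rewrite prodr_const card_ord.
  move=> t'01; rewrite normr_prod.
  by apply: ler_prod => j _; rewrite normr_ge0 y_bound.
have -> : 2 * C ^+ n = C ^+ n + C ^+ n by ring.
rewrite mulrBr (le_trans (ler_normB _ _))// lerD//.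
  by rewrite /kern mulrA -exprMn mulfV ?gt_eqF// expr1n mul1r P.
rewrite /kern mulrA -exprMn invfM mulrCA mulfV ?gt_eqF// mulr1 normrM.
rewrite -[leRHS]mul1r ler_pM// ?P//.
by rewrite ger0_norm ?exprn_ge0// exprn_ile1// invf_le1// ler1n.
Qed.

Lemma kern_difference_out u : ~ ball x (2 * L * s) u ->
  kern (y t) s x u - kern (y (t / 2)) (2 * s) x u = 0.
Proof.
have L0 : 0 < L by apply: lt_le_trans L1.
move=> /(notin_ball_coord Ls0)[j h]; rewrite !(@kern_eq0 _ _ _ _ j) ?subrr//; apply: y_out.
  rewrite normrM normfV (@gtr0_norm _ (2 * s)) ?mulr_gt0// ler_pdivlMr ?mulr_gt0//.
  by rewrite mulrA [L * 2]mulrC.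
rewrite normrM normfV (gtr0_norm s0) ler_pdivlMr//.
by apply: le_trans h; rewrite ler_pM2r//; lra.
Qed.

End one_scale.

Lemma kern_continuous D s x : tower D -> continuous (kern D s x).
Proof.
move=> tD; apply: continuous_mulr; first exact: continuous_cstr.
apply: (@continuous_big R _ (@GRing.mul R) 1 predT).
  by move=> [a b]; exact: mul_continuous.
move=> i _ u.
apply: (@continuous_comp _ _ _ (fun u : Rn => u ord0 i) (fun v => D 0%N ((v - x ord0 i) * s^-1))).
  exact: coord_continuous.
have := @tower_continuous _ _ 0%N (tower_rescale (x ord0 i) s tD) (u ord0 i).
rewrite (_ : rescale _ _ _ _ = fun v => D 0%N ((v - x ord0 i) * s^-1))//.
by apply/funext => v; rewrite /rescale expr0 mul1r.
Qed.

(** Either a <= lam, or a^(1-p) <= lam^(1-p). *)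
Lemma le_powR_split (a lam p : R) : 0 <= a -> 0 < lam -> 1 < p ->
  a <= lam + lam `^ (1 - p) * a `^ p.
Proof.
move=> a0 lam0 p1; have [al|la] := leP a lam.
  by rewrite (le_trans al)// lerDl mulr_ge0 ?powR_ge0.
have a00 : 0 < a := lt_trans lam0 la.
have aE : a = a `^ (1 - p) * a `^ p.
  by rewrite -powRD ?(gt_eqF a00) ?implybT// subrK powRr1.
rewrite {1}aE; apply: (@le_trans _ _ (lam `^ (1 - p) * a `^ p)).
  rewrite ler_wpM2r ?powR_ge0// -[1 - p]opprB !powRN lef_pV2 ?posrE ?powR_gt0//.
  by rewrite ge0_ler_powR ?nnegrE ?(ltW a00) ?(ltW lam0) ?(ltW la)// subr_ge0 ltW.
by rewrite lerDr ltW.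
Qed.

Lemma integral_le_power (B : set bRn) (w : bRn -> R) (lam p b : R) :
  measurable B -> (mu B <= b%:E)%E -> measurable_fun setT w -> 0 < lam -> 1 < p ->
  (\int[mu]_(u in B) `|w u|%:E <=
   (lam * b)%:E + (lam `^ (1 - p))%:E * \int[mu]_(u in B) (`|w u| `^ p)%:E)%E.
Proof.
move=> mB Bb mw lam0 p1.
have mwp : measurable_fun setT (fun u => `|w u| `^ p).
  apply: (measurableT_comp (measurable_powR p)).
  exact: measurableT_comp.
apply: (@le_trans _ _ (\int[mu]_(u in B)
    (lam%:E + (lam `^ (1 - p))%:E * (`|w u| `^ p)%:E))%E).
  apply: ge0_le_integral => //.
  - apply: measurable_funTS; apply/measurable_EFinP; exact: measurableT_comp.
  - apply: measurable_funTS; apply/measurable_EFinP; apply: measurable_funD.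
      exact: measurable_cst.
    by apply: measurable_funM; [exact: measurable_cst|].
  - by move=> u _; rewrite -EFinM -EFinD lee_fin le_powR_split.
rewrite ge0_integralD//; last 3 first.
- by move=> u _; rewrite lee_fin ltW.
- by move=> u _; rewrite -EFinM lee_fin mulr_ge0 ?powR_ge0.
- apply: measurable_funTS; apply/measurable_EFinP.
  by apply: measurable_funM; [exact: measurable_cst|].
apply: leeD.
  rewrite integral_cst// EFinM; apply: lee_wpmul2l => //.
  by rewrite lee_fin ltW.
rewrite ge0_integralZl_EFin ?powR_ge0//.
by apply: measurable_funTS; exact/measurable_EFinP.
Qed.

Lemma integral_mul_bounded (w : bRn -> R) (phi : Rn -> R) x r c :
  loc_integrable w -> continuous phi -> 0 < r -> (forall u, `|phi u| <= c) ->
  (forall u, ~ ball x r u -> phi u = 0) ->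
  (`|\int[mu]_u (w u * phi u)%:E| <= c%:E * \int[mu]_(u in ball x r) `|w u|%:E)%E.
Proof.
move=> lw cphi r0 phic phi0.
have mw := loc_integrable_measurable lw.
have mphi := continuous_borel_measurable cphi.
have c0 : 0 <= c by apply: le_trans (phic 0).
pose B : set bRn := ball x r.
have mB : measurable B by exact: measurable_rV_ball.
have mwp : measurable_fun setT (fun u => (w u * phi u)%:E).
  by apply/measurable_EFinP; exact: measurable_funM.
apply: (le_trans (le_abse_integral mu measurableT mwp)).
rewrite -ge0_integralZl_EFin//; last first.
  by apply: measurable_funTS; apply/measurable_EFinP; exact: measurableT_comp.
rewrite [leRHS]integral_mkcond; apply: ge0_le_integral => //.
- by apply: measurableT_comp.
- apply/(measurable_restrictT _ _).1 => //; apply: measurable_funTS.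
  apply/measurable_EFinP; apply: measurable_funM; first exact: measurable_cst.
  exact: measurableT_comp.
- move=> u _; rewrite patchE.
  have [_|] := boolP (u \in B).
    by rewrite -EFinM lee_fin normrM mulrC ler_wpM2r.
  by rewrite notin_setE => /phi0 ->; rewrite mulr0 abse0.
Qed.

Lemma Lp_norm_pow (p a : R) (g : Rn -> R) : 0 < p ->
  (Lp_norm p g <= a%:E)%E -> (\int[mu]_u (`|g u| `^ p)%:E <= (a `^ p)%:E)%E.
Proof.
move=> p0 ga; have pn0 : p != 0 by rewrite gt_eqF.
rewrite (_ : (\int[mu]_u (`|g u| `^ p)%:E)%E = (Lp_norm p g `^ p)%E); last first.
  by rewrite /Lp_norm powR_Lnorm.
rewrite -poweR_EFin.
have N0 : (0 <= Lp_norm p g)%E by exact: Lnorm_ge0.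
by apply: ler_poweR => //; exact: ltW.
Qed.

(** The integral is replaced by 0 when it is infinite; this does not occur for the
    functions considered. *)
Definition average (f : Rn -> R) D s x : R := fine (\int[mu]_u (f u * kern D s x u)%:E).

Lemma kern_out D s (x : Rn) u (l : R) : 0 < s -> 0 < l ->
  (forall v, l <= `|v| -> D 0%N v = 0) -> ~ ball x (l * s) u -> kern D s x u = 0.
Proof.
move=> s0 l0 D0 /notin_ball_coord[|j h]; first by rewrite mulr_gt0.
apply: (@kern_eq0 _ _ _ _ j); apply: D0.
by rewrite normrM normfV (gtr0_norm s0) ler_pdivlMr.
Qed.

Lemma ball_norm_out (x : Rn) r (phi : Rn -> R) : (forall u, ~ ball x r u -> phi u = 0) ->
  forall u : Rn, `|x| + r < `|u| -> phi u = 0.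
Proof.
move=> phi0 u h; apply: phi0; rewrite mx_norm_ball /ball_/= => xu.
have := lerB_dist u x; rewrite distrC; lra.
Qed.

Lemma kern_integrable (w : bRn -> R) D s (x : Rn) (l : R) : loc_integrable w ->
  tower D -> 0 < s -> 0 < l -> (forall v, l <= `|v| -> D 0%N v = 0) ->
  mu.-integrable setT (fun u => (w u * kern D s x u)%:E).
Proof.
move=> lw tD s0 l0 D0.
apply: (@loc_integrable_mul_support _ _ _ _ (`|x| + l * s)) => //.
  exact: kern_continuous.
apply: ball_norm_out => u; exact: kern_out.
Qed.

Lemma Rintegral_sum (I : finType) (h : I -> bRn -> R) :
  (forall i, mu.-integrable setT (EFin \o h i)) ->
  mu.-integrable setT (EFin \o (fun u => \sum_i h i u)) /\
  \int[mu]_u (\sum_i h i u) = \sum_i \int[mu]_u h i u.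
Proof.
move=> ih; suff H (r : seq I) : mu.-integrable setT (EFin \o (fun u => \sum_(i <- r) h i u)) /\
  \int[mu]_u (\sum_(i <- r) h i u) = \sum_(i <- r) \int[mu]_u h i u by exact: H.
elim: r => [|i r [IH1 IH2]].
  split; first by under eq_fun do rewrite /= big_nil; exact: integrable0.
  under [LHS]eq_Rintegral do rewrite big_nil.
  by rewrite big_nil Rintegral_cst// mul0r.
have E : (fun u => \sum_(j <- i :: r) h j u) = (fun u => h i u + \sum_(j <- r) h j u).
  by apply/funext => u; rewrite big_cons.
rewrite E; split.
  rewrite (_ : _ \o _ = (EFin \o h i) \+ (EFin \o fun u => \sum_(j <- r) h j u))//.
  exact: integrableD.
by rewrite RintegralD// IH2 big_cons.
Qed.

(** A decomposition whose cost in the K-functional is below a.  What is kept of the second summand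
    are its weak derivatives w_i, through their defining identity only. *)
Lemma K_decomposition (f : Rn -> R) (p a s : R) : (0 < n)%N -> continuous f ->
  0 < s -> (K_Lp_sobolev m p (s ^+ m) f < a%:E)%E ->
  exists g : Rn -> R, exists w : 'I_n -> Rn -> R,
  [/\ loc_integrable g /\ forall i, loc_integrable (w i),
    (Lp_norm p g <= a%:E)%E, forall i, ((s ^+ m)%:E * Lp_norm p (w i) <= a%:E)%E &
    forall i phi, test_function phi ->
      \int[mu]_u ((f u - g u) * multi_partial (fun j => pure_index i j) phi u) =
      (-1) ^+ m * \int[mu]_u (w i u * phi u)].
Proof.
move=> n0 cf s0 /ereal_inf_lt[_ [[g h] /= [gL hW fE] <-] gha].
have sm0 : 0 < s ^+ m by rewrite exprn_gt0.
have hw (k : {ffun 'I_n -> 'I_m.+1}) : order_eq k -> is_weak_deriv (fun i => k i) h (weak_deriv (fun i => k i) h).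
  move=> ok; have [w' hw' _] := hW.1 _ ok; apply: (@xgetPex _ (cst 0) [set w | is_weak_deriv (fun i => k i) h w]).
  by exists w'.
have hg i := hw _ (pure_index_order i).
have lh : loc_integrable h by case: (hg (Ordinal n0)).
have N0 : (0 <= Lp_norm p g)%E by exact: Lnorm_ge0.
have S0 : (0 <= (s ^+ m)%:E * sobolev_norm m p h)%E.
  by rewrite mule_ge0 ?sobolev_norm_ge0// lee_fin ltW.
exists g, (fun i => weak_deriv (fun j => pure_index i j) h); split.
- split; last by move=> i; case: (hg i).
  have -> : g = (fun u => f u - h u) by apply/funext => u; rewrite fE/= addrK.
  move=> K cK; have mK := compact_borel_measurable cK.
  exact: (integrableB mK (continuous_loc_integrable cf cK) (lh K cK)).
- by apply: le_trans (ltW gha); rewrite leeDl.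
- move=> i; apply: le_trans (ltW gha); apply: (@le_trans _ _ ((s ^+ m)%:E * sobolev_norm m p h)%E).
    apply: lee_wpmul2l; first by rewrite lee_fin ltW.
    rewrite /sobolev_norm (bigD1 (pure_index i)) ?pure_index_order//=.
    by rewrite leeDl// sume_ge0// => k _; exact: Lnorm_ge0.
  by rewrite leeDr.
move=> i phi tphi; have [_ _ /(_ phi tphi) E] := hg i.
have so : (\sum_(j < n) pure_index i j)%N = m by exact/eqP/pure_index_order.
rewrite /Rintegral (_ : (fun u => _) = (fun u => (h u * multi_partial (fun j => pure_index i j) phi u)%:E)).
  rewrite E so fineM//; apply: integrable_fin_num => //.
  have [M _ hM] := test_function_support tphi.
  apply: (@loc_integrable_mul_support _ _ _ _ M) => //; first by case: (hg i).
  exact: (tphi.1 [::]).1.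
by apply/funext => u; rewrite fE/= addrC addKr.
Qed.

(** The difference of averages is the integral of g against the difference of the kernels
    plus, after moving the m-th derivatives onto the second summand, the integrals of
    s^m w_i against bounded functions.  The powers |g|^p and |s^m w_i|^p are collected in W;
    the level lam interpolates between the L^1 and L^p sizes on the ball.  W does not depend
    on the parameter t, which varies with the point of the tent. *)
Lemma average_difference (f : Rn -> R) (p a s : R) : (0 < n)%N -> continuous f ->
  1 < p -> 0 < s -> (K_Lp_sobolev m p (s ^+ m) f < a%:E)%E ->
  exists W : bRn -> R, [/\ forall u, 0 <= W u, measurable_fun setT W,
    (\int[mu]_u (W u)%:E <= (n.+1%:R * a `^ p)%:E)%E &
    forall t x lam, 0 <= t <= 1 -> 0 < lam ->
    (`|average f (y t) s x - average f (y (t / 2)) (2 * s) x|%:E <=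
     ((2 * C ^+ n * n.+1%:R * (4 * L) ^+ n) * lam)%:E +
     (2 * C ^+ n * s^-1 ^+ n * lam `^ (1 - p))%:E *
       \int[mu]_(u in ball x (2 * L * s)) (W u)%:E)%E].
Proof.
move=> n0 cf p1 s0 /(K_decomposition n0 cf s0)[g [w [[lg lw] ga wa gw]]].
have p0 : 0 < p by apply: lt_trans p1.
have L0 : 0 < L by apply: lt_le_trans L1.
have C0 : 0 <= C by apply: le_trans C1.
have sm0 : 0 < s ^+ m by rewrite exprn_gt0.
have a0 : 0 <= a by rewrite -lee_fin; apply: le_trans ga; exact: Lnorm_ge0.
have mg : measurable_fun setT (g : bRn -> R) := loc_integrable_measurable lg.
have nE (c : R) : n.+1%:R * c = c + n%:R * c by rewrite -natr1; ring.
pose v i : bRn -> R := fun u => s ^+ m * w i u.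
have lv i : loc_integrable (v i : Rn -> R).
  move=> K cK; rewrite (_ : _ \o _ = (fun u => (s ^+ m)%:E * (EFin \o (w i : bRn -> R)) u)%E)//.
  by apply: integrableZl; [exact: compact_borel_measurable|exact: lw].
have mv i : measurable_fun setT (v i) := loc_integrable_measurable (lv i).
have mpow (h : bRn -> R) : measurable_fun setT h -> measurable_fun setT (fun u => `|h u| `^ p).
  move=> mh; apply: (measurableT_comp (measurable_powR p)).
  exact: measurableT_comp.
pose W : bRn -> R := fun u => `|g u| `^ p + \sum_i `|v i u| `^ p.
have mW : measurable_fun setT W.
  apply: measurable_funD; first exact: mpow.
  by apply: measurable_sum => i; exact: mpow.
have WE (D : set bRn) : measurable D -> (\int[mu]_(u in D) (W u)%:E =
    \int[mu]_(u in D) (`|g u| `^ p)%:E + \sum_i \int[mu]_(u in D) (`|v i u| `^ p)%:E)%E.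
  move=> mD; under eq_integral do rewrite /W EFinD -sumEFin.
  have mE (h : bRn -> R) : measurable_fun setT h -> measurable_fun D (fun u => (`|h u| `^ p)%:E).
    by move=> mh; apply: measurable_funTS; apply/measurable_EFinP; exact: mpow.
  rewrite ge0_integralD//; last 3 first.
  - exact: mE.
  - by move=> u _; rewrite sume_ge0// => i _; rewrite lee_fin powR_ge0.
  - by apply: emeasurable_sum => i; exact: mE.
  by rewrite ge0_integral_sum// => i; exact: mE.
have W0 u : 0 <= W u.
  by rewrite addr_ge0 ?powR_ge0// sumr_ge0// => i _; exact: powR_ge0.
exists W; split.
- exact: W0.
- exact: mW.
- rewrite WE// nE EFinD; apply: leeD.
    exact: Lp_norm_pow.
  rewrite mulr_natl -[X in a `^ p *+ X](card_ord n) -sumr_const -sumEFin.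
  apply: lee_sum => i _.
  have wp : (\int[mu]_u (`|w i u| `^ p)%:E <= ((a / s ^+ m) `^ p)%:E)%E.
    by apply: Lp_norm_pow => //; rewrite EFinM lee_pdivlMr// muleC.
  rewrite (eq_integral (fun u : bRn => ((s ^+ m) `^ p)%:E * (`|w i u| `^ p)%:E)%E); last first.
    by move=> u _; rewrite -EFinM -powRM ?(ltW sm0)// normrM (gtr0_norm sm0).
  rewrite ge0_integralZl_EFin ?powR_ge0//; last first.
    by apply/measurable_EFinP; apply: mpow; exact: loc_integrable_measurable.
  apply: le_trans (lee_wpmul2l _ wp) _; first by rewrite lee_fin powR_ge0.
  by rewrite -EFinM -powRM ?(ltW sm0) ?divr_ge0 ?(ltW sm0)// mulrCA divff ?gt_eqF// mulr1.
move=> t x lam t01 lam0; set B : set bRn := ball x (2 * L * s).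
have r0 : 0 < 2 * L * s by rewrite !mulr_gt0.
have mB : measurable B by exact: measurable_rV_ball.
have muB : (mu B <= ((4 * L) ^+ n * s ^+ n)%:E)%E.
  have -> : mu B = ((2 * (2 * L * s)) ^+ n)%:E by exact: lebesgue_ball.
  by rewrite -exprMn lee_fin (_ : 2 * (2 * L * s) = 4 * L * s)//; ring.
have t201 : 0 <= t / 2 <= 1 by case/andP: t01 => ? ?; apply/andP; split; lra.
have s20 : 0 < 2 * s by rewrite mulr_gt0.
pose P u := kern (y t) s x u - kern (y (t / 2)) (2 * s) x u.
pose T i := mixed_tensor t s x i.
have tT i : test_function (T i) by exact: mixed_tensor_test.
have lf : loc_integrable f := continuous_loc_integrable cf.
have cP : continuous (fun u => s ^+ n * P u).
  apply: continuous_mulr; first exact: continuous_cstr.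
  apply: continuous_addr; first exact: kern_continuous.
  by apply: continuous_oppr; exact: kern_continuous.
have Pout u : ~ B u -> s ^+ n * P u = 0.
  by move=> uB; rewrite /P kern_difference_out//  mulr0.
have iP (h : Rn -> R) : loc_integrable h -> mu.-integrable setT (fun u => (h u * (s ^+ n * P u))%:E).
  move=> lh; apply: (@loc_integrable_mul_support _ _ _ _ (`|x| + 2 * L * s)) => //.
  exact: ball_norm_out.
have PE u : s ^+ n * P u = \sum_i s ^+ m * multi_partial (fun j => pure_index i j) (T i) u.
  by rewrite /P kern_difference// mulrA -exprMn mulfV ?gt_eqF// expr1n mul1r.
have JE : average f (y t) s x - average f (y (t / 2)) (2 * s) x = s^-1 ^+ n *
    (\int[mu]_u (g u * (s ^+ n * P u)) + \sum_i (-1) ^+ m * \int[mu]_u (v i u * T i u)).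
  have JB : average f (y t) s x - average f (y (t / 2)) (2 * s) x = \int[mu]_u (f u * P u).
    rewrite /average -/(Rintegral _ _ _) -/(Rintegral _ _ _) -RintegralB//; last 2 first.
    - by apply: (@kern_integrable _ _ _ _ L) => // z; exact: y_out.
    - by apply: (@kern_integrable _ _ _ _ L) => // z; exact: y_out.
    by apply: eq_Rintegral => u _; rewrite /P mulrBr.
  have JE' : \int[mu]_u (f u * P u) = s^-1 ^+ n * \int[mu]_u (f u * (s ^+ n * P u)).
    rewrite -RintegralZl//; last exact: iP.
    have sn : s^-1 ^+ n * s ^+ n = 1 by rewrite -exprMn mulVf ?gt_eqF// expr1n.
    by apply: eq_Rintegral => u _; rewrite -[LHS]mul1r -sn; ring.
  rewrite JB JE'; congr (_ * _).
  have lfg : loc_integrable (fun u => f u - g u).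
    by move=> K cK; exact: (integrableB (compact_borel_measurable cK) (lf K cK) (lg K cK)).
  have ih i : mu.-integrable setT (EFin \o (fun u : bRn =>
      (f u - g u) * multi_partial (fun j => pure_index i j) (T i) u)).
    apply: (@loc_integrable_mul_support _ _ _ _ (`|x| + 2 * L * s)) => //.
      exact: ((tT i).1 _).1.
    apply: iter_partial_support; apply: ball_norm_out => u; exact: mixed_tensor_out.
  have ihs i : mu.-integrable setT (EFin \o (fun u : bRn =>
      s ^+ m * ((f u - g u) * multi_partial (fun j => pure_index i j) (T i) u))).
    exact: (integrableZl measurableT (s ^+ m) (ih i)).
  have [isum Es] := Rintegral_sum ihs.
  rewrite (_ : \sum_i _ = \sum_i \int[mu]_u (s ^+ m * ((f u - g u) * multi_partial (fun j => pure_index i j) (T i) u))).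
    rewrite -Es -RintegralD//; last exact: iP.
    apply: eq_Rintegral => u _; rewrite PE !mulr_sumr -big_split/=.
    by apply: eq_bigr => i _; ring.
  apply: eq_bigr => i _; rewrite RintegralZl// gw// mulrCA; congr (_ * _).
  rewrite -RintegralZl//; last first.
    apply: (@loc_integrable_mul_support _ _ _ _ (`|x| + 2 * L * s)) => //.
      exact: ((tT i).1 [::]).1.
    by apply: ball_norm_out => u; exact: mixed_tensor_out.
  by apply: eq_Rintegral => u _; rewrite /v mulrA.
rewrite JE; apply: (@le_trans _ _ ((s^-1 ^+ n)%:E * ((2 * C ^+ n)%:E *
   (\int[mu]_(u in B) `|g u|%:E + \sum_i \int[mu]_(u in B) `|v i u|%:E)))%E).
  rewrite normrM ger0_norm ?exprn_ge0 ?invr_ge0 ?(ltW s0)// EFinM.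
  apply: lee_wpmul2l; first by rewrite lee_fin exprn_ge0 ?invr_ge0 ?(ltW s0).
  rewrite muleDr//; last first.
    by apply: ge0_adde_def; rewrite inE ?integral_ge0// sume_ge0// => i _; exact: integral_ge0.
  apply: (@le_trans _ _ (`|\int[mu]_u (g u * (s ^+ n * P u))|%:E +
      \sum_i `|\int[mu]_u (v i u * T i u)|%:E)%E).
    rewrite sumEFin -EFinD lee_fin (le_trans (ler_normD _ _))// lerD2l.
    rewrite (le_trans (ler_norm_sum _ _ _))// ler_sum// => i _.
    by rewrite normrM normrX normrN1 expr1n mul1r.
  have absR (h : bRn -> R) : mu.-integrable setT (fun u => (h u)%:E) ->
      `|\int[mu]_u h u|%:E = `|\int[mu]_u (h u)%:E|%E.
    by move=> ih; rewrite /Rintegral -abse_EFin fineK//; apply: integrable_fin_num.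
  apply: leeD.
    rewrite absR; last exact: iP.
    by apply: integral_mul_bounded => // u; exact: kern_difference_bound.
  rewrite ge0_sume_distrr//; last by move=> i _; exact: integral_ge0.
  apply: lee_sum => i _; rewrite absR; last first.
    apply: (@loc_integrable_mul_support _ _ _ _ (`|x| + 2 * L * s)) => //.
      exact: ((tT i).1 [::]).1.
    by apply: ball_norm_out => u; exact: mixed_tensor_out.
  apply: integral_mul_bounded => //; first exact: ((tT i).1 [::]).1.
    move=> u; apply: (@le_trans _ _ (C ^+ n)); first exact: mixed_tensor_bound.
    by rewrite ler_peMl ?exprn_ge0// ler1n.
  by move=> u; exact: mixed_tensor_out.
apply: (@le_trans _ _ ((s^-1 ^+ n)%:E * ((2 * C ^+ n)%:E *
   ((n.+1%:R * (lam * ((4 * L) ^+ n * s ^+ n)))%:E + (lam `^ (1 - p))%:E *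
    \int[mu]_(u in B) (W u)%:E)))%E).
  apply: lee_wpmul2l; first by rewrite lee_fin exprn_ge0 ?invr_ge0 ?(ltW s0).
  apply: lee_wpmul2l; first by rewrite lee_fin mulr_ge0 ?exprn_ge0.
  rewrite WE// muleDr//; last first.
    by apply: ge0_adde_def; rewrite inE ?integral_ge0// sume_ge0// => i _; exact: integral_ge0.
  rewrite nE EFinD addeACA; apply: leeD.
    exact: integral_le_power.
  rewrite mulr_natl -[X in _ *+ X](card_ord n) -sumr_const -sumEFin.
  rewrite ge0_sume_distrr//; last by move=> i _; exact: integral_ge0.
  by rewrite -big_split/=; apply: lee_sum => i _; exact: integral_le_power.
have I0 : (0 <= \int[mu]_(u in B) (W u)%:E)%E.
  by apply: integral_ge0 => u _; rewrite lee_fin W0.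
have sn : s^-1 ^+ n * s ^+ n = 1 by rewrite -exprMn mulVf ?gt_eqF// expr1n.
rewrite muleA -EFinM ge0_muleDr ?lee_fin//; last 2 first.
  rewrite mulr_ge0 ?ler0n// mulr_ge0 ?(ltW lam0)// mulr_ge0//.
    by rewrite exprn_ge0// mulr_ge0// ltW.
  by rewrite exprn_ge0// ltW.
  by rewrite mule_ge0// lee_fin powR_ge0.
rewrite muleA -!EFinM [in X in (_ + X <= _)%E]mulrAC; apply: leeD.
  rewrite lee_fin (_ : s^-1 ^+ n * (2 * C ^+ n) * (n.+1%:R * (lam * ((4 * L) ^+ n * s ^+ n))) =
    (s^-1 ^+ n * s ^+ n) * (2 * C ^+ n * n.+1%:R * (4 * L) ^+ n * lam)); last by ring.
  by rewrite sn mul1r.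
rewrite (_ : s^-1 ^+ n * lam `^ (1 - p) * (2 * C ^+ n) = 2 * C ^+ n * s^-1 ^+ n * lam `^ (1 - p))//.
by ring.
Qed.
End kernels.

(** * Telescoping over scales *)

Section averages.
Variables (R : realType) (n : nat).
Local Notation Rn := 'rV[R]_n.
Local Notation bRn := (borel 'rV[R]_n).
Local Notation mu := (@lebesgue R n).

(** The kernel is supported where f >= 1. *)
Lemma average_ge (f : Rn -> R) D (c r s : R) (x : Rn) : (0 < n)%N -> continuous f -> tower D ->
  0 < c -> (forall v, 0 <= D 0%N v) -> (forall v, 1 <= `|v| -> D 0%N v = 0) ->
  (forall v, `|v| <= 2^-1 -> c <= D 0%N v) ->
  (forall u, eucl_ball x r u -> 1 <= f u) -> 0 < s -> n%:R * s <= r ->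
  c ^+ n <= average f D s x.
Proof.
move=> n0 cf tD c0 D0 Dout Dc f1 s0 sr.
have n0R : 0 < n%:R :> R by rewrite ltr0n.
have fk u : kern D s x u <= f u * kern D s x u.
  have [xu|xu] := pselect (ball x (1 * s) u); last first.
    by rewrite (kern_out s0 ltr01 Dout xu) mulr0.
  rewrite ler_peMl//.
    by rewrite mulr_ge0 ?exprn_ge0 ?invr_ge0 ?(ltW s0)// prodr_ge0.
  apply: f1; apply: lt_le_trans sr; apply: (le_lt_trans (eucl_dist_le_norm x u)).
  by rewrite ltr_pM2l//; move: xu; rewrite mx_norm_ball /ball_/= mul1r.
have kc u : ball x (s / 2) u -> c ^+ n * s^-1 ^+ n <= kern D s x u.
  move=> /rV_ballP[_ xu]; rewrite /kern mulrC ler_pM2l ?exprn_gt0 ?invr_gt0//.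
  have <- : \prod_(i < n) c = c ^+ n by rewrite prodr_const card_ord.
  apply: ler_prod => i _; rewrite (ltW c0) Dc// normrM normfV (gtr0_norm s0).
  by rewrite ler_pdivrMr// mulrC distrC ltW.
have k0 u : 0 <= kern D s x u.
  by rewrite mulr_ge0 ?exprn_ge0 ?invr_ge0 ?(ltW s0)// prodr_ge0.
have lf : loc_integrable f := continuous_loc_integrable cf.
have ifk : mu.-integrable setT (fun u => (f u * kern D s x u)%:E).
  by apply: (@kern_integrable _ _ _ _ _ _ 1).
have mB : @measurable _ bRn (ball x (s / 2)) by apply: measurable_rV_ball.
rewrite -lee_fin /average fineK; last exact: integrable_fin_num.
apply: (@le_trans _ _ (\int[mu]_(u in (ball x (s / 2) : set bRn)) (c ^+ n * s^-1 ^+ n)%:E)%E).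
  have muB : mu (ball x (s / 2)) = (s ^+ n)%:E.
    have -> : mu (ball x (s / 2)) = ((2 * (s / 2)) ^+ n)%:E by apply: lebesgue_ball; rewrite divr_gt0.
    by rewrite mulrC divfK.
  rewrite integral_cst// -[X in (_ * X)%E]/(mu (ball x (s / 2))) muB.
  by rewrite -EFinM -mulrA -exprMn mulVf ?gt_eqF// expr1n mulr1.
rewrite integral_mkcond; apply: ge0_le_integral => //.
- move=> u _; rewrite patchE; case: ifPn => // _.
  by rewrite lee_fin mulr_ge0 ?exprn_ge0 ?invr_ge0 ?(ltW s0) ?(ltW c0).
- by apply/(measurable_restrictT _ _).1 => //; exact: measurable_cst.
- by case/integrableP: ifk.
- move=> u _; rewrite patchE; case: ifPn => [|_]; last by rewrite lee_fin (le_trans (k0 u)).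
  by rewrite inE => /kc h; rewrite lee_fin (le_trans h).
Qed.

Lemma multi_partial0 (f : Rn -> R) : multi_partial (fun=> 0%N) f = f.
Proof. by rewrite /multi_partial; elim: (enum _). Qed.

(** Decay follows from the boundedness of x_i f(x) for each coordinate i. *)
Lemma schwartz_vanish (f : Rn -> R) : (0 < n)%N -> schwartz f ->
  (exists M, forall u, `|f u| <= M) /\
  forall e, 0 < e -> exists2 r : R, 0 < r & forall u : Rn, r <= `|u| -> `|f u| <= e.
Proof.
move=> n0 [_ sf]; split.
  have [M fM] := sf (fun=> 0%N) (fun=> 0%N); exists M => u.
  by have := fM u; rewrite multi_partial0 big1 ?mul1r.
have H i : exists C : R, forall u : Rn, `|u ord0 i * f u| <= C.
  have [C fC] := sf (fun j => (j == i) : nat) (fun=> 0%N); exists C => u.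
  have := fC u; rewrite multi_partial0 (bigD1 i)//= eqxx expr1 big1 ?mulr1// => j ji.
  by rewrite (negbTE ji).
have [C fC] := choice H.
have C0 i : 0 <= C i by apply: le_trans (fC i 0).
move=> e e0; exists ((1 + \sum_i C i) / e).
  by rewrite divr_gt0// ltr_wpDr// sumr_ge0.
move=> u ru; rewrite leNgt; apply/negP => ef.
have : `|u| <= (\sum_i C i) / e.
  apply: norm_le_coord => [|i]; first by rewrite divr_ge0 ?(ltW e0)// sumr_ge0.
  rewrite ler_pdivlMr//; apply: (@le_trans _ _ (C i)); last first.
    by rewrite (bigD1 i)//= lerDl sumr_ge0.
  by apply: le_trans (fC i u); rewrite normrM ler_wpM2l// ltW.
apply/negP; rewrite -ltNge; apply: lt_le_trans ru.
by rewrite ltr_pM2r ?invr_gt0// ltrDr.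
Qed.

Lemma average_le_integral (f : Rn -> R) D (C L s : R) (x : Rn) : loc_integrable f ->
  tower D -> 0 < L -> 0 < s -> (forall v, `|D 0%N v| <= C) ->
  (forall v, L <= `|v| -> D 0%N v = 0) ->
  (`|average f D s x|%:E <= (s^-1 ^+ n * C ^+ n)%:E * \int[mu]_(u in ball x (L * s)) `|f u|%:E)%E.
Proof.
move=> lf tD L0 s0 DC Dout.
have Ls0 : 0 < L * s by rewrite mulr_gt0.
have sn : s^-1 ^+ n * s ^+ n = 1 by rewrite -exprMn mulVf ?gt_eqF// expr1n.
have ck : continuous (fun u => s ^+ n * kern D s x u).
  by apply: continuous_mulr; [exact: continuous_cstr|exact: kern_continuous].
have ik : mu.-integrable setT (fun u => (f u * (s ^+ n * kern D s x u))%:E).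
  apply: (@loc_integrable_mul_support _ _ _ _ (`|x| + L * s)) => //.
  by apply: ball_norm_out => u xu; rewrite (kern_out s0 L0 Dout xu) mulr0.
have -> : average f D s x = s^-1 ^+ n * \int[mu]_u (f u * (s ^+ n * kern D s x u)).
  rewrite -RintegralZl// /average; congr fine; apply: eq_integral => u _; congr EFin.
  by rewrite -[LHS]mul1r -sn; ring.
rewrite normrM ger0_norm ?exprn_ge0 ?invr_ge0 ?(ltW s0)// EFinM (EFinM (s^-1 ^+ n)) -muleA.
apply: lee_wpmul2l; first by rewrite lee_fin exprn_ge0 ?invr_ge0 ?(ltW s0).
rewrite /Rintegral -abse_EFin fineK; last exact: integrable_fin_num.
apply: integral_mul_bounded => // u.
  rewrite /kern mulrA [s ^+ n * _]mulrC sn mul1r.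
  have <- : \prod_(i < n) C = C ^+ n by rewrite prodr_const card_ord.
  by rewrite normr_prod; apply: ler_prod => j _; rewrite normr_ge0 DC.
by move=> xu; rewrite (kern_out s0 L0 Dout xu) mulr0.
Qed.

(** f is at most e outside a large ball, and this ball carries a vanishing proportion of the
    mass of the kernel as the scale grows. *)
Lemma average_vanish (f : Rn -> R) (C L e : R) : (0 < n)%N -> schwartz f -> 0 < C -> 0 < L -> 0 < e ->
  exists2 S : R, 0 < S & forall D s x, S <= s -> tower D -> (forall v, `|D 0%N v| <= C) ->
    (forall v, L <= `|v| -> D 0%N v = 0) -> `|average f D s x| <= e.
Proof.
move=> n0 sf C0 L0 e0; have [[M fM] fe] := schwartz_vanish n0 sf.
have M0 : 0 <= M by apply: le_trans (fM 0).
have K0 : 0 < (C * (2 * L)) ^+ n by rewrite exprn_gt0// !mulr_gt0.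
pose e' := e / 2 / (C * (2 * L)) ^+ n.
have e'0 : 0 < e' by rewrite !divr_gt0.
have [r r0 fr] := fe e' e'0.
pose K := M * (C * (2 * r)) ^+ n.
have K1 : 0 <= K by rewrite mulr_ge0// exprn_ge0// !mulr_ge0// ltW.
exists (1 + K / (e / 2)); first by rewrite ltr_pwDl// divr_ge0// divr_ge0// ltW.
move=> D s x Ss tD DC Dout.
have s1 : 1 <= s by apply: le_trans Ss; rewrite lerDl divr_ge0// divr_ge0// ltW.
have s0 : 0 < s by apply: lt_le_trans s1.
have cf : continuous f := (sf.1 [::]).1.
have lf : loc_integrable f := continuous_loc_integrable cf.
have mf : measurable_fun setT (f : bRn -> R) := continuous_borel_measurable cf.
have Ls0 : 0 < L * s by rewrite mulr_gt0.
have mB : @measurable _ bRn (ball x (L * s)) by apply: measurable_rV_ball.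
have mB0 : @measurable _ bRn (ball (0 : Rn) r) by apply: measurable_rV_ball.
rewrite -lee_fin; apply: (le_trans (average_le_integral x lf tD L0 s0 DC Dout)).
have I : (\int[mu]_(u in ball x (L * s)) `|f u|%:E <=
    (e' * (2 * (L * s)) ^+ n + M * (2 * r) ^+ n)%:E)%E.
  apply: (@le_trans _ _ (\int[mu]_(u in ball x (L * s)) (e'%:E + (M * \1_(ball (0 : Rn) r) u)%:E))%E).
    apply: ge0_le_integral => //.
    - by apply: measurable_funTS; apply/measurable_EFinP; exact: measurableT_comp.
    - apply: measurable_funTS; apply/measurable_EFinP; apply: measurable_funD; first exact: measurable_cst.
      by apply: measurable_funM; [exact: measurable_cst|exact: measurable_indic].
    - move=> u _; rewrite -EFinD lee_fin indicE; case: (boolP (u \in _)) => [_|].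
        by rewrite mulr1 (le_trans (fM u))// lerDr ltW.
      rewrite notin_setE mx_norm_ball /ball_/= sub0r normrN => /negP; rewrite -leNgt => ru.
      by rewrite mulr0 addr0 fr.
  rewrite ge0_integralD//; last 3 first.
  - by move=> u _; rewrite lee_fin ltW.
  - by move=> u _; rewrite lee_fin mulr_ge0.
  - apply: measurable_funTS; apply/measurable_EFinP.
    by apply: measurable_funM; [exact: measurable_cst|exact: measurable_indic].
  rewrite EFinD; apply: leeD.
    rewrite integral_cst// [leRHS]EFinM; apply: lee_wpmul2l; first by rewrite lee_fin ltW.
    rewrite (_ : ((2 * (L * s)) ^+ n)%:E = mu (ball x (L * s)))//.
    by apply/esym; exact: lebesgue_ball.
  under eq_integral do rewrite EFinM.
  rewrite ge0_integralZl_EFin//; last first.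
    by apply: measurable_funTS; apply/measurable_EFinP; exact: measurable_indic.
  rewrite integral_indic// EFinM; apply: lee_wpmul2l; first by rewrite lee_fin.
  rewrite (_ : ((2 * r) ^+ n)%:E = mu (ball (0 : Rn) r)); last first.
    by apply/esym; exact: lebesgue_ball.
  by apply: le_measure; rewrite ?inE//; exact: measurableI.
apply: (le_trans (lee_wpmul2l _ I)).
  by rewrite lee_fin mulr_ge0 ?exprn_ge0 ?invr_ge0 ?(ltW s0) ?(ltW C0).
rewrite -EFinM lee_fin.
have sn : s^-1 ^+ n * s ^+ n = 1 by rewrite -exprMn mulVf ?gt_eqF// expr1n.
have -> : s^-1 ^+ n * C ^+ n * (e' * (2 * (L * s)) ^+ n + M * (2 * r) ^+ n) =
   (s^-1 ^+ n * s ^+ n) * (e' * (C * (2 * L)) ^+ n) + s^-1 ^+ n * K.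
  rewrite /K !exprMn; ring.
rewrite sn mul1r /e' divfK ?gt_eqF// -[leRHS](@divfK _ 2)// mulr_natr mulr2n lerD2l.
apply: (@le_trans _ _ (s^-1 * K)).
  apply: ler_wpM2r => //; rewrite -[leRHS]expr1; apply: ler_wiXn2l => //.
    by rewrite invr_ge0 ltW.
  by rewrite invf_le1.
rewrite mulrC ler_pdivrMr// mulrC -ler_pdivrMr ?divr_gt0//.
by apply: le_trans Ss; rewrite lerDr.
Qed.

Lemma average_telescope (f : Rn -> R) (y : R -> nat -> R -> R) (s : R) (x : Rn) N :
  average f (y 1) s x = \sum_(k < N) (average f (y (2^-1 ^+ k)) (2 ^+ k * s) x -
    average f (y (2^-1 ^+ k / 2)) (2 * (2 ^+ k * s)) x) + average f (y (2^-1 ^+ N)) (2 ^+ N * s) x.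
Proof.
elim: N => [|N IH]; first by rewrite big_ord0 add0r !expr0 mul1r.
rewrite IH big_ord_recr/= -addrA; congr (_ + _).
by rewrite !exprS [2^-1 * _]mulrC [2 * (2 ^+ N * s)]mulrA subrK.
Qed.

Lemma geometric_sum_le (b q : R) N : 0 <= b -> 0 <= q < 1 ->
  \sum_(l < N) b * q ^+ l <= b / (1 - q).
Proof.
move=> b0 /andP[q0 q1]; have q10 : 0 < 1 - q by rewrite subr_gt0.
rewrite ler_pdivlMr// -mulr_sumr -mulrA ler_piMr//.
rewrite mulrC -[1 - q]opprB mulNr -subrX1 opprB lerBlDr lerDl exprn_ge0//.
Qed.

(** F tau s stands for the difference of averages at scale s and G s for the average.
    The sum of the differences from a scale s at most t upwards is at least c / 2.  The
    scales from s0 upwards contribute at most c / 4, so the scales below s0 contribute at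
    least c / 4, which is more than the sum of the thresholds w0 r^j. *)
Lemma scale_selection (F : R -> R -> R) (G : R -> R) (c s0 b q w0 r t : R) :
  (forall s, 0 < s -> s <= t -> c <= G s) -> 0 < c -> 0 < s0 -> 0 < t ->
  (forall s N0, 0 < s -> exists2 N, (N0 <= N)%N & G s <= \sum_(k < N) F (2^-1 ^+ k) (2 ^+ k * s) + c / 2) ->
  (forall l tau, 0 <= tau <= 1 -> F tau (2 ^+ l * s0) <= b * q ^+ l) ->
  0 <= b -> 0 <= q < 1 -> b / (1 - q) <= c / 4 ->
  0 <= w0 -> 0 <= r < 1 -> w0 / (1 - r) < c / 4 ->
  exists j tau, [/\ 0 <= tau <= 1, t < 2 * (2^-1 ^+ j * s0) & w0 * r ^+ j <= F tau (2^-1 ^+ j * s0)].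
Proof.
move=> cG c0 s00 t0 GF Fb b0 q01 bq w00 r01 wr.
have tau01 k : 0 <= (2^-1 ^+ k : R) <= 1.
  by rewrite exprn_ge0 ?exprn_ile1// ?invr_ge0// invf_le1// ler1n.
have [J0 [J0t Jmin]] : exists J, 2^-1 ^+ J * s0 <= t /\ forall j, (j < J)%N -> t < 2^-1 ^+ j * s0.
  pose P j := 2^-1 ^+ j * s0 <= t.
  have exP : exists j, P j.
    exists (Num.truncn (s0 / t)); set j := Num.truncn _; rewrite /P exprVn mulrC.
    have j2 : j.+1%:R <= 2 ^+ j :> R by rewrite -natrX ler_nat ltn_expl.
    rewrite ler_pdivrMr ?exprn_gt0// mulrC -ler_pdivrMr//.
    by apply: le_trans j2; rewrite ltW// /j truncnS_gt.
  case: (ex_minnP exP) => J PJ Jm; exists J; split => // j jJ.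
  by rewrite ltNge; apply/negP => /Jm; rewrite leqNgt jJ.
have s'0 : 0 < 2^-1 ^+ J0 * s0 :> R by rewrite mulr_gt0// exprn_gt0.
have [N JN GN] := GF _ J0 s'0.
have c2 : c / 2 <= \sum_(k < N) F (2^-1 ^+ k) (2 ^+ k * (2^-1 ^+ J0 * s0)).
  by have := cG _ s'0 J0t; lra.
have sE k : (k <= J0)%N -> 2 ^+ k * (2^-1 ^+ J0 * s0) = 2^-1 ^+ (J0 - k) * s0.
  move=> kJ; rewrite -{1}(subnKC kJ) exprD !mulrA -exprMn divff// expr1n mul1r//.
rewrite -(subnKC JN) big_split_ord/= in c2.
apply: contrapT => H; have : c / 2 < c / 4 + c / 4; last by lra.
apply: (le_lt_trans c2); apply: ltr_leD; last first.
  apply: le_trans bq; apply: le_trans (geometric_sum_le (N - J0) b0 q01).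
  apply: ler_sum => i _.
  rewrite (_ : 2 ^+ (J0 + i) * (2^-1 ^+ J0 * s0) = 2 ^+ i * s0); first exact: Fb.
  by rewrite addnC exprD -mulrA sE// subnn expr0 mul1r.
apply: le_lt_trans wr; apply: (@le_trans _ _ (\sum_(k < J0) w0 * r ^+ (J0 - k)%N)).
  apply: ler_sum => k _; rewrite sE; last exact: ltnW.
  rewrite leNgt; apply/negP => h; apply: H; exists (J0 - k)%N, (2^-1 ^+ k).
  split; [exact: tau01| |exact: ltW].
  have k1 : (0 < J0 - k)%N by rewrite subn_gt0.
  have : ((J0 - k).-1 < J0)%N by rewrite prednK// leq_subr.
  move=> /Jmin; rewrite mulrA -{2}(prednK k1) exprS mulrA divff// mul1r//.
apply: le_trans (geometric_sum_le J0 w00 r01).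
rewrite (reindex_inj rev_ord_inj)/=; apply: ler_sum => k _; apply: ler_wpM2l => //.
rewrite subKn// exprS; case/andP: r01 => r0 r1.
by apply: ler_piMl; [exact: exprn_ge0|exact: ltW].
Qed.
End averages.

(** * Lower bounds for Besov norms, and packing *)

Section kfunctional.
Variables (R : realType) (n : nat).
Local Notation Rn := 'rV[R]_n.
Local Notation bRn := (borel 'rV[R]_n).
Local Notation mu := (@lebesgue R n).

Lemma K_homo m (p t u : R) (f : Rn -> R) : 0 <= t -> t <= u ->
  (K_Lp_sobolev m p t f <= K_Lp_sobolev m p u f)%E.
Proof.
move=> t0 tu; apply: le_ereal_inf_tmp => _ [z zf <-].
apply: (@le_trans _ _ (Lp_norm p z.1 + t%:E * sobolev_norm m p z.2)%E).
  by apply: ereal_inf_lbound; exists z.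
by apply: leeD => //; apply: lee_wpmul2r; [exact: sobolev_norm_ge0|rewrite lee_fin].
Qed.

(** K is nondecreasing in t, so the integral over [t, 2t] alone already controls
    K(t, f). *)
Lemma K_le_besov_norm m (alpha p : R) (q : \bar R) : 0 < alpha < m%:R -> (0 < q)%E ->
  exists2 C : R, 0 < C & forall (f : Rn -> R) (N t : R), 0 < N -> 0 < t ->
  (besov_norm m alpha p q f <= N%:E)%E ->
  (K_Lp_sobolev m p t f <= (C * t `^ (alpha / m%:R) * N)%:E)%E.
Proof.
move=> /andP[al0 alm] q0; set th := alpha / m%:R.
have th0 : 0 < th by rewrite divr_gt0// (lt_trans al0 alm).
case: q q0 => [r|_|//]; last first.
  exists 1 => // f N t N0 t0 fN; rewrite mul1r.
  have : ((t `^ (- th))%:E * K_Lp_sobolev m p t f <= N%:E)%E.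
    apply: le_trans fN; apply: ereal_sup_ubound; exists t => //=.
    by rewrite in_itv/= t0.
  by rewrite powRN lee_pdivrMl ?powR_gt0// -EFinM.
rewrite lte_fin => r0; exists (2 `^ th * 4 `^ r^-1); first by rewrite mulr_gt0 ?powR_gt0.
move=> f N t N0 t0; rewrite /besov_norm /interpolation_norm -/th => fN.
(* the factor 4^(1/r) makes the integral over [t, 2t] at least 2 N^r, a contradiction *)
set B := _ * N; rewrite leNgt; apply/negP => BK.
pose F u := (((u `^ (- th))%:E * K_Lp_sobolev m p u f) `^ r * u^-1%:E)%E.
have F0 u : 0 < u -> (0 <= F u)%E.
  by move=> u0; rewrite mule_ge0 ?poweR_ge0// lee_fin invr_ge0 ltW.
have : (\int[lebesgue_measure]_(u in `]0%R, +oo[) F u <= (N `^ r)%:E)%E.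
  set I := (X in (X <= _)%E); have -> : I = ((I `^ r^-1) `^ r)%E.
    rewrite -poweRrM mulVf ?gt_eqF// poweRe1//.
    by apply: integral_ge0 => u /=; rewrite in_itv/= andbT; exact: F0.
  by rewrite -poweR_EFin; apply: ler_poweR; [exact: ltW|exact: poweR_ge0|].
apply/negP; rewrite -ltNge.
have B0 : 0 < B by rewrite !mulr_gt0// ?powR_gt0.
pose g : R -> \bar R := (cst (((2 * t) `^ (- th) * B) `^ r * (2 * t)^-1)%:E) \_ `[t, 2 * t].
apply: (@lt_le_trans _ _ (\int[lebesgue_measure]_(u in `]0%R, +oo[) g u)%E).
  rewrite /g -integral_mkcondr (_ : _ `&` _ = `[t, 2 * t]%classic); last first.
    apply/seteqP; split => [u []|u] //=; rewrite !in_itv/= andbT => /andP[tu ->].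
    by rewrite tu (lt_le_trans t0 tu).
  rewrite integral_cst//= lebesgue_measure_itv/= lte_fin ifT; last by lra.
  have -> : (2 * t) `^ (- th) * B = 4 `^ r^-1 * N.
    rewrite /B powRN (powRM th) ?(ltW t0)//.
    have ? : 2 `^ th != 0 :> R by rewrite gt_eqF ?powR_gt0.
    have ? : t `^ th != 0 :> R by rewrite gt_eqF ?powR_gt0.
    by field; apply/andP.
  rewrite powRM ?powR_ge0 ?(ltW N0)// -powRrM mulVf ?gt_eqF// powRr1//.
  rewrite -EFinB -EFinM lte_fin.
  rewrite (_ : 4 * N `^ r / (2 * t) * (2 * t - t) = 2 * N `^ r).
    by rewrite ltr_pMl ?powR_gt0// ltr1n.
  by field; rewrite gt_eqF.
apply: ge0_le_integral_nonmeasurable => u /=; rewrite in_itv/= andbT => u0.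
  by rewrite /g patchE; case: ifPn => // _; rewrite lee_fin mulr_ge0 ?powR_ge0// invr_ge0 mulr_ge0// ltW.
rewrite /g patchE; case: ifPn => [|_]; last exact: F0.
rewrite inE/= in_itv/= => /andP[tu ut]; rewrite EFinM /F; apply: lee_pmul.
- by rewrite lee_fin powR_ge0.
- by rewrite lee_fin invr_ge0 mulr_ge0// ltW.
- rewrite -[leLHS]poweR_EFin; apply: ler_poweR; first exact: ltW.
    by rewrite lee_fin mulr_ge0 ?powR_ge0// ltW.
  rewrite EFinM; apply: lee_pmul; rewrite ?lee_fin ?powR_ge0//; first exact: ltW.
    rewrite !powRN lef_pV2 ?posrE ?powR_gt0// ?mulr_gt0//.
    by apply: ge0_ler_powR; rewrite ?nnegrE ?(ltW th0) ?(ltW u0)// mulr_ge0// ltW.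
  by apply: (le_trans (ltW BK)); apply: K_homo; rewrite // ltW.
- by rewrite lee_fin lef_pV2// posrE ?mulr_gt0.
Qed.

(** A maximal family of points of X with disjoint balls: each ball carries mass v, and by
    maximality every point of X is within 2 r of the family. *)
Lemma packing (W : bRn -> R) (X : set Rn) (r v T : R) : 0 < r -> 0 < v ->
  (forall u, 0 <= W u) -> measurable_fun setT W -> (\int[mu]_u (W u)%:E <= T%:E)%E ->
  (forall x, X x -> (v%:E <= \int[mu]_(u in ball x r) (W u)%:E)%E) ->
  exists s : seq Rn, (size s)%:R * v <= T /\ forall x, X x -> exists2 z, z \in s & `|x - z| < 2 * r.
Proof.
move=> r0 v0 W0 mW WT XW.
pose good (s : seq Rn) := (forall x, x \in s -> X x) /\ pairwise (fun x z => 2 * r <= `|x - z|) s.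
have mB z : @measurable _ bRn (ball z r) by apply: measurable_rV_ball.
have goodT s : good s -> (size s)%:R * v <= T.
  suff H : good s -> (((size s)%:R * v)%:E <= \int[mu]_(u in \bigcup_(z in [set` s]) (ball z r : set bRn)) (W u)%:E)%E.
    move=> /H h; rewrite -lee_fin (le_trans h)// (le_trans _ WT)//.
    apply: ge0_subset_integral => //.
    - by apply: fin_bigcup_measurable => [|z _]; [exact: finite_seq|exact: mB].
    - exact/measurable_EFinP.
    - by move=> u _; rewrite lee_fin.
  elim: s => [_|z s IH [sX /= /andP[/allP zs ps]]].
    by rewrite mul0r integral_ge0// => u _; rewrite lee_fin.
  have gs : good s by split => // x xs; apply: sX; rewrite inE xs orbT.
  have -> : \bigcup_(z0 in [set` z :: s]) (ball z0 r : set bRn) =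
      ball z r `|` \bigcup_(z0 in [set` s]) (ball z0 r : set bRn).
    by rewrite !bigcup_seq big_cons.
  have mU : @measurable _ bRn (\bigcup_(z0 in [set` s]) (ball z0 r : set bRn)).
    by apply: fin_bigcup_measurable => [|x _]; [exact: finite_seq|exact: mB].
  rewrite ge0_integral_setU//; last 3 first.
  - by apply: measurable_funTS; exact/measurable_EFinP.
  - by move=> u _; rewrite lee_fin.
  - apply/disj_set2P; rewrite -subset0 => u [zu [x /= xs xu]].
    have := zs _ xs; apply/negP; rewrite -ltNge.
    move: zu xu; rewrite mx_norm_ball /ball_/= => zu xu.
    rewrite (_ : z - x = (z - u) - (x - u)); last by rewrite opprB addrA subrK.
    by apply: (le_lt_trans (ler_normB _ _)); lra.
  rewrite /= -natr1 mulrDl mul1r addrC EFinD; apply: leeD; last exact: IH.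
  by apply: XW; apply: sX; rewrite inE eqxx.
pose P k := `[< exists s, good s /\ size s = k >].
have exP : exists k, P k by exists 0%N; apply/asboolP; exists [::].
have Pb k : P k -> (k <= Num.truncn (T / v))%N.
  move=> /asboolP[s [/goodT h <-]].
  by rewrite -ltnS -(ltr_nat R) (le_lt_trans _ (truncnS_gt _))// ler_pdivlMr.
case: (ex_maxnP exP Pb) => k /asboolP[s [gs sk]] kmax.
exists s; split; first exact: goodT.
move=> x Xx; apply: contrapT => H; have := kmax k.+1.
have Pk : P k.+1.
  apply/asboolP; exists (x :: s); split; last by rewrite /= sk.
  split.
    by move=> z; rewrite inE => /orP[/eqP->//|/(gs.1)].
  rewrite /= gs.2 andbT; apply/allP => z zs; rewrite leNgt; apply/negP => h.
  by apply: H; exists z.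
by move=> /(_ Pk); rewrite ltnn.
Qed.
End kfunctional.

(** * Covering a tent by tents over balls *)

Section covering.
Variables (R : realType) (n : nat).
Local Notation Rn := 'rV[R]_n.
Local Notation bRn := (borel 'rV[R]_n).
Local Notation mu := (@lebesgue R n).

(** At this level the two terms of [average_difference] have the same size, when the
    mass on the ball is bounded by the total mass a^p. *)
Lemma optimal_level (s a p : R) : 0 < s -> 0 < a -> 1 < p ->
  s^-1 ^+ n * (a * s `^ (- (n%:R / p))) `^ (1 - p) * a `^ p = a * s `^ (- (n%:R / p)).
Proof.
move=> s0 a0 p1; have p0 : 0 < p by apply: lt_trans p1.
rewrite powRM ?powR_ge0 ?(ltW a0)// -powRrM.
have -> : s^-1 ^+ n = s `^ (- n%:R) by rewrite powRN powR_mulrn ?(ltW s0)// exprVn.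
transitivity ((a `^ (1 - p) * a `^ p) * (s `^ (- n%:R) * s `^ (- (n%:R / p) * (1 - p)))).
  by ring.
rewrite -!powRD ?(gt_eqF a0) ?(gt_eqF s0) ?implybT// subrK powRr1 ?(ltW a0)//.
by congr (_ * _ `^ _); field; rewrite gt_eqF.
Qed.

Lemma K_lt_of_besov_norm (m : nat) (alpha p : R) (q : \bar R) : 0 < alpha < m%:R -> (0 < q)%E ->
  exists2 C : R, 0 < C & forall (f : Rn -> R) (M s : R), 0 < M -> 0 < s ->
  (besov_norm m alpha p q f <= M%:E)%E ->
  (K_Lp_sobolev m p (s ^+ m) f < (C * s `^ alpha * M)%:E)%E.
Proof.
move=> alm q0; have [C C0 CP] := K_le_besov_norm n p alm q0.
have m0 : (0 : R) < m%:R by case/andP: alm; exact: lt_trans.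
exists (2 * C); first by rewrite mulr_gt0.
move=> f M s M0 s0 fM; have sm0 : 0 < s ^+ m by rewrite exprn_gt0.
apply: (le_lt_trans (CP f M _ M0 sm0 fM)).
rewrite -powR_mulrn ?(ltW s0)// -powRrM mulrCA divff ?gt_eqF// mulr1.
have h : 0 < C * s `^ alpha * M by rewrite !mulr_gt0// powR_gt0.
rewrite lte_fin; lra.
Qed.

(** With lam = w / (2 c1) the first term of [average_difference] is w / 2, and the
    other term has to account for the remaining half. *)
Lemma level_mass (w c1 c2 s p I : R) : 0 < w -> 0 < c1 -> 0 < c2 -> 0 < s -> 1 < p ->
  w <= c1 * (w / (2 * c1)) + c2 * s^-1 ^+ n * (w / (2 * c1)) `^ (1 - p) * I ->
  (2 * c1) `^ (1 - p) / (2 * c2) * w `^ p * s `^ n%:R <= I.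
Proof.
move=> w0 c10 c20 s0 p1.
have -> : c1 * (w / (2 * c1)) = w / 2 by field; rewrite gt_eqF.
set k := _ `^ (1 - p) => h.
have k0 : 0 < k by rewrite powR_gt0// divr_gt0// mulr_gt0.
have sn0 : 0 < s ^+ n by rewrite exprn_gt0.
have : w / (2 * c2 * k) * s ^+ n <= I.
  have {}h : w / 2 <= c2 * s^-1 ^+ n * k * I by lra.
  rewrite -(ler_pM2l (_ : 0 < c2 * s^-1 ^+ n * k)); last by rewrite !mulr_gt0// exprn_gt0 ?invr_gt0.
  apply: le_trans h; rewrite exprVn le_eqVlt; apply/orP; left; apply/eqP; field.
  by rewrite !gt_eqF.
apply: le_trans; rewrite powR_mulrn ?(ltW s0)// ler_pM2r//.
rewrite le_eqVlt; apply/orP; left; apply/eqP.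
have -> : k = w `^ (1 - p) / (2 * c1) `^ (1 - p).
  rewrite /k powRM ?invr_ge0 ?(ltW w0) ?mulr_ge0 ?(ltW c10)//; congr (_ * _).
  by rewrite -powR_inv1 ?mulr_ge0 ?(ltW c10)// -powRrM mulN1r powRN.
have -> : w `^ p = w / w `^ (1 - p).
  by rewrite -powRN opprB -{2}(powRr1 (ltW w0)) -powRD ?(gt_eqF w0) ?implybT//; congr (_ `^ _); ring.
have ? : w `^ (1 - p) != 0 by rewrite gt_eqF// powR_gt0.
have ? : (2 * c1) `^ (1 - p) != 0 by rewrite gt_eqF// powR_gt0// mulr_gt0.
have ? : c2 != 0 by rewrite gt_eqF.
by field; repeat (apply/andP; split).
Qed.

Definition cover_scale (A M p d : R) (j : nat) : R := 2^-1 ^+ j * (A * M `^ (p / d)).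

Lemma tent_covering (m : nat) (alpha p : R) (q : \bar R) (r : R) :
  (0 < n)%N -> 0 < alpha < m%:R -> 1 < p -> alpha * p < n%:R -> (0 < q)%E -> 0 < r < 1 ->
  exists A B C : R, [/\ 0 < A, 0 < B, 0 < C &
  forall (M : R) (f : Rn -> R) (O : set Rn), 0 < M -> schwartz f ->
    (besov_norm m alpha p q f <= M%:E)%E -> open O -> (forall x, O x -> 1 <= f x) ->
  let s := cover_scale A M p (n%:R - alpha * p) in
  exists F : nat -> seq Rn,
    (forall j, (size (F j))%:R * ((r ^+ j) `^ p * s j `^ (n%:R - alpha * p)) <= B * M `^ p) /\
    tent O `<=` \bigcup_j \bigcup_(z in [set` F j]) tent (eucl_ball z (C * s j))].
Proof.
move=> n0 alm p1 ap q0 /andP[r0 r1]; set d := n%:R - alpha * p.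
have d0 : 0 < d by rewrite subr_gt0.
have p0 : 0 < p by apply: lt_trans p1.
have m0 : (0 < m)%N by rewrite -(ltr0n R); case/andP: alm; exact: lt_trans.
have n0R : 1 <= n%:R :> R by rewrite ler1n.
have [y [eta [C' [L [c [[C'0 L1 c0] [y_eta eta_y yb yo [y1 y1o y1c]]]]]]]] := multiscale_kernels R m0.
pose C := C' + 1.
have C1 : 1 <= C by rewrite lerDr ltW.
have C0 : 0 < C by apply: lt_le_trans C1.
have L0 : 0 < L by apply: lt_le_trans L1.
have y_tower t : tower (y t) := (y_eta t).1.
have y_bound t v : 0 <= t <= 1 -> `|y t 0%N v| <= C.
  by move=> /(yb _ v)[h _]; rewrite (le_trans h)// lerDl.
have eta_bound t v : 0 <= t <= 1 -> `|eta t 0%N v| <= C.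
  by move=> /(yb _ v)[_ h]; rewrite (le_trans h)// lerDl.
have y_out t v : L <= `|v| -> y t 0%N v = 0 by move=> /(yo t)[].
have eta_out t v : L <= `|v| -> eta t 0%N v = 0 by move=> /(yo t)[].
have [CK CK0 KP] := K_lt_of_besov_norm p alm q0.
pose c1 := 2 * C ^+ n * n.+1%:R * (4 * L) ^+ n.
pose c2 := 2 * C ^+ n.
have c10 : 0 < c1 by rewrite !mulr_gt0// ?exprn_gt0// ?mulr_gt0.
have c20 : 0 < c2 by rewrite !mulr_gt0// ?exprn_gt0.
(* c3 M s^(-d/p) bounds the difference on every scale s; g is its ratio between two
   consecutive scales, and A makes the scales above s_0 contribute at most cn / 4 *)
pose c3 := (c1 + c2 * n.+1%:R) * CK.
have c30 : 0 < c3 by rewrite mulr_gt0// addr_gt0// mulr_gt0.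
pose cn := c ^+ n.
have cn0 : 0 < cn by rewrite exprn_gt0.
pose g := 2 `^ (- (d / p)).
have g0 : 0 < g by rewrite powR_gt0.
have g1 : g < 1.
  rewrite /g powRN invf_lt1 ?powR_gt0//.
  have : (1 : R) `^ (d / p) < 2 `^ (d / p) by apply: gt0_ltr_powR; rewrite ?nnegrE ?divr_gt0// ltr1n.
  by rewrite powR1.
pose A := (cn * (1 - g) / (4 * c3)) `^ (- (p / d)).
have g10 : 0 < 1 - g by rewrite subr_gt0.
have A00 : 0 < cn * (1 - g) / (4 * c3) by apply: divr_gt0; apply: mulr_gt0.
have A0 : 0 < A by rewrite powR_gt0.
have AE : A `^ (- (d / p)) = cn * (1 - g) / (4 * c3).
  rewrite -powRrM (_ : - (p / d) * - (d / p) = 1).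
    by rewrite powRr1// ltW.
  by field; rewrite !gt_eqF.
(* half the largest value for which the thresholds w0 r^j sum to at most cn / 4 *)
pose w0 := cn * (1 - r) / 8.
have w00 : 0 < w0 by rewrite divr_gt0// mulr_gt0// subr_gt0.
have w0r : w0 / (1 - r) < cn / 4.
  rewrite /w0 mulrAC mulfK ?subr_eq0 ?gt_eqF//.
  by rewrite ltr_pM2l// ltf_pV2 ?posrE// ltr_nat.
clearbody w0.
pose c4 := (2 * c1) `^ (1 - p) / (2 * c2).
have c40 : 0 < c4 by apply: divr_gt0; [apply: powR_gt0|]; exact: mulr_gt0.
exists A, (n.+1%:R * CK `^ p / (c4 * w0 `^ p)), (7 * n%:R * L).
have nR0 : 0 < n%:R :> R by rewrite ltr0n.
split=> //; first by rewrite divr_gt0// mulr_gt0 ?powR_gt0.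
  by rewrite !mulr_gt0.
move=> M f O M0 sf fM oO fO s.
have cf : continuous f := (sf.1 [::]).1.
have s0 j : 0 < s j by rewrite mulr_gt0 ?exprn_gt0// mulr_gt0// powR_gt0.
have sE j : s j = 2^-1 ^+ j * (A * M `^ (p / d)) by [].
clearbody s.
pose a (u : R) := CK * u `^ alpha * M.
have a0 u : 0 < u -> 0 < a u by move=> u0; rewrite !mulr_gt0// powR_gt0.
pose D tau u x := `|average f (y tau) u x - average f (y (tau / 2)) (2 * u) x|.
have JD u : 0 < u -> exists W : bRn -> R, [/\ forall u, 0 <= W u, measurable_fun setT W,
    (\int[mu]_u (W u)%:E <= (n.+1%:R * a u `^ p)%:E)%E &
    forall t x lam, 0 <= t <= 1 -> 0 < lam ->
    ((D t u x)%:E <= (c1 * lam)%:E + (c2 * u^-1 ^+ n * lam `^ (1 - p))%:E *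
       \int[mu]_(u in ball x (2 * L * u)) (W u)%:E)%E].
  move=> u0.
  have [eta_tower ?] : (forall t, tower (eta t)) /\ True by split => // t; exact: (y_eta t).2.
  exact: (average_difference C1 L1 y_tower eta_tower eta_y y_bound eta_bound y_out eta_out n0 cf p1 u0 (KP _ _ _ M0 u0 fM)).
have large u tau x : 0 < u -> 0 <= tau <= 1 -> D tau u x <= c3 * M * u `^ (- (d / p)).
  move=> u0 tau01; have [W [W0 mW WT WD]] := JD u u0.
  have lam0 : 0 < a u * u `^ (- (n%:R / p)) by rewrite mulr_gt0 ?a0// powR_gt0.
  rewrite -lee_fin; apply: (le_trans (WD tau x _ tau01 lam0)).
  have h : (\int[mu]_(v in (ball x (2 * L * u) : set bRn)) (W v)%:E <= (n.+1%:R * a u `^ p)%:E)%E.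
    apply: le_trans WT; apply: ge0_subset_integral => //.
    - by apply: measurable_rV_ball.
    - exact/measurable_EFinP.
    - by move=> v _; rewrite lee_fin.
  apply: le_trans (leeD (le_refl _) (lee_wpmul2l _ h)) _.
    by rewrite lee_fin mulr_ge0 ?powR_ge0// mulr_ge0 ?exprn_ge0 ?invr_ge0 ?(ltW u0) ?(ltW c20).
  rewrite -EFinM -EFinD lee_fin.
  have E := optimal_level u0 (a0 _ u0) p1.
  have alg (X P l A' N r' : R) : P * l * A' = r' -> X * P * l * (N * A') = X * N * r' by move=> <-; ring.
  rewrite (alg _ _ _ _ _ _ E) -mulrDl.
  have -> : u `^ (- (d / p)) = u `^ alpha * u `^ (- (n%:R / p)).
    rewrite -powRD ?(gt_eqF u0) ?implybT//.
    by congr (_ `^ _); rewrite /d; field; rewrite gt_eqF.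
  rewrite /c3 /a; move: (c1 + _) (u `^ alpha) (u `^ _) => X Y Z.
  by rewrite le_eqVlt; apply/orP; left; apply/eqP; ring.
pose Q j (F : seq Rn) := (size F)%:R * (c4 * (w0 * r ^+ j) `^ p * s j `^ n%:R) <= n.+1%:R * a (s j) `^ p /\
   forall x tau, 0 <= tau <= 1 -> w0 * r ^+ j <= D tau (s j) x ->
     exists2 z, z \in F & `|x - z| < 2 * (2 * L * s j).
have [F HF] : exists F, forall j, Q j (F j).
  suff : forall j, exists F, Q j F by move=> H; have [F HF] := choice H; exists F.
  move=> j.
  have [W [W0 mW WT WD]] := JD (s j) (s0 j).
  have w0j : 0 < w0 * r ^+ j by rewrite mulr_gt0// exprn_gt0.
  pose X := [set x | exists2 tau, 0 <= tau <= 1 & w0 * r ^+ j <= D tau (s j) x].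
  have rj : 0 < 2 * L * s j by apply: mulr_gt0; [exact: mulr_gt0|exact: s0].
  have vj : 0 < c4 * (w0 * r ^+ j) `^ p * s j `^ n%:R by apply: mulr_gt0; [apply: mulr_gt0; [exact: c40|exact: powR_gt0] | exact/powR_gt0/s0].
  have XW x : X x -> ((c4 * (w0 * r ^+ j) `^ p * s j `^ n%:R)%:E <= \int[mu]_(u in ball x (2 * L * s j)) (W u)%:E)%E.
    move=> [tau tau01 xw].
    set I := (X in (_ <= X)%E).
    have I0 : (0 <= I)%E by apply: integral_ge0 => v _; rewrite lee_fin.
    have Ifin : I \is a fin_num.
      rewrite ge0_fin_numE//; apply: le_lt_trans (ltry (n.+1%:R * a (s j) `^ p)).
      apply: le_trans WT; apply: ge0_subset_integral => //.
      - by apply: measurable_rV_ball.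
      - exact/measurable_EFinP.
      - by move=> v _; rewrite lee_fin.
    have lam0 : 0 < (w0 * r ^+ j) / (2 * c1) by rewrite divr_gt0// mulr_gt0.
    have := WD tau x _ tau01 lam0; rewrite -/I -(fineK Ifin) -EFinM -EFinD !lee_fin => h.
    by apply: level_mass => //; exact: le_trans h.
  have [F [F1 F2]] := packing rj vj W0 mW WT XW.
  by exists F; split => // x tau tau01 h; apply: F2; exists tau.
exists F; split.
  move=> j; have [h _] := HF j.
  move: h; set k := (size (F j))%:R; rewrite /a !powRM ?mulr_ge0 ?powR_ge0 ?exprn_ge0 ?(ltW w00) ?(ltW r0) ?(ltW CK0) ?(ltW M0)//.
  have -> : s j `^ n%:R = s j `^ d * (s j `^ alpha) `^ p.
    by rewrite -powRrM -powRD ?(gt_eqF (s0 j)) ?implybT//; congr (_ `^ _); rewrite /d; ring.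
  set X := (s j `^ alpha) `^ p => h.
  have X0 : 0 < X by rewrite !powR_gt0.
  clearbody c4; have W0 : 0 < w0 `^ p by rewrite powR_gt0.
  have U0 : 0 < c4 * w0 `^ p by rewrite mulr_gt0.
  rewrite -(ler_pM2r X0) -(ler_pM2r U0).
  set Y := (r ^+ j) `^ p in h *; set Z := s j `^ d in h *.
  apply: (@le_trans _ _ (k * (c4 * (w0 `^ p * Y) * (Z * X)))).
    by rewrite le_eqVlt; apply/orP; left; apply/eqP; ring.
  apply: (le_trans h); rewrite le_eqVlt; apply/orP; left; apply/eqP.
  by field; rewrite !gt_eqF.
move=> z [Oz tz]; set x := (set_val z).1; set t := (set_val z).2.
have t0 : 0 < t by exact: half_space_gt0.
have bO : eucl_ball x t `<=` O by exact: tent_ball_sub.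
have t'0 : 0 < t / n%:R by rewrite divr_gt0.
have S0 : 0 < A * M `^ (p / d) by rewrite mulr_gt0// powR_gt0.
have G1 u : 0 < u -> u <= t / n%:R -> cn <= average f (y 1) u x.
  move=> u0 ut; apply: (@average_ge _ _ _ _ c t) => //; first by move=> v vx; apply: fO; exact: bO.
  by rewrite mulrC -ler_pdivlMr.
have G2 u N0 : 0 < u -> exists2 N, (N0 <= N)%N &
    average f (y 1) u x <= \sum_(k < N) D (2^-1 ^+ k) (2 ^+ k * u) x + cn / 2.
  move=> u0; have cn20 : 0 < cn / 2 by rewrite divr_gt0.
  have [S S0' SP] := average_vanish n0 sf C0 L0 cn20.
  pose N := maxn N0 (Num.truncn (S / u)); exists N; first exact: leq_maxl.
  have SN : S <= 2 ^+ N * u.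
    rewrite -ler_pdivrMr//; apply: (le_trans (ltW (truncnS_gt _))).
    by rewrite -natrX ler_nat (leq_trans _ (ltn_expl N _))// ltnS leq_maxr.
  rewrite (average_telescope f y u x N); apply: lerD.
    by apply: ler_sum => k _; rewrite /D ler_norm.
  apply: (le_trans (ler_norm _)); apply: SP => // v; last exact: y_out.
  apply: y_bound; rewrite exprn_ge0 ?exprn_ile1// ?invr_ge0// invf_le1// ler1n//.
have G3 l tau : 0 <= tau <= 1 -> D tau (2 ^+ l * (A * M `^ (p / d))) x <= cn * (1 - g) / 4 * g ^+ l.
  move=> tau01; apply: (le_trans (large _ _ _ _ tau01)); first by rewrite mulr_gt0// exprn_gt0.
  have gl : (2 ^+ l) `^ (- (d / p)) = g ^+ l.
    by rewrite -[2 ^+ l]powR_mulrn// -powRrM mulrC powRrM powR_mulrn// powR_ge0.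
  rewrite powRM ?exprn_ge0 ?(ltW S0)// gl powRM ?powR_ge0 ?(ltW A0)// AE -powRrM.
  rewrite (_ : p / d * - (d / p) = -1); last by field; rewrite !gt_eqF.
  rewrite powR_inv1 ?(ltW M0)// le_eqVlt; apply/orP; left; apply/eqP.
  by field; rewrite !gt_eqF.
have q1 : 0 <= cn * (1 - g) / 4 by rewrite divr_ge0// mulr_ge0 ?(ltW cn0) ?(ltW g10).
have q2 : 0 <= g < 1 by rewrite (ltW g0).
have q3 : cn * (1 - g) / 4 / (1 - g) <= cn / 4 by rewrite mulrAC mulfK ?gt_eqF.
have q4 : 0 <= r < 1 by rewrite (ltW r0).
have [j [tau [tau01 tj wj]]] := @scale_selection _ (fun tau u => D tau u x) (fun u => average f (y 1) u x)
  cn (A * M `^ (p / d)) (cn * (1 - g) / 4) g w0 r (t / n%:R) G1 cn0 S0 t'0 G2 G3 q1 q2 q3 (ltW w00) q4 w0r.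
exists j => //; rewrite -sE in tj wj.
have [_ /(_ x tau tau01 wj)[c' c'F xc]] := HF j; exists c' => //.
apply: (@ball_in_tent _ _ _ (4 * n%:R * L * s j) (2 * n%:R * s j)).
- rewrite eucl_distC; apply: (le_trans (eucl_dist_le_norm _ _)).
  rewrite (_ : 4 * n%:R * L * s j = n%:R * (2 * (2 * L * s j))); last by ring.
  by rewrite ler_pM2l// ltW.
- by rewrite ltW// mulrAC -ltr_pdivrMr.
rewrite -mulrDl ltr_pM2r//.
have : n%:R <= n%:R * L by rewrite ler_peMr// ltW.
have : 0 < n%:R * L by rewrite mulr_gt0.
rewrite -[4 * _ * _]mulrA -[7 * _ * _]mulrA.
by move: (n%:R * L) (n%:R : R) => X Y; lra.
Qed.
End covering.

(** * Decay of the gauge function *)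

(** A step of superadditivity for the integral of a function that may not be measurable:
    a simple function below g on A can be enlarged by the value c on E. *)
Lemma integral_add_step (R : realType) d (T : measurableType d) (m : {measure set T -> \bar R})
    (A E D : set T) (g : T -> \bar R) (c : R) :
  (forall x, D x -> 0 <= g x)%E -> A `<=` D -> E `<=` D -> measurable E ->
  A `&` E = set0 -> 0 <= c -> (forall x, E x -> (c%:E <= g x)%E) -> (m E < +oo)%E ->
  (\int[m]_(x in A) g x + c%:E * m E <= \int[m]_(x in D) g x)%E.
Proof.
move=> g0 AD ED mE AE c0 cg mEoo.
have cfin : (c%:E * m E)%E \is a fin_num by rewrite fin_numM// ge0_fin_numE.
rewrite -leeBrDr// ge0_integralE; last by move=> x /AD; exact: g0.
apply: ge_ereal_sup => _ [h hg <-]; rewrite leeBrDr// -integralT_nnsfun.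
have -> : (c%:E * m E = \int[m]_x (c * \1_E x)%:E)%E.
  under eq_integral do rewrite EFinM.
  rewrite ge0_integralZl_EFin//; last by apply/measurable_EFinP; exact: measurable_indic.
  by rewrite integral_indic// setIT.
have mh : measurable_fun setT (fun x : T => (h x)%:E) by apply/measurable_EFinP; exact: measurable_funP.
have mE1 : measurable_fun setT (fun x : T => (c * \1_E x)%:E).
  apply/measurable_EFinP; apply: measurable_funM; first exact: measurable_cst.
  exact: measurable_indic.
have cE0 (x : T) : setT x -> (0 <= (c * \1_E x)%:E)%E by rewrite lee_fin mulr_ge0.
have h0 (x : T) : setT x -> (0 <= (h x)%:E)%E by rewrite lee_fin.
rewrite -(ge0_integralD m measurableT h0 mh cE0 mE1).
rewrite [leRHS]integral_mkcond; apply: ge0_le_integral_nonmeasurable => x _.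
  by apply: adde_ge0; [exact: h0|exact: cE0].
have hx := hg x; rewrite patchE in hx; rewrite patchE indicE.
have [Ex|nEx] := boolP (x \in E).
  have nA : x \notin A.
    apply/negP => /set_mem Ax; have : (A `&` E) x by split => //; exact: set_mem.
    by rewrite AE.
  rewrite (negbTE nA) in hx.
  rewrite mem_set; last by apply: ED; exact: set_mem.
  rewrite mulr1 (_ : (h x)%:E = 0%E) ?add0e; first by apply: cg; exact: set_mem.
  by apply/eqP; rewrite eq_le hx/= lee_fin.
rewrite mulr0 adde0; apply: (le_trans hx); case: ifPn => [/set_mem Ax|_].
  by rewrite mem_set//; exact: AD.
by case: ifPn => // /set_mem; exact: g0.
Qed.

(** Let I s be the integral of g u / u over ]0, s[.  The part over [s, 2 s[ is at least a
    multiple of g s, hence of I s by hypothesis.  So I (2 s) >= (1 + e) I s for some e > 0,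
    I decays geometrically along dyadic scales, and so does g, since g s is at most a
    multiple of I (2 s). *)
Lemma dyadic_decay (R : realType) (g : R -> R) (K k : R) : 0 < K -> 0 < k ->
  (forall u, 0 < u -> 0 <= g u) ->
  (forall s, 0 < s -> (\int[@lebesgue_measure R]_(u in `]0%R, s[) (g u / u)%:E <= (K * g s)%:E)%E) ->
  (forall s u, 0 < s -> s <= u -> u <= 2 * s -> k * g s <= g u) ->
  exists rho C : R, [/\ 0 < rho < 1, 0 < C & forall s j, 0 < s -> g (2^-1 ^+ j * s) <= C * rho ^+ j * g s].
Proof.
move=> K0 k0 g0 gK gk.
pose I s := (\int[@lebesgue_measure R]_(u in `]0%R, s[) (g u / u)%:E)%E.
have I0 s : 0 < s -> (0 <= I s)%E.
  move=> s0; apply: integral_ge0 => u /=; rewrite in_itv/= => /andP[u0 _].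
  by rewrite lee_fin divr_ge0 ?g0// ltW.
have Ifin s : 0 < s -> I s \is a fin_num.
  by move=> s0; rewrite ge0_fin_numE ?I0// (le_lt_trans (gK _ s0))// ltry.
pose J s := fine (I s).
have JE s : 0 < s -> (J s)%:E = I s by move=> s0; rewrite /J fineK// Ifin.
have J0 s : 0 < s -> 0 <= J s by move=> s0; rewrite fine_ge0// I0.
have JK s : 0 < s -> J s <= K * g s.
  by move=> s0; rewrite -lee_fin JE// gK.
have step s : 0 < s -> J s + k / 2 * g s <= J (2 * s).
  move=> s0; have s20 : 0 < 2 * s by rewrite mulr_gt0.
  rewrite -lee_fin EFinD !JE//.
  apply: (@le_trans _ _ (I s + (k * g s / (2 * s))%:E * @lebesgue_measure R `[s, (2 * s)%R[)%E).
    rewrite leeD2l// lebesgue_measure_itv/= lte_fin ifT; last by lra.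
    rewrite -EFinB -EFinM lee_fin le_eqVlt; apply/orP; left; apply/eqP.
    by field; rewrite gt_eqF.
  have Eoo : (@lebesgue_measure R `[s, (2 * s)%R[ < +oo)%E.
    by rewrite lebesgue_measure_itv/= lte_fin ifT -?EFinB ?ltry//; lra.
  apply: integral_add_step.
  - by move=> u /=; rewrite in_itv/= => /andP[u0 _]; rewrite lee_fin divr_ge0 ?g0// ltW.
  - by move=> u /=; rewrite !in_itv/= => /andP[-> us]/=; lra.
  - by move=> u /=; rewrite !in_itv/= => /andP[su ->]; rewrite (lt_le_trans s0).
  - exact: measurable_itv.
  - by rewrite -subset0 => u [] /=; rewrite !in_itv/= => /andP[_ us] /andP[su _]; lra.
  - by rewrite divr_ge0 ?mulr_ge0 ?g0 ?ltW.
  - move=> u /=; rewrite in_itv/= => /andP[su us]; have u0 : 0 < u := lt_le_trans s0 su.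
    rewrite lee_fin; apply: ler_pM.
    + by rewrite mulr_ge0 ?g0// ltW.
    + by rewrite invr_ge0 mulr_ge0// ltW.
    + by apply: gk => //; exact: ltW.
    + by rewrite lef_pV2 ?posrE ?mulr_gt0// ltW.
  - exact: Eoo.
pose e := k / (2 * K); have e0 : 0 < e by rewrite divr_gt0 ?mulr_gt0.
pose rho := (1 + e)^-1.
have rho0 : 0 < rho by rewrite invr_gt0; lra.
have rho1 : rho < 1 by rewrite invf_lt1; lra.
have Jr s : 0 < s -> J s <= rho * J (2 * s).
  move=> s0; rewrite /rho mulrC ler_pdivlMr; last by lra.
  apply: le_trans (step _ s0); rewrite mulrDr mulr1 lerD2l.
  apply: (@le_trans _ _ (K * g s * e)); first by rewrite ler_pM2r ?JK.
  by rewrite /e le_eqVlt; apply/orP; left; apply/eqP; field; rewrite gt_eqF.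
have Jj s j : 0 < s -> J (2^-1 ^+ j * s) <= rho ^+ j * J s.
  move=> s0; elim: j => [|j IH]; first by rewrite !expr0 !mul1r.
  have h : 0 < 2^-1 ^+ j.+1 * s by rewrite mulr_gt0// exprn_gt0.
  apply: (le_trans (Jr _ h)); rewrite [rho ^+ _]exprS -mulrA ler_pM2l//.
  by rewrite (_ : 2 * (2^-1 ^+ j.+1 * s) = 2^-1 ^+ j * s)// exprS; field.
exists rho, (1 + 2 * K / (k * rho)); split; first by rewrite rho0.
  by rewrite addr_gt0// divr_gt0// mulr_gt0.
move=> s [|j] s0.
  by rewrite !expr0 mulr1 mul1r ler_peMl ?g0// lerDl divr_ge0// mulr_ge0// ltW.
have h : 0 < 2^-1 ^+ j.+1 * s by rewrite mulr_gt0// exprn_gt0.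
have E : 2 * (2^-1 ^+ j.+1 * s) = 2^-1 ^+ j * s by rewrite exprS; field.
have H := step _ h; rewrite E in H.
have {}H : k / 2 * g (2^-1 ^+ j.+1 * s) <= rho ^+ j * (K * g s).
  apply: (@le_trans _ _ (J (2^-1 ^+ j * s))); first by have := J0 _ h; lra.
  by apply: (le_trans (Jj _ _ s0)); rewrite ler_pM2l ?JK// exprn_gt0.
apply: (@le_trans _ _ (2 * K / (k * rho) * rho ^+ j.+1 * g s)).
  rewrite -(@ler_pM2l _ (k / 2)) ?divr_gt0//; apply: (le_trans H).
  rewrite exprS le_eqVlt; apply/orP; left; apply/eqP; field; rewrite !gt_eqF//.
by rewrite ler_wpM2r ?g0// ler_wpM2r ?exprn_ge0 ?ltW// ltrDr.
Qed.

Lemma prec_on_EFin (T : Type) (R : realType) (D : set T) (X Y : T -> R) :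
  prec_on D (fun s => (X s)%:E) (fun s => (Y s)%:E) ->
  exists2 c : R, 0 < c & forall s, D s -> X s <= c * Y s.
Proof. by move=> [c c0 XY]; exists c => // s /XY; rewrite -EFinM lee_fin. Qed.

Section capacity.
Variables (R : realType) (n : nat).
Local Notation Rn := 'rV[R]_n.

Lemma besov_capacity_ge0 m (alpha p : R) q (O : set Rn) : (0 <= besov_capacity m alpha p q O)%E.
Proof. by apply: le_ereal_inf_tmp => _ [f _ <-]; exact: poweR_ge0. Qed.

Lemma besov_capacity_lt m (alpha p M : R) q (O : set Rn) : 0 < p -> 0 < M ->
  (besov_capacity m alpha p q O < (M `^ p)%:E)%E ->
  exists f, [/\ schwartz f, forall x, O x -> 1 <= f x & (besov_norm m alpha p q f <= M%:E)%E].
Proof.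
move=> p0 M0 /ereal_inf_lt[_ [f [sf f0 f1] <-] fM]; exists f; split => //.
rewrite leNgt; apply/negP => Mf; move: fM; apply/negP; rewrite -leNgt -poweR_EFin.
by apply: ler_poweR; rewrite ?lee_fin ltW.
Qed.

End capacity.

(** [dyadic_decay] for g s = (Phi s / s^d)^(1/p), which loses at most a constant factor
    over one dyadic step because Phi is almost increasing. *)
Lemma gauge_decay (R : realType) (Phi : R -> R) (d p CM : R) : 0 < d -> 0 < p -> 0 < CM ->
  (forall s : R, 0 <= s -> 0 <= Phi s) ->
  (forall s t, 0 <= s -> s <= t -> Phi s <= CM * Phi t) ->
  prec_on [set s : R | 0 < s]
    (fun s => \int[@lebesgue_measure R]_(u in `]0%R, s[) ((Phi u / u `^ d) `^ p^-1 / u)%:E)%E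
    (fun s => ((Phi s / s `^ d) `^ p^-1)%:E) ->
  exists rho C : R, [/\ 0 < rho < 1, 0 < C & forall s j, 0 < s ->
    Phi (2^-1 ^+ j * s) / (2^-1 ^+ j * s) `^ d <= C * (rho ^+ j) `^ p * (Phi s / s `^ d)].
Proof.
move=> d0 p0 CM0 Phi_ge0 Phi_mono [K K0 PK]; pose g s := (Phi s / s `^ d) `^ p^-1.
have r0 s : 0 < s -> 0 <= Phi s / s `^ d.
  by move=> s0; rewrite divr_ge0 ?powR_ge0// Phi_ge0// ltW.
have [||||rho [C [rho01 C0 H]]] := @dyadic_decay R g K ((CM * 2 `^ d)^-1 `^ p^-1) K0.
- by rewrite powR_gt0// invr_gt0 mulr_gt0// powR_gt0.
- by move=> u _; exact: powR_ge0.
- by move=> s s0; rewrite EFinM; exact: PK.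
- move=> s u s0 su us; have u0 := lt_le_trans s0 su.
  rewrite /g -powRM ?r0 ?invr_ge0 ?mulr_ge0 ?powR_ge0 ?(ltW CM0)//.
  apply: ge0_ler_powR; rewrite ?nnegrE ?invr_ge0 ?(ltW p0) ?r0//.
    by rewrite mulr_ge0 ?r0// invr_ge0 mulr_ge0 ?powR_ge0 ?(ltW CM0).
  rewrite ler_pdivlMr ?powR_gt0// -mulrA mulrC ler_pdivrMr ?mulr_gt0 ?powR_gt0//.
  apply: (@le_trans _ _ (Phi s / s `^ d * (2 * s) `^ d)).
    rewrite ler_wpM2l ?r0// ge0_ler_powR ?nnegrE ?(ltW d0) ?(ltW u0)//.
    by rewrite mulr_ge0// ltW.
  rewrite powRM ?(ltW s0)// (_ : _ * _ = Phi s * 2 `^ d); last first.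
    by field; rewrite gt_eqF ?powR_gt0.
  apply: (@le_trans _ _ (CM * Phi u * 2 `^ d)).
    by rewrite ler_pM2r ?powR_gt0// Phi_mono// ltW.
  by rewrite le_eqVlt; apply/orP; left; apply/eqP; ring.
exists rho, (C `^ p); split => //; first by rewrite powR_gt0.
move=> s j s0; have sj0 : 0 < 2^-1 ^+ j * s by rewrite mulr_gt0// exprn_gt0.
have gp u : 0 < u -> g u `^ p = Phi u / u `^ d.
  by move=> u0; rewrite /g -powRrM mulVf ?gt_eqF// powRr1// r0.
have rj : 0 <= rho ^+ j by rewrite exprn_ge0//; case/andP: rho01 => /ltW.
rewrite -!gp// -!powRM ?mulr_ge0 ?powR_ge0 ?(ltW C0)//.
apply: ge0_ler_powR; rewrite ?nnegrE ?mulr_ge0 ?powR_ge0 ?(ltW C0) ?(ltW p0)//.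
exact: H.
Qed.

(** * Measure of a tent *)

Section tent_measure.
Variables (R : realType) (n : nat).
Local Notation Rn := 'rV[R]_n.
Variable nu : {measure set (borel (half_space R n)) -> \bar R}.

Lemma measure_tents_le (s : seq Rn) (r v : R) :
  (forall x, (nu (tent (eucl_ball x r)) <= v%:E)%E) ->
  (nu (\bigcup_(z in [set` s]) tent (eucl_ball z r)) <= ((size s)%:R * v)%:E)%E.
Proof.
have mt x : @measurable _ (borel (half_space R n)) (tent (eucl_ball x r)).
  by apply: measurable_tent; exact: open_eucl_ball.
move=> H; rewrite bigcup_seq; elim: s => [|z s IH]; first by rewrite big_nil measure0 mul0r.
rewrite big_cons; apply: (le_trans (measureU2 _ _ _)) => //.
  by rewrite -bigcup_seq; apply: fin_bigcup_measurable => [|x _]; [exact: finite_seq|exact: mt].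
by rewrite /= -natr1 mulrDl mul1r addrC EFinD; apply: leeD.
Qed.

Lemma nneseries_geometric_le (u : nat -> \bar R) (b q : R) : 0 <= b -> 0 <= q < 1 ->
  (forall j, 0 <= u j)%E -> (forall j, u j <= (b * q ^+ j)%:E)%E ->
  (\sum_(0 <= j <oo) u j <= (b / (1 - q))%:E)%E.
Proof.
move=> b0 q01 u0 ub; apply: lime_le.
  by apply: is_cvg_nneseries => j _ _; exact: u0.
apply: nearW => N; rewrite big_mkord.
apply: (@le_trans _ _ (\sum_(j < N) (b * q ^+ j)%:E)%E); first by apply: lee_sum => j _.
by rewrite sumEFin lee_fin geometric_sum_le.
Qed.

Variables (m : nat) (alpha p : R) (q : \bar R).
Hypotheses (n0 : (0 < n)%N) (alm : 0 < alpha < m%:R) (p1 : 1 < p) (ap : alpha * p < n%:R) (q0 : (0 < q)%E).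
Local Notation d := (n%:R - alpha * p).
Variables (Phi : R -> R).
Hypothesis Phi_ge0 : forall s : R, 0 <= s -> 0 <= Phi s.
Hypothesis Phi_dil : forall c : R, 0 < c -> exists2 C : R, 0 < C & forall s, 0 < s -> Phi (c * s) <= C * Phi s.

(** For the covering with r = sqrt rho, the balls of scale s_j contribute at most a
    multiple of M^p r^(-jp) Phi (s_j) / s_j^d, that is of
    M^p r^(jp) Phi (s_0) / s_0^d, where s_0^d is a multiple of M^p. *)
Lemma tent_measure_le (rho C0 cnu : R) : 0 < rho < 1 -> 0 < C0 -> 0 < cnu ->
  (forall s j, 0 < s ->
    Phi (2^-1 ^+ j * s) / (2^-1 ^+ j * s) `^ d <= C0 * (rho ^+ j) `^ p * (Phi s / s `^ d)) ->
  (forall x r, 0 < r -> (nu (tent (eucl_ball x r)) <= (cnu * Phi r)%:E)%E) ->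
  exists2 K : R, 0 < K & forall (M : R) (f : Rn -> R) (O : set Rn), 0 < M -> schwartz f ->
    (besov_norm m alpha p q f <= M%:E)%E -> open O -> (forall x, O x -> 1 <= f x) ->
    (nu (tent O) <= (K * Phi (M `^ (p / d)))%:E)%E.
Proof.
move=> /andP[rho0 rho1] C00 cnu0 decay ball_le.
have d0 : 0 < d by rewrite subr_gt0.
have p0 : 0 < p by apply: lt_trans p1.
pose r := Num.sqrt rho.
have r0 : 0 < r by rewrite sqrtr_gt0.
(* half of the decay of the gauge pays for the thresholds, half is left for summation *)
have rr : r ^+ 2 = rho by rewrite sqr_sqrtr// ltW.
have r1 : r < 1 by rewrite -(@ltr_pXn2r _ 2) ?nnegrE ?(ltW r0)// rr expr1n.
have r01 : 0 < r < 1 by rewrite r0.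
have [A [B [C [A0 B0 Cgt0 cover]]]] := tent_covering n0 alm p1 ap q0 r01.
have [CA CA0 PA] := Phi_dil A0; have [CC CC0 PC] := Phi_dil Cgt0.
have k01 : 0 <= r `^ p < 1.
  rewrite powR_ge0/=; have : r `^ p < 1 `^ p by apply: gt0_ltr_powR; rewrite ?nnegrE ?(ltW r0).
  by rewrite powR1.
have k10 : 0 < 1 - r `^ p by rewrite subr_gt0; case/andP: k01.
pose K0 := cnu * CC * B * C0 * CA / A `^ d.
have K00 : 0 < K0 by rewrite divr_gt0 ?powR_gt0// !mulr_gt0.
exists (K0 / (1 - r `^ p)); first by rewrite divr_gt0.
move=> M f O M0 sf fM oO fO.
have [F [FB tF]] := cover M f O M0 sf fM oO fO.
set s := cover_scale A M p d in FB tF.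
have Mp0 : 0 < M `^ (p / d) by rewrite powR_gt0.
have s0 j : 0 < s j by rewrite mulr_gt0 ?exprn_gt0// mulr_gt0.
pose G j : set (borel (half_space R n)) := \bigcup_(z in [set` F j]) tent (eucl_ball z (C * s j)).
have mG j : measurable (G j).
  apply: fin_bigcup_measurable => [|x _]; first exact: finite_seq.
  by apply: measurable_tent; exact: open_eucl_ball.
apply: (le_trans (measure_sigma_subadditive nu mG _ tF)); first exact: measurable_tent.
have PM0 : 0 <= Phi (M `^ (p / d)) by rewrite Phi_ge0// ltW.
rewrite mulrAC; apply: nneseries_geometric_le => // [|j]; first by rewrite mulr_ge0// ltW.
have Csj : 0 < C * s j by rewrite mulr_gt0.
apply: (le_trans (measure_tents_le (F j) (fun x => ball_le x _ Csj))).
rewrite lee_fin; have := FB j; set k := (size _)%:R => kB.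
have k0 : 0 <= k by rewrite ler0n.
have Pj := PC _ (s0 j).
have sE : s j = 2^-1 ^+ j * (A * M `^ (p / d)) by [].
clearbody s.
have AM0 : 0 < A * M `^ (p / d) by rewrite mulr_gt0.
have Dj := decay _ j AM0; rewrite -sE in Dj.
have PAM := PA _ Mp0.
have Ad : (A * M `^ (p / d)) `^ d = A `^ d * M `^ p.
  by rewrite powRM ?(ltW A0) ?(ltW Mp0)// -powRrM divfK// gt_eqF.
have Rj : (rho ^+ j) `^ p = (r ^+ j) `^ p * (r `^ p) ^+ j.
  rewrite -rr -exprM mulnC exprM expr2 powRM ?exprn_ge0 ?(ltW r0)//; congr (_ * _).
  by rewrite -powR_mulrn ?(ltW r0)// -powRrM mulrC powRrM powR_mulrn// powR_ge0.
rewrite Rj Ad in Dj.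
have X0 : 0 < (r ^+ j) `^ p by rewrite powR_gt0 ?exprn_gt0.
have Z0 : 0 < s j `^ d by rewrite powR_gt0.
have a0 : 0 < A `^ d by rewrite powR_gt0.
have m0 : 0 < M `^ p by rewrite powR_gt0.
have y0 : 0 <= (r `^ p) ^+ j by rewrite exprn_ge0// powR_ge0.
have P1 : Phi (s j) <= C0 * ((r ^+ j) `^ p * (r `^ p) ^+ j) * (CA * Phi (M `^ (p / d)) / (A `^ d * M `^ p)) * s j `^ d.
  rewrite -ler_pdivrMr//; apply: (le_trans Dj); apply: ler_wpM2l.
    by rewrite !mulr_ge0 ?powR_ge0 ?(ltW C00).
  by rewrite ler_pM2r ?invr_gt0 ?mulr_gt0.
apply: (@le_trans _ _ (k * (cnu * (CC * Phi (s j))))).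
  by rewrite ler_wpM2l// ler_pM2l.
apply: (@le_trans _ _ (k * (cnu * (CC * (C0 * ((r ^+ j) `^ p * (r `^ p) ^+ j) * (CA * Phi (M `^ (p / d)) / (A `^ d * M `^ p)) * s j `^ d))))).
  by rewrite ler_wpM2l// ler_pM2l// ler_pM2l.
move: kB; rewrite /K0; move: X0 Z0 a0 m0 y0 PM0.
move: (Phi (M `^ _)) ((r ^+ j) `^ p) (s j `^ d) (A `^ d) (M `^ p) ((r `^ p) ^+ j) => P X Z a b Y X0 Z0 a0 b0 Y0 P0 kB.
rewrite (_ : k * _ = (k * (X * Z)) * (cnu * CC * C0 * CA * P * Y / (a * b))); last first.
  by field; rewrite !gt_eqF.
apply: (@le_trans _ _ (B * b * (cnu * CC * C0 * CA * P * Y / (a * b)))).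
  rewrite ler_wpM2r// divr_ge0 ?mulr_ge0 ?(ltW a0) ?(ltW b0) ?(ltW cnu0) ?(ltW CC0) ?(ltW C00) ?(ltW CA0)//.
by rewrite le_eqVlt; apply/orP; left; apply/eqP; field; rewrite !gt_eqF.
Qed.
End tent_measure.

(** * Equality of the two classes *)

Theorem theorem2p3 (R : realType) (n m : nat) (alpha p : R) (q : \bar R)
  (Phi : R -> R)
  (n_ge1 : (1 <= n)%N) (alpha_gt0 : 0 < alpha)
  (p_gt1 : 1 < p) (p_lt : p < n%:R / alpha)
  (q_gt0 : (0 < q)%E) (alpha_lt_m : alpha < m%:R)
  (Phi_ge0 : forall s : R, 0 <= s -> 0 <= Phi s)
  (Phi_onto : forall y : R, 0 <= y -> exists2 s : R, 0 <= s & Phi s = y)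
  (Phi_gt0 : forall s : R, 0 < s -> 0 < Phi s)
  (Phi_increasing : exists2 Psi : R -> R,
     (forall s t : R, 0 <= s -> s < t -> Psi s < Psi t) &
     approx_on [set s : R | 0 <= s] (fun s => (Phi s)%:E) (fun s => (Psi s)%:E))
  (Phi0 : Phi 0 = 0)
  (Phi_dilation : forall c : R, 0 < c ->
     approx_on [set s : R | 0 < s]
       (fun s => (Phi (c * s))%:E) (fun s => (Phi s)%:E))
  (Phi_integral :
     prec_on [set s : R | 0 < s]
       (fun s => \int[@lebesgue_measure R]_(u in `]0%R, s[)
          ((Phi u / u `^ (n%:R - alpha * p)) `^ p^-1 / u)%:E)%E
       (fun s => ((Phi s / s `^ (n%:R - alpha * p)) `^ p^-1)%:E)) :
  Cap_class (@besov_capacity R n m alpha p q)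
    (fun s => Phi (s `^ (n%:R - alpha * p)^-1)) =
  @C_class R n Phi.
Proof.
set d := n%:R - alpha * p.
have p0 : 0 < p by apply: lt_trans p_gt1.
have ap : alpha * p < n%:R by rewrite mulrC -ltr_pdivlMr.
have d0 : 0 < d by rewrite subr_gt0.
have d1 : 0 < d^-1 by rewrite invr_gt0.
have alm : 0 < alpha < m%:R by rewrite alpha_gt0.
have [CM CM0 mono] : exists2 C : R, 0 < C & forall s t, 0 <= s -> s <= t -> Phi s <= C * Phi t.
  have [Psi Psi_inc [/prec_on_EFin[a a0 aP] /prec_on_EFin[b b0 bP]]] := Phi_increasing.
  exists (a * b); first by rewrite mulr_gt0.
  move=> s t s0 st; have t0 := le_trans s0 st.
  apply: (le_trans (aP s s0)); rewrite -mulrA ler_pM2l//.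
  apply: le_trans (bP t t0); move: st; rewrite le_eqVlt => /orP[/eqP->//|st].
  by rewrite ltW// Psi_inc.
have dil (c : R) : 0 < c -> exists2 C : R, 0 < C & forall s, 0 < s -> Phi (c * s) <= C * Phi s.
  by move=> /Phi_dilation[/prec_on_EFin[C C0 CP] _]; exists C.
apply/seteqP; split => nu.
  move=> [c c0 cP]; have [C C0 capC] := besov_capacity_ball n alm p0 q_gt0.
  have C10 : 0 < C `^ d^-1 by rewrite powR_gt0.
  have [C2 C20 C2P] := dil _ C10.
  exists (c * (CM * C2)); first by rewrite !mulr_gt0.
  move=> [x r] /= r0; have capr := capC x r r0.
  have cap0 := @besov_capacity_ge0 R n m alpha p q (eucl_ball x r).
  have capoo : (besov_capacity m alpha p q (eucl_ball x r) < +oo)%E.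
    by apply: le_lt_trans capr _; rewrite ltry.
  have capf : besov_capacity m alpha p q (eucl_ball x r) \is a fin_num by rewrite ge0_fin_numE.
  have := cP (eucl_ball x r) (conj (@open_eucl_ball _ _ x r) capoo).
  move=> /le_trans; apply; rewrite -!EFinM lee_fin -mulrA ler_pM2l// -mulrA.
  rewrite -(fineK capf) lee_fin in capr.
  have v0 : 0 <= fine (besov_capacity m alpha p q (eucl_ball x r)) by rewrite fine_ge0.
  apply: (@le_trans _ _ (CM * Phi (C `^ d^-1 * r))); last by rewrite ler_pM2l// C2P.
  apply: mono; first exact: powR_ge0.
  apply: (@le_trans _ _ ((C * r `^ d) `^ d^-1)).
    by apply: ge0_ler_powR; rewrite ?nnegrE ?(ltW d1)// mulr_ge0 ?powR_ge0// ltW.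
  by rewrite powRM ?powR_ge0 ?(ltW C0)// -powRrM mulfV ?gt_eqF// powRr1// ltW.
move=> [cnu cnu0 ball_le].
have [rho [C0 [rho01 C00 decay]]] := gauge_decay d0 p0 CM0 Phi_ge0 mono Phi_integral.
have ball_le' x r : 0 < r -> (nu (tent (eucl_ball x r)) <= (cnu * Phi r)%:E)%E.
  by move=> r0; rewrite EFinM; exact: (ball_le (x, r)).
have [K K0 KP] := tent_measure_le n_ge1 alm p_gt1 ap q_gt0 Phi_ge0 dil rho01 C00 cnu0 decay ball_le'.
have c20 : 0 < 2 `^ d^-1 :> R by rewrite powR_gt0.
have [C2 C20 C2P] := dil _ c20.
exists (K * C2); first by rewrite mulr_gt0.
move=> O [oO capoo]; have cap0 := @besov_capacity_ge0 R n m alpha p q O.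
have capf : besov_capacity m alpha p q O \is a fin_num by rewrite ge0_fin_numE.
have := fine_ge0 cap0; set v := fine _; rewrite le_eqVlt => /orP[/eqP v0|v0].
  rewrite -v0 powR0 ?gt_eqF// Phi0 mule0.
  apply/lee_addgt0Pr => e e0; rewrite add0e.
  (* capacity 0: every M > 0 is allowed, and M^(p/d) is taken to be a point where
     Phi is e / K *)
  have [s s0 sP] := Phi_onto _ (ltW (divr_gt0 e0 K0)).
  have {}s0 : 0 < s.
    rewrite lt_neqAle s0 andbT; apply/eqP => sE; move: sP; rewrite -sE Phi0 => /eqP.
    by rewrite lt_eqF// divr_gt0.
  have M0 : 0 < s `^ (d / p) by rewrite powR_gt0.
  have capM : (besov_capacity m alpha p q O < ((s `^ (d / p)) `^ p)%:E)%E.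
    by rewrite -(fineK capf) -/v -v0 lte_fin powR_gt0.
  have [f [sf f1 fM]] := besov_capacity_lt p0 M0 capM.
  apply: (le_trans (KP _ f O M0 sf fM oO f1)).
  rewrite -powRrM (_ : d / p * (p / d) = 1); last by field; rewrite !gt_eqF.
  by rewrite powRr1 ?(ltW s0)// sP mulrC divfK ?gt_eqF.
have M0 : 0 < (2 * v) `^ p^-1 by rewrite powR_gt0// mulr_gt0.
have capM : (besov_capacity m alpha p q O < (((2 * v) `^ p^-1) `^ p)%:E)%E.
  rewrite -powRrM mulVf ?gt_eqF// powRr1 ?mulr_ge0 ?(ltW v0)//.
  by rewrite -(fineK capf) -/v lte_fin ltr_pMl// ltr1n.
have [f [sf f1 fM]] := besov_capacity_lt p0 M0 capM.
apply: (le_trans (KP _ f O M0 sf fM oO f1)).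
rewrite -EFinM lee_fin -mulrA ler_pM2l//.
rewrite -powRrM (_ : p^-1 * (p / d) = d^-1); last by field; rewrite !gt_eqF.
by rewrite powRM ?(ltW v0)// C2P// powR_gt0.
Qed.
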